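(* Suppose $d=d(n)$ satisfies $dn$ even, $d=O(\sqrt n)$ and $d\to\infty$. Let $Z_{C_3}$ be the number of triangles in ${\mathcal G}(n,d)$ and $\mu_{C_3}={\mathbb E}Z_{C_3}$. Then \[ \frac{Z_{C_3}-\mu_{C_3}}{\sqrt{\mu_{C_3}}}\xrightarrow{d}{\mathcal N}(0,1)\quad\text{as }n\to\infty. \]
   Context: ${\mathcal G}(n,d)$ is a uniformly random $d$-regular simple graph on vertex set $[n]$. *)

(* Defs.v *)
From HB Require Import structures.
From mathcomp Require Import all_boot all_order all_algebra.
From mathcomp Require Import all_classical all_reals all_analysis.
Set Implicit Arguments. Unset Strict Implicit. Unset Printing Implicit Defensive.
Import Order.TTheory GRing.Theory Num.Theory.
Local Open Scope ring_scope.

Definition graph (n : nat) := {ffun 'I_n * 'I_n -> bool}.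

Definition is_simple n (G : graph n) : bool :=
  [forall i, forall j, G (i, j) == G (j, i)] && [forall i, ~~ G (i, i)].

Definition is_regular n (d : nat) (G : graph n) : bool :=
  [forall i, #|[set j | G (i, j)]| == d].

Definition reg_graphs (n d : nat) : {set graph n} :=
  [set G | is_simple G && is_regular d G].

Definition num_triangles n (G : graph n) : nat :=
  #|[set S : {set 'I_n} | (#|S| == 3)%N &&
      [forall i in S, forall j in S, (i != j) ==> G (i, j)]]|.

Definition Gnd_prob {R : realType} (n d : nat) (E : graph n -> bool) : R :=
  (#|[set G in reg_graphs n d | E G]|%:R) / (#|reg_graphs n d|%:R).

Definition Gnd_expect {R : realType} (n d : nat) (X : graph n -> R) : R :=
  (\sum_(G in reg_graphs n d) X G) / (#|reg_graphs n d|%:R).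

Arguments Gnd_prob {R} n d E.
Arguments Gnd_expect {R} n d X.

Definition mu_C3 {R : realType} (n d : nat) : R :=
  Gnd_expect n d (fun G => (num_triangles G)%:R).

Definition std_normal_cdf {R : realType} (x : R) : \bar R :=
  normal_prob 0 1 `]-oo, x]%classic.

(* Main.v *)
(** Stein's method driven by switchings.  Let [T = 6 Z] count ordered triangles.
    In a path [a x z y b] with [xy] and [ab] non-adjacent, replacing the edges
    [ax, yb] by [xy, ab] keeps the graph regular and creates the triangle [xzy];
    the reverse move starts from a triangle and a disjoint edge.  Matching the two
    kinds of sites gives, for every [h],
      [E (h(G) L(G)) = E (sum over the path sites s of h(switched G))],
    where [L = (nd - 2d^2) T] and the number of path sites is
    [nd(d-1)^3 - d^2 T - C5], up to errors controlled by bounds on the expected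
    number of small subgraphs when [d^2 = O(n)].  A switching changes [Z] by 1 plus
    terms counting common neighbours; summed over all sites these terms cancel up
    to lower order thanks to the weak law [E (h (C_k - d^k)) = O(d^(k-1))] for cycle
    counts, which follows from the same identity applied to longer cycles.  With
    [W = (Z - center) / sqrt (d^3 / 6)] this yields
      [|E (W phi(W)) - E (phi'(W))| = O(1 / sqrt d)]
    for bounded [phi] with bounded Lipschitz derivative.  Taking [phi = atan] shows
    tightness; taking for [phi] the solution of Stein's equation with a compactly
    supported right-hand side identifies the limit on trapezoids, between which the
    indicator of a half-line is squeezed.  Finally [E Z = d^3/6 + O(d^2)], so
    centering and scaling by [E Z] is asymptotically the same as using [W]. *)

Require Import Defs.
From HB Require Import structures.
From mathcomp Require Import all_boot all_order all_algebra.
From mathcomp Require Import all_classical all_reals all_analysis.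
From mathcomp Require Import measurable_realfun ring lra zify.
Import Order.TTheory GRing.Theory Num.Theory.
Import numFieldTopology.Exports numFieldNormedType.Exports.
Local Open Scope classical_set_scope.
Local Open Scope ring_scope.
Set Implicit Arguments. Unset Strict Implicit. Unset Printing Implicit Defensive.

(** * Sums over sequences and switchings *)

(** When [d] is of order [sqrt n], the codegree terms in the summed triangle change are as large as
    the main term [n d^4]: each is about [d^6]. Bounding them is not enough; they have to cancel,
    [d^2 d^4 + d^6 - 2 d^3 d^3 = 0], up to [O(d^5) = O(n d^3)]. The cancellation must survive
    multiplication by a function of [Z], which is why the weak law carries a factor [h]. That law
    may be crude about [h]: a change of [O(1 / d)] per created triangle suffices, so the argument is
    not circular.

    The rate [1 / sqrt d] compares an error [n d^2] with the coefficient of [E (W phi(W))], of order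
    [n d^(5/2)]. Terms of order [n d^3] in the number of path sites can therefore not be dropped;
    hence the exact [(d - 1)^3] and the [d^5] in the centring.

    A right-hand side of Stein's equation with compact support and Gaussian mean zero has a
    compactly supported solution, so no Gaussian tail estimate enters its bounds. Regular graphs are
    exhibited as circulants, because over an empty set [Gnd_expect] is zero and the expectation of 1
    would not be 1. *)

Section TupleSums.
Variables (R : realType) (T : finType).
Implicit Types (F : seq T -> R) (s : seq T).

(** The recursion makes the sum compute to nested sums over single vertices, while the summand can
    still be written by matching on the sequence; the front entries can then be summed out first. *)
Fixpoint sumt (k : nat) (F : seq T -> R) : R :=
  if k is k'.+1 then \sum_(x : T) sumt k' (fun s => F (x :: s)) else F [::].

Lemma eq_sumt k F1 F2 :
  (forall s, size s = k -> F1 s = F2 s) -> sumt k F1 = sumt k F2.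
Proof.
elim: k F1 F2 => [|k IH] F1 F2 H /=; first exact: H.
by apply: eq_bigr => x _; apply: IH => s hs; apply: H; rewrite /= hs.
Qed.

Lemma ler_sumt k F1 F2 :
  (forall s, size s = k -> F1 s <= F2 s) -> sumt k F1 <= sumt k F2.
Proof.
elim: k F1 F2 => [|k IH] F1 F2 H /=; first exact: H.
by apply: ler_sum => x _; apply: IH => s hs; apply: H; rewrite /= hs.
Qed.

Lemma sumtD k F1 F2 : sumt k (fun s => F1 s + F2 s) = sumt k F1 + sumt k F2.
Proof.
elim: k F1 F2 => [|k IH] F1 F2 //=.
by rewrite -big_split /=; apply: eq_bigr => x _; rewrite IH.
Qed.

Lemma sumtZ k (c : R) F : sumt k (fun s => c * F s) = c * sumt k F.
Proof.
elim: k F => [|k IH] F //=.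
by rewrite mulr_sumr; apply: eq_bigr => x _; rewrite IH.
Qed.

Lemma sumtZr k (c : R) F : sumt k (fun s => F s * c) = sumt k F * c.
Proof. by rewrite mulrC -sumtZ; apply: eq_sumt => s _; rewrite mulrC. Qed.

Lemma sumtN k F : sumt k (fun s => - F s) = - sumt k F.
Proof. by rewrite -mulN1r -sumtZ; apply: eq_sumt => s _; rewrite mulN1r. Qed.

Lemma sumtB k F1 F2 : sumt k (fun s => F1 s - F2 s) = sumt k F1 - sumt k F2.
Proof. by rewrite sumtD sumtN. Qed.

Lemma sumt_ge0 k F : (forall s, size s = k -> 0 <= F s) -> 0 <= sumt k F.
Proof.
elim: k F => [|k IH] F H /=; first exact: H.
by apply: sumr_ge0 => x _; apply: IH => s hs; apply: H; rewrite /= hs.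
Qed.

Lemma sumt_cst k (c : R) : sumt k (fun=> c) = #|T|%:R ^+ k * c.
Proof.
elim: k => [|k IH] /=; first by rewrite expr0 mul1r.
by rewrite IH sumr_const exprS -mulrA mulr_natl.
Qed.

Lemma sumt_sum k (I : Type) (r : seq I) (P : pred I) (F : I -> seq T -> R) :
  sumt k (fun s => \sum_(i <- r | P i) F i s) = \sum_(i <- r | P i) sumt k (F i).
Proof.
elim: k F => [|k IH] F //=.
by rewrite exchange_big /=; apply: eq_bigr => x _; rewrite IH.
Qed.

Lemma ler_norm_sumt k F : `|sumt k F| <= sumt k (fun s => `|F s|).
Proof.
elim: k F => [|k IH] F //=.
by apply: le_trans (ler_norm_sum _ _ _) _; apply: ler_sum.
Qed.

End TupleSums.

Section Switch.
Variables (n d : nat).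
Notation V := 'I_n.
Implicit Types (G : graph n) (x y a b u v : V).

Definition adj G : rel V := fun x y => G (x, y).

Lemma reg_sym G : G \in reg_graphs n d -> symmetric (adj G).
Proof.
rewrite inE => /andP[/andP[/forallP h _] _] x y.
by move: (h x) => /forallP /(_ y) /eqP.
Qed.

Lemma reg_irr G : G \in reg_graphs n d -> irreflexive (adj G).
Proof.
by rewrite inE => /andP[/andP[_ /forallP h] _] x; apply/negbTE/h.
Qed.

Lemma reg_deg G x : G \in reg_graphs n d -> (\sum_y adj G x y)%N = d.
Proof.
rewrite inE => /andP[_ /forallP /(_ x) /eqP] <-.
rewrite -sum1_card [RHS]big_mkcond /=; apply: eq_bigr => y _.
by rewrite inE /adj; case: (G _).
Qed.

(** Toggling the 4-cycle [x y b a] by exclusive or makes the map its own inverse, so one definition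
    serves both directions of the switching. *)
Definition sw x y b a G : graph n :=
  [ffun p => G p (+) (p \in [:: (x, y); (y, x); (y, b); (b, y);
                               (b, a); (a, b); (a, x); (x, a)])].

Lemma c4_sym x y b a u v :
  ((u, v) \in [:: (x, y); (y, x); (y, b); (b, y); (b, a); (a, b); (a, x); (x, a)]) =
  ((v, u) \in [:: (x, y); (y, x); (y, b); (b, y); (b, a); (a, b); (a, x); (x, a)]).
Proof.
rewrite !inE !xpair_eqE.
by case: (u == x); case: (u == y); case: (u == b); case: (u == a);
   case: (v == x); case: (v == y); case: (v == b); case: (v == a).
Qed.

Lemma swK x y b a : involutive (sw x y b a).
Proof. by move=> G; apply/ffunP => p; rewrite !ffunE -addbA addbb addbF. Qed.

Lemma adj_sw x y b a G u v : adj (sw x y b a G) u v =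
  adj G u v (+) ((u, v) \in [:: (x, y); (y, x); (y, b); (b, y);
                               (b, a); (a, b); (a, x); (x, a)]).
Proof. by rewrite /adj ffunE. Qed.

Lemma sw_row x y b a G i p q : p != q -> adj G i p != adj G i q ->
  (forall j, adj (sw x y b a G) i j = adj G i j (+) ((j == p) || (j == q))) ->
  (\sum_j adj (sw x y b a G) i j = \sum_j adj G i j)%N.
Proof.
move=> pq hne h.
rewrite (bigD1 p) //= (bigD1 q) /=; last by rewrite eq_sym.
rewrite [RHS](bigD1 p) //= [in RHS](bigD1 q) /=; last by rewrite eq_sym.
rewrite !h !eqxx (negbTE pq) [q == p]eq_sym (negbTE pq) /=.
rewrite (eq_bigr (fun j => adj G i j : nat)).
  by case: (adj G i p) hne; case: (adj G i q) => //=; lia.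
by move=> j /andP[/negbTE jp /negbTE jq]; rewrite h jp jq addbF.
Qed.

(** The edges of the 4-cycle are alternately present and absent, so each of its four vertices meets
    one of each kind and [sw_row] applies. *)
Lemma sw_reg x y b a G : uniq [:: x; y; b; a] ->
  adj G x y = adj G b a -> adj G y b = adj G a x -> adj G x y != adj G y b ->
  G \in reg_graphs n d -> sw x y b a G \in reg_graphs n d.
Proof.
move=> U exy eyb ne hG; have sG := reg_sym hG; have iG := reg_irr hG.
have dG := fun x => reg_deg x hG.
move: U; rewrite /= !inE !negb_or !andbT => /and3P[/and3P[xy xb xa] /andP[yb ya] ba].
have yx : y != x by rewrite eq_sym.
have bx : b != x by rewrite eq_sym.
have ax : a != x by rewrite eq_sym.
have byy : b != y by rewrite eq_sym.
have ay : a != y by rewrite eq_sym.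
have ab : a != b by rewrite eq_sym.
have N := (negbTE xy, negbTE xb, negbTE xa, negbTE yb, negbTE ya, negbTE ba,
  negbTE yx, negbTE bx, negbTE ax, negbTE byy, negbTE ay, negbTE ab).
rewrite /is_simple /is_regular; apply/andP; split; [apply/andP; split|].
- apply/forallP => i; apply/forallP => j.
  rewrite -/(adj (sw x y b a G) i j) -/(adj (sw x y b a G) j i) !adj_sw (sG i j).
  by rewrite c4_sym.
- apply/forallP => i.
  rewrite -/(adj (sw x y b a G) i i) adj_sw iG /= !inE !xpair_eqE.
  have [->|ix] := eqVneq i x; first by rewrite !N.
  have [->|iy] := eqVneq i y; first by rewrite !N.
  have [->|ib] := eqVneq i b; first by rewrite !N.
  by rewrite /= andbF.
apply/forallP => i.
have -> : #|[set j | sw x y b a G (i, j)]%SET| = (\sum_j adj (sw x y b a G) i j)%N.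
  rewrite -sum1_card big_mkcond /=; apply: eq_bigr => j _.
  by rewrite inE /adj; case: (sw _ _ _ _ _ _).
rewrite -[X in _ == X](dG i); apply/eqP.
have [-> | ix] := eqVneq i x.
  apply: (@sw_row _ _ _ _ _ _ y a) => //.
    by rewrite (sG x a) -eyb.
  by move=> j; rewrite adj_sw !inE !xpair_eqE !eqxx !N /= ?orbF.
have [-> | iy] := eqVneq i y.
  apply: (@sw_row _ _ _ _ _ _ x b) => //.
    by rewrite (sG y x).
  by move=> j; rewrite adj_sw !inE !xpair_eqE !eqxx !N /= ?orbF.
have [-> | ib] := eqVneq i b.
  apply: (@sw_row _ _ _ _ _ _ y a) => //.
    by rewrite (sG b y) -exy eq_sym.
  by move=> j; rewrite adj_sw !inE !xpair_eqE !eqxx !N /= ?orbF.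
have [-> | ia] := eqVneq i a.
  apply: (@sw_row _ _ _ _ _ _ b x) => //.
    by rewrite (sG a b) -exy -eyb.
  by move=> j; rewrite adj_sw !inE !xpair_eqE !eqxx !N /= ?orbF.
apply: eq_bigr => j _; rewrite adj_sw !inE !xpair_eqE.
by rewrite (negbTE ix) (negbTE iy) (negbTE ib) (negbTE ia) /= addbF.
Qed.

End Switch.

(** * Expectations over regular graphs *)

Section Expectation.
Variables (R : realType) (n d : nat).
Notation V := 'I_n.
Notation Reg := (reg_graphs n d).
Notation Ex := (@Gnd_expect R n d).
Implicit Types (G : graph n) (X Y : graph n -> R).

Lemma eq_Ex X Y : (forall G, G \in Reg -> X G = Y G) -> Ex X = Ex Y.
Proof. by move=> h; rewrite /Gnd_expect (eq_bigr _ h). Qed.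

Lemma ler_Ex X Y : (forall G, G \in Reg -> X G <= Y G) -> Ex X <= Ex Y.
Proof.
move=> h; rewrite /Gnd_expect ler_wpM2r ?invr_ge0 //.
by apply: ler_sum.
Qed.

Lemma Ex_ge0 X : (forall G, G \in Reg -> 0 <= X G) -> 0 <= Ex X.
Proof. by move=> h; rewrite /Gnd_expect mulr_ge0 ?invr_ge0 // sumr_ge0. Qed.

Lemma ExD X Y : Ex (fun G => X G + Y G) = Ex X + Ex Y.
Proof. by rewrite /Gnd_expect big_split /= mulrDl. Qed.

Lemma ExZ (c : R) X : Ex (fun G => c * X G) = c * Ex X.
Proof. by rewrite /Gnd_expect -mulr_sumr mulrA. Qed.

Lemma ExZr (c : R) X : Ex (fun G => X G * c) = Ex X * c.
Proof. by rewrite mulrC -ExZ; apply: eq_Ex => G _; rewrite mulrC. Qed.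

Lemma ExN X : Ex (fun G => - X G) = - Ex X.
Proof. by rewrite -mulN1r -ExZ; apply: eq_Ex => G _; rewrite mulN1r. Qed.

Lemma ExB X Y : Ex (fun G => X G - Y G) = Ex X - Ex Y.
Proof. by rewrite ExD ExN. Qed.

Lemma Ex_norm X : `|Ex X| <= Ex (fun G => `|X G|).
Proof.
rewrite /Gnd_expect normrM [`|_^-1|]ger0_norm ?invr_ge0 //.
by rewrite ler_wpM2r ?invr_ge0 // ler_norm_sum.
Qed.

Lemma Ex_norm_le X Y :
  (forall G, G \in Reg -> `|X G| <= Y G) -> `|Ex X| <= Ex Y.
Proof. by move=> h; apply: le_trans (Ex_norm _) _; apply: ler_Ex. Qed.

Lemma Ex_cst (c : R) : (0 < #|Reg|)%N -> Ex (fun=> c) = c.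
Proof.
move=> h; rewrite /Gnd_expect sumr_const -(mulr_natr c) mulfK //.
by rewrite pnatr_eq0 -lt0n.
Qed.

Lemma Ex_sumt k (F : graph n -> seq V -> R) :
  Ex (fun G => sumt k (F G)) = sumt k (fun s => Ex (fun G => F G s)).
Proof. by rewrite /Gnd_expect -sumt_sum -sumtZr. Qed.

Lemma Ex_sum (I : Type) (r : seq I) (P : pred I) (F : I -> graph n -> R) :
  Ex (fun G => \sum_(i <- r | P i) F i G) = \sum_(i <- r | P i) Ex (F i).
Proof. by rewrite /Gnd_expect exchange_big mulr_suml. Qed.

(** The change of variables behind every switching identity: the involution [sw] matches the regular
    graphs satisfying [c] with those satisfying [c'], and the uniform measure is unchanged. *)
Lemma Ex_sw x y b a (c c' : graph n -> bool) (h : graph n -> R) :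
  (forall G, G \in Reg -> c G ->
     (sw x y b a G \in Reg) && c' (sw x y b a G)) ->
  (forall G, G \in Reg -> c' G ->
     (sw x y b a G \in Reg) && c (sw x y b a G)) ->
  Ex (fun G => (c G)%:R * h G) = Ex (fun G => (c' G)%:R * h (sw x y b a G)).
Proof.
move=> h1 h2; rewrite /Gnd_expect; congr (_ / _).
transitivity (\sum_(G in Reg | c G) h G).
  by rewrite [RHS]big_mkcondr /=; apply: eq_bigr => G _; case: (c G);
     rewrite ?mul1r ?mul0r.
transitivity (\sum_(G in Reg | c' G) h (sw x y b a G)); last first.
  by rewrite big_mkcondr /=; apply: eq_bigr => G _; case: (c' G);
     rewrite ?mul1r ?mul0r.
rewrite (reindex_inj (inv_inj (swK x y b a))) /=; apply: eq_bigl => G.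
apply/andP/andP => -[g1 g2].
  by have /andP[] := h1 _ g1 g2; rewrite swK.
by have /andP[] := h2 _ g1 g2.
Qed.

(** With only one direction available, injectivity of [sw] still compares the two probabilities. *)
Lemma Ex_sw_le x y b a (c c' : graph n -> bool) :
  (forall G, G \in Reg -> c G ->
     (sw x y b a G \in Reg) && c' (sw x y b a G)) ->
  Ex (fun G => (c G)%:R) <= Ex (fun G => (c' G)%:R).
Proof.
move=> h1; rewrite /Gnd_expect ler_wpM2r ?invr_ge0 //.
rewrite -!natr_sum ler_nat -!big_mkcondr /=.
rewrite [X in (_ <= X)%N](reindex_inj (inv_inj (swK x y b a))) /=.
rewrite big_mkcond [X in (_ <= X)%N]big_mkcond /=; apply: leq_sum => G _.
by case: ifP => // /andP[g1 g2]; rewrite h1.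
Qed.

(** Edge lists without loops and without repetition in either orientation, so that the edges can be
    peeled off one at a time by [edge_prob]. *)
Definition goodl (T : eqType) := fix goodl (S : seq (T * T)) : bool :=
  if S is p :: S' then [&& p.1 != p.2, p \notin S', (p.2, p.1) \notin S' & goodl S']
  else true.

Definition has_all G (S : seq (V * V)) := all (fun p => adj G p.1 p.2) S.

Lemma sum_adj G x : G \in Reg -> \sum_y (adj G x y)%:R = d%:R :> R.
Proof. by move=> hG; rewrite -natr_sum (reg_deg x hG). Qed.

Lemma sum_adj_r G x : G \in Reg -> \sum_y (adj G y x)%:R = d%:R :> R.
Proof.
by move=> hG; rewrite -(sum_adj x hG); apply: eq_bigr => y _; rewrite (reg_sym hG).
Qed.

Lemma sum_adj2 G : G \in Reg -> \sum_x \sum_y (adj G x y)%:R = n%:R * d%:R :> R.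
Proof.
move=> hG; under eq_bigr do rewrite sum_adj //.
by rewrite sumr_const card_ord mulr_natl.
Qed.

(* Switch [xy] and an edge [ba] to [xa], [yb]: each graph containing [S] arises at most
   [d ^ 2] times, and the left factor bounds the number of admissible [ba] from below. *)
Lemma edge_prob (S : seq (V * V)) x y : x != y -> (x, y) \notin S -> (y, x) \notin S ->
  (n%:R * d%:R - 2 * d%:R * (d%:R + 1) - 2 * (size S)%:R) *
     Ex (fun G => (has_all G ((x, y) :: S))%:R)
  <= d%:R ^+ 2 * Ex (fun G => (has_all G S)%:R) :> R.
Proof.
move=> xy xyS yxS.
pose c G a b := [&& has_all G ((x, y) :: S), adj G b a, a != x, b != y,
  ~~ adj G a x, ~~ adj G b y, (a, b) \notin S & (b, a) \notin S].
pose c' G a b := [&& has_all G S, adj G x a & adj G y b].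
apply: (@le_trans _ _ (Ex (fun G => \sum_a \sum_b (c G a b)%:R))).
  rewrite -ExZ; apply: ler_Ex => G hG.
  have sG := reg_sym hG.
  case hS : (has_all G _); last first.
    by rewrite mulr0; apply: sumr_ge0 => a _; apply: sumr_ge0.
  rewrite mulr1.
  (* A union bound: each way in which the edge [ba] fails to be admissible is subtracted as an
     indicator. The six sums below cost [d], [d], [d^2], [d^2], [size S], [size S], which add up to
     the loss in the statement. *)
  apply: (@le_trans _ _ (\sum_a \sum_b ((adj G b a)%:R - (a == x)%:R * (adj G b a)%:R
     - (b == y)%:R * (adj G b a)%:R - (adj G a x)%:R * (adj G b a)%:R
     - (adj G b y)%:R * (adj G b a)%:R - ((a, b) \in S)%:R - ((b, a) \in S)%:R))).
    have E1 : \sum_a \sum_b (adj G b a)%:R = n%:R * d%:R :> R.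
      by rewrite exchange_big /=; exact: sum_adj2.
    have E2 : \sum_a \sum_b (a == x)%:R * (adj G b a)%:R = d%:R :> R.
      rewrite (bigD1 x) //= [X in _ + X]big1 => [|a /negbTE ax]; last first.
        by apply: big1 => b _; rewrite ax mul0r.
      by rewrite addr0; under eq_bigr do rewrite eqxx mul1r; exact: sum_adj_r.
    have E3 : \sum_a \sum_b (b == y)%:R * (adj G b a)%:R = d%:R :> R.
      rewrite exchange_big (bigD1 y) //= [X in _ + X]big1 => [|b /negbTE yb]; last first.
        by apply: big1 => a _; rewrite yb mul0r.
      by rewrite addr0; under eq_bigr do rewrite eqxx mul1r; exact: sum_adj.
    have E4 : \sum_a \sum_b (adj G a x)%:R * (adj G b a)%:R = d%:R * d%:R :> R.
      under eq_bigr do rewrite -mulr_sumr sum_adj_r //.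
      by rewrite -mulr_suml sum_adj_r.
    have E5 : \sum_a \sum_b (adj G b y)%:R * (adj G b a)%:R = d%:R * d%:R :> R.
      rewrite exchange_big /=; under eq_bigr do rewrite -mulr_sumr sum_adj //.
      by rewrite -mulr_suml sum_adj_r.
    have E6 : \sum_a \sum_b ((a, b) \in S)%:R <= (size S)%:R :> R.
      rewrite pair_big /= -natr_sum ler_nat.
      apply: leq_trans (card_size S).
      rewrite -sum1_card [X in (_ <= X)%N]big_mkcond /=.
      by apply: leq_sum => -[a b] _ /=; case: (_ \in _).
    have E7 : \sum_a \sum_b ((b, a) \in S)%:R <= (size S)%:R :> R.
      rewrite exchange_big /= pair_big /= -natr_sum ler_nat.
      apply: leq_trans (card_size S).
      rewrite -sum1_card [X in (_ <= X)%N]big_mkcond /=.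
      by apply: leq_sum => -[a b] _ /=; case: (_ \in _).
    under eq_bigr do rewrite !sumrB.
    rewrite !sumrB E1 E2 E3 E4 E5.
    by lra.
  apply: ler_sum => a _; apply: ler_sum => b _.
  rewrite /c hS /=.
  case: (adj G b a) => /=; last by rewrite !mulr0 !subr0; do 2 case: (_ \in S) => /=; lra.
  case: (a == x); case: (b == y); case: (adj G a x); case: (adj G b y);
    case: (_ \in S); case: (_ \in S) => /=; lra.
rewrite Ex_sum; under eq_bigr do rewrite Ex_sum.
apply: (@le_trans _ _ (\sum_a \sum_b Ex (fun G => (c' G a b)%:R))); last first.
  under eq_bigr do rewrite -Ex_sum.
  rewrite -Ex_sum -ExZ; apply: ler_Ex => G hG.
  under eq_bigr do under eq_bigr do rewrite /c' -mulnb natrM -mulnb natrM.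
  under eq_bigr do rewrite -mulr_sumr -mulr_sumr sum_adj //.
  rewrite -mulr_sumr -mulr_suml sum_adj // -expr2 mulrC.
  by [].
apply: ler_sum => a _; apply: ler_sum => b _.
apply: (@Ex_sw_le x y b a) => G hG /andP[hS /andP[ba /andP[ax /and5P[bY nax nby abS baS]]]].
have sG := reg_sym hG; have iG := reg_irr hG.
move: hS => /= /andP[Exy hS].
have yb : y != b by rewrite eq_sym.
have xa : x != a by rewrite eq_sym.
have xb : x != b by apply: contraNneq nax => ->; rewrite sG.
have ya : y != a by apply: contraNneq nby => ->.
have bna : b != a by apply: contraTneq ba => ->; rewrite iG.
have U : uniq [:: x; y; b; a].
  by rewrite /= !inE !negb_or xy xb xa yb ya bna.
rewrite sw_reg //=; [|by rewrite Exy ba|by rewrite (negbTE nax) sG (negbTE nby)|].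
  rewrite /c'; apply/and3P; split.
  - apply/allP => -[u v] uvS; rewrite adj_sw.
    have huv := allP hS _ uvS; rewrite huv /=.
    apply/negP; rewrite !inE => /orP[/eqP e|/orP[/eqP e|/orP[/eqP e|/orP[/eqP e|
      /orP[/eqP e|/orP[/eqP e|/orP[/eqP e|/eqP e]]]]]]].
    + by rewrite e (negbTE xyS) in uvS.
    + by rewrite e (negbTE yxS) in uvS.
    + by case: e huv => -> ->; rewrite /= sG (negbTE nby).
    + by case: e huv => -> ->; rewrite /= (negbTE nby).
    + by rewrite e (negbTE baS) in uvS.
    + by rewrite e (negbTE abS) in uvS.
    + by case: e huv => -> ->; rewrite /= (negbTE nax).
    + by case: e huv => -> ->; rewrite /= sG (negbTE nax).
  - by rewrite adj_sw sG (negbTE nax) /= !inE eqxx !orbT.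
  - by rewrite adj_sw sG (negbTE nby) /= !inE eqxx !orbT.
by rewrite (sG y b) (negbTE nby) Exy.
Qed.

End Expectation.

(** * Patterns, cycles and the switching identity *)

Section Patterns.
Variables (R : realType) (n d : nat).
Notation V := 'I_n.
Notation Reg := (reg_graphs n d).
Notation Ex := (@Gnd_expect R n d).
Implicit Types (G : graph n) (x y a b : V).

(* [Es] lists the edges of a pattern on the vertices [0, .., k - 1];
   [inj_count] counts its injective copies in [G]. *)
Definition inst (T : eqType) (x0 : T) (s : seq T) (Es : seq (nat * nat)) :=
  [seq (nth x0 s e.1, nth x0 s e.2) | e <- Es].

Definition inj_count (x0 : V) G k (Es : seq (nat * nat)) : R :=
  sumt k (fun s => (uniq s && has_all G (inst x0 s Es))%:R).

Definition good_pattern k (Es : seq (nat * nat)) :=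
  goodl Es && all (fun e => (e.1 < k)%N && (e.2 < k)%N) Es.

Lemma good_inst (T : eqType) (x0 : T) (s : seq T) k Es : size s = k -> uniq s ->
  good_pattern k Es -> goodl (inst x0 s Es).
Proof.
move=> hs us /andP[]; elim: Es => //= -[i j] Es IH.
move=> /and4P[/= ij h1 h2 h3] /andP[/andP[ik jk] hk]; rewrite IH // andbT.
rewrite nth_uniq ?hs // ij /=.
have aux i' j' : (i' < k)%N -> (j' < k)%N -> (i', j') \notin Es ->
    (nth x0 s i', nth x0 s j') \notin inst x0 s Es.
  move=> ik' jk'; apply: contraNN => /mapP[[u v] uvEs /= [/eqP e1 /eqP e2]].
  have /andP[/= uk vk] := allP hk _ uvEs.
  move: e1 e2; rewrite !nth_uniq ?hs // => /eqP -> /eqP ->.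
  exact: uvEs.
by rewrite !aux.
Qed.

Section Sparse.
Hypotheses (d_gt0 : (0 < d)%N) (dn : (4 * (d + 1) + 80 <= n)%N).

Let q : R := 2 * d%:R / n%:R.

(** Iterates [edge_prob]. For at most 20 edges, [4 (d + 1) + 80 <= n] makes the loss
    [2 d (d + 1) + 40] at most half of [n d], so each edge costs a factor
    [d^2 / (n d / 2) = 2 d / n]. *)
Lemma has_all_prob (S : seq (V * V)) : (0 < #|Reg|)%N ->
  goodl S -> (size S <= 20)%N ->
  Ex (fun G => (has_all G S)%:R) <= q ^+ size S.
Proof.
move=> Reg_gt0; elim: S => [_ _|[x y] S IH].
  by rewrite expr0 (eq_Ex (Y := fun=> 1)) ?Ex_cst.
move=> /= /and4P[/= xy xyS yxS gS] sS; have {}IH := IH gS (ltnW sS).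
have := @edge_prob R n d S x y xy xyS yxS.
set P1 := Ex _; set P0 := Ex _ in IH * => H.
have d1 : 1 <= d%:R :> R by rewrite ler1n.
have s20 : (size S)%:R <= 20 :> R by rewrite ler_nat ltnW.
have dnR : 4 * (d%:R + 1) + 80 <= n%:R :> R.
  by have := dn; rewrite -(ler_nat R) natrD natrM natrD.
have n0 : 0 < n%:R :> R by lra.
have P1_ge0 : 0 <= P1 by apply: Ex_ge0.
rewrite exprS /q.
apply: (@le_trans _ _ (2 * d%:R / n%:R * P0)); last first.
  by apply: ler_wpM2l IH; rewrite divr_ge0 ?mulr_ge0.
have h1 : n%:R * d%:R / 2 * P1 <= d%:R ^+ 2 * P0.
  apply: le_trans H; apply: ler_wpM2r => //.
  by nra.
have h2 : n%:R * P1 <= 2 * d%:R * P0.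
  rewrite -(@ler_pM2l _ (d%:R / 2)) ?divr_gt0 //; last by lra.
  by lra.
rewrite -(@ler_pM2l _ n%:R) //; apply: le_trans h2 _.
by rewrite le_eqVlt; apply/orP; left; apply/eqP; field; rewrite lt0r_neq0.
Qed.

Lemma inj_count_le x0 k Es : (0 < #|Reg|)%N ->
  good_pattern k Es -> (size Es <= 20)%N ->
  Ex (fun G => inj_count x0 G k Es) <= n%:R ^+ k * q ^+ size Es.
Proof.
move=> Reg_gt0 gE sE; rewrite /inj_count Ex_sumt.
have q0 : 0 <= q by rewrite divr_ge0 ?mulr_ge0.
rewrite -[n in n%:R ^+ _]card_ord -sumt_cst; apply: ler_sumt => s hs.
case us : (uniq s) => /=; last by rewrite Ex_cst // exprn_ge0.
rewrite -(size_map (fun e => (nth x0 s e.1, nth x0 s e.2)) Es).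
by apply: has_all_prob; rewrite ?size_map // (good_inst _ hs us).
Qed.

End Sparse.

(* Each cycle of length [m + 1] is counted [2 (m + 1)] times. *)
Definition cyc m G : R :=
  sumt m.+1 (fun s => if s is x :: p then
    ([&& uniq s, path (adj G) x p & adj G (last x p) x])%:R else 0).

(* [pc] describes the sites [b :: a :: x :: p] of a switching: the path [a, x, p, b],
   whose last inner vertex is [y = last x p], is closed into the cycle [x :: p] by
   exchanging the edges [ax], [yb] for [xy], [ab].  [lc] describes the sites of the
   reverse switching. *)
Definition pc G s := if s is b :: a :: x :: p then
  [&& uniq s, adj G a x, path (adj G) x p, adj G b (last x p),
      ~~ adj G x (last x p) & ~~ adj G a b] else false.

Definition lc G s := if s is b :: a :: x :: p then
  [&& uniq s, adj G a b, path (adj G) x p, adj G x (last x p),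
      ~~ adj G b (last x p) & ~~ adj G a x] else false.

Definition sws s G := if s is b :: a :: x :: p then sw x (last x p) b a G else G.

(** Of the four toggled edges only the one joining [x] to [last x p] has both ends on [x :: p], and
    these two are not consecutive once [p] has at least two entries. *)
Lemma path_sw G x p a b : uniq [:: b, a, x & p] -> (1 < size p)%N ->
  path (adj (sw x (last x p) b a G)) x p = path (adj G) x p.
Proof.
case: p => [|z p] // U; rewrite /= ltnS => p0; set y := last z p.
have zy : z != y.
  rewrite /y; move: U p0; case/lastP: p {y} => // p y.
  rewrite last_rcons /= => /and4P[_ _ _ /andP[zp _]] _.
  by apply: contraNneq zp => ->; rewrite mem_rcons mem_head.
move: U => /= /and4P[hb ha hx /andP[hz up]].
move: hb; rewrite !in_cons !negb_or => /and4P[ba bx bz bp].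
move: ha; rewrite !in_cons !negb_or => /and3P[ax az ap].
move: hx; rewrite !in_cons !negb_or => /andP[xz xp].
have zx : z != x by rewrite eq_sym.
have za : z != a by rewrite eq_sym.
have zb : z != b by rewrite eq_sym.
rewrite adj_sw; congr (_ && _).
  by rewrite !inE !xpair_eqE (negbTE zx) (negbTE zy) (negbTE za) !(andbF, orbF)
    (negbTE zb) !andbF addbF.
apply: (@eq_in_path _ (mem (z :: p))); last exact/allP.
move=> u v; rewrite ?inE => hu hv.
have N w r : (r \notin z :: p) -> w \in z :: p -> w != r.
  by move=> h; apply: contraTneq => ->.
have [hx ha hb] : [/\ x \notin z :: p, a \notin z :: p & b \notin z :: p].
  by rewrite !in_cons !negb_or xz xp az ap bz bp.
have /negbTE ux := N u x hx hu; have /negbTE ua := N u a ha hu.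
have /negbTE ub := N u b hb hu; have /negbTE vx := N v x hx hv.
have /negbTE va := N v a ha hv; have /negbTE vb := N v b hb hv.
by rewrite adj_sw !inE !xpair_eqE ux ua ub vx va vb !(andbF, orbF) addbF.
Qed.

(** Holds site by site: for a fixed sequence of distinct vertices, [Ex_sw] exchanges the graphs in
    which it is an [lc] site with those in which it is a [pc] site. *)
Lemma switch_id m (h : graph n -> R) : (1 < m)%N ->
  Ex (fun G => h G * sumt m.+3 (fun s => (lc G s)%:R)) =
  Ex (fun G => sumt m.+3 (fun s => (pc G s)%:R * h (sws s G))).
Proof.
move=> m1.
rewrite (eq_Ex (Y := fun G => sumt m.+3 (fun s => (lc G s)%:R * h G))); last first.
  by move=> G _; rewrite sumtZr mulrC.
rewrite !Ex_sumt; apply: eq_sumt; case=> [|b [|a [|x p]]] // -[sp].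
have p1 : (1 < size p)%N by rewrite sp.
set y := last x p.
have [U|U] := boolP (uniq [:: b, a, x & p]); last first.
  rewrite (eq_Ex (Y := fun=> 0)) ?[RHS](eq_Ex (Y := fun=> 0)) //.
    by move=> G _; rewrite /pc (negbTE U) mul0r.
  by move=> G _; rewrite /lc (negbTE U) mul0r.
have yp : y \in p by rewrite /y; case: (p) p1 => //= z p' _; exact: mem_last.
have [ba bx ax] : [/\ b != a, b != x & a != x].
  by move: U; rewrite /= !in_cons !negb_or => /and3P[/and3P[-> -> _] /andP[-> _] _].
have [yb ya yx] : [/\ y != b, y != a & y != x].
  move: U; rewrite /= !in_cons !negb_or.
  move=> /and4P[/and3P[_ _ hb] /andP[_ ha] hx _].
  by split; [apply: contraNneq hb|apply: contraNneq ha|apply: contraNneq hx] => <-.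
have U4 : uniq [:: x; y; b; a].
  by rewrite /= !inE !negb_or ![x == _]eq_sym yx bx ax yb ya ba.
have N := (negbTE ba, negbTE bx, negbTE ax, negbTE yb, negbTE ya, negbTE yx).
have M : [/\ (a, x) \in [:: (x, y); (y, x); (y, b); (b, y); (b, a); (a, b); (a, x); (x, a)],
  (a, b) \in [:: (x, y); (y, x); (y, b); (b, y); (b, a); (a, b); (a, x); (x, a)],
  (x, y) \in [:: (x, y); (y, x); (y, b); (b, y); (b, a); (a, b); (a, x); (x, a)] &
  (b, y) \in [:: (x, y); (y, x); (y, b); (b, y); (b, a); (a, b); (a, x); (x, a)]].
  by rewrite !inE !eqxx !orbT.
case: M => M1 M2 M3 M4.
apply: (@Ex_sw _ _ _ x y b a) => G hG.
  rewrite /lc U -/y andTb => /and5P[Eab hp Exy nby nax].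
  have sG := reg_sym hG.
  rewrite sw_reg //; [|by rewrite Exy sG Eab
    |by rewrite sG (negbTE nby) (negbTE nax)|by rewrite Exy (sG y b) (negbTE nby)].
  rewrite /pc U -/y path_sw // hp !adj_sw M1 M2 M3 M4.
  by rewrite Exy Eab (negbTE nby) (negbTE nax).
rewrite /pc U -/y andTb => /and5P[Eax hp Eby nxy nab].
have sG := reg_sym hG.
rewrite sw_reg //; [|by rewrite (negbTE nxy) sG (negbTE nab)
    |by rewrite sG Eby Eax|by rewrite (negbTE nxy) (sG y b) Eby].
rewrite /lc U -/y path_sw // hp !adj_sw M1 M2 M3 M4.
by rewrite Eax Eby (negbTE nxy) (negbTE nab).
Qed.

End Patterns.

(** * Counting paths in a regular graph *)

Section SumtFront.
Variables (R : realType) (T : finType).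

Lemma sumt_front k (F : seq T -> R) :
  sumt k.+1 F = sumt k (fun s => \sum_a F (a :: s)).
Proof. by rewrite sumt_sum. Qed.

Lemma sumt_front2 k (F : seq T -> R) :
  sumt k.+2 F = sumt k (fun s => \sum_b \sum_a F (b :: a :: s)).
Proof.
by rewrite sumt_sum /=; apply: eq_bigr => b _; rewrite sumt_sum.
Qed.

Lemma ler_bool (b c : bool) : (b -> c) -> b%:R <= c%:R :> R.
Proof. by case: b; case: c => // /(_ isT). Qed.

Lemma sum_mem_le (s : seq T) : \sum_v (v \in s)%:R <= (size s)%:R :> R.
Proof.
rewrite -natr_sum ler_nat; apply: leq_trans (card_size s).
rewrite -sum1_card [X in (_ <= X)%N]big_mkcond /=.
by apply: leq_sum => v _; case: (_ \in _).
Qed.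

Lemma sum_mem_uniq (s : seq T) (F : T -> R) : uniq s ->
  \sum_v F v = \sum_v (v \notin s)%:R * F v + \sum_(v <- s) F v.
Proof.
move=> us; rewrite (bigID (fun v => v \in s)) /= addrC; congr (_ + _).
  rewrite big_mkcond /=; apply: eq_bigr => v _.
  by case: (v \in s); rewrite /= ?mul1r ?mul0r.
by rewrite -big_uniq.
Qed.

End SumtFront.

Section Counting.
Variables (R : realType) (n d : nat) (G : graph n).
Hypothesis hG : G \in reg_graphs n d.
Notation V := 'I_n.
Notation e := (adj G).
Notation D := d%:R.
Notation N := n%:R.

Let sG := reg_sym hG.
Let iG := reg_irr hG.

(** The codegree: the number of triangles gained by adding the edge [xy], or lost by deleting it. *)
Definition cod (x y : V) : R := \sum_w (e x w)%:R * (e y w)%:R.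

Lemma cod_ge0 x y : 0 <= cod x y.
Proof. by apply: sumr_ge0 => w _; rewrite mulr_ge0. Qed.

Lemma cod_le x y : cod x y <= D.
Proof.
rewrite -(sum_adj R x hG); apply: ler_sum => w _.
by rewrite ler_piMr // lern1 leq_b1.
Qed.

Lemma walk_sum k x : sumt k (fun p => (path e x p)%:R) = D ^+ k :> R.
Proof.
elim: k x => [|k IH] x //=.
rewrite exprS -[X in X * _](sum_adj R x hG) mulr_suml; apply: eq_bigr => z _.
by rewrite -(IH z) -sumtZ; apply: eq_sumt => s _; rewrite -mulnb natrM.
Qed.

(** By regularity every vertex is the end of exactly [d^k] walks of length [k]. *)
Lemma walk_end k (g : V -> R) :
  \sum_x sumt k (fun p => (path e x p)%:R * g (last x p)) = D ^+ k * \sum_y g y.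
Proof.
elim: k => [|k IH] /=.
  by rewrite expr0 mul1r; apply: eq_bigr => x _; rewrite mul1r.
rewrite exchange_big /= exprS -mulrA -IH mulr_sumr; apply: eq_bigr => z _.
rewrite -[X in X * _](sum_adj_r R z hG) mulr_suml; apply: eq_bigr => x _.
by rewrite -sumtZ; apply: eq_sumt => p _; rewrite -mulnb natrM mulrA.
Qed.

Definition upath k : R := sumt k.+1 (fun s =>
  if s is x :: p then (uniq s && path e x p)%:R else 0).

Lemma upath_le k : upath k <= N * D ^+ k.
Proof.
rewrite /upath /= mulr_natl -[X in _ *+ X](card_ord n) -sumr_const.
apply: ler_sum => x _; rewrite -(walk_sum k x); apply: ler_sumt => p _.
by apply: ler_bool => /andP[].
Qed.

Lemma ext_ge u s : D - (size s)%:R <= \sum_v ((v \notin s) && e v u)%:R :> R.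
Proof.
rewrite lerBlDr; apply: le_trans (_ : _ <= \sum_v ((v \notin s) && e v u)%:R +
   \sum_v (v \in s)%:R) _; last by rewrite lerD2l sum_mem_le.
rewrite -big_split /= -(sum_adj_r R u hG); apply: ler_sum => v _.
by rewrite -natrD ler_nat; case: (v \in s); case: (e v u).
Qed.

Lemma upath_rec k : (D - k.+1%:R) * upath k <= upath k.+1.
Proof.
rewrite [upath k.+1]/upath sumt_front /upath -sumtZ.
apply: ler_sumt => -[|x p] // [sp].
rewrite (eq_bigr (fun a => (uniq (x :: p) && path e x p)%:R *
   ((a \notin x :: p) && e a x)%:R)); last first.
  move=> a _; rewrite -natrM mulnb; congr (_%:R).
  by rewrite [uniq (a :: _)]/= [path _ a _]/=; do ![case: (_ \notin _) => //=];
     case: (e a x); rewrite /= ?andbF ?andbT //.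
rewrite -mulr_sumr mulrC ler_wpM2l //.
by have := ext_ge x (x :: p); rewrite /= sp.
Qed.

(** Each prepended vertex loses at most the vertices already used; the losses
    [1 + 2 + ... + (k + 1)] are bounded by [(k + 1)^2]. *)
Lemma upath_ge k : N * D ^+ k.+1 - (k.+1 ^ 2)%N%:R * N * D ^+ k <= upath k.+1.
Proof.
have U0 j : 0 <= upath j by apply: sumt_ge0 => -[|x p].
elim: k => [|k IH].
  apply: le_trans (upath_rec 0); rewrite /upath /= sumr_const card_ord expr1 expr0.
  by rewrite mulr_natr; lra.
apply: le_trans (upath_rec k.+1); have := upath_le k.+1.
set u := upath _ in IH *; set X := D ^+ k in IH *; rewrite !exprS -/X => h.
rewrite exprS -/X in IH; have D0 : 0 <= D :> R by []; have N0 : 0 <= N :> R by [].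
have X0 : 0 <= X by rewrite exprn_ge0.
have -> : (k.+2 ^ 2)%N%:R = (k.+1 ^ 2)%N%:R + 2 * k%:R + 3 :> R.
  by rewrite !natrX -!natr1; ring.
rewrite -(natr1 k.+1) -natr1; have k0 : 0 <= k%:R :> R by [].
have := ler_wpM2l D0 IH.
have := ler_wpM2l k0 h.
have : 0 <= N * (D * X) by rewrite !mulr_ge0.
set K := (_ ^ 2)%N%:R => h1.
have : 0 <= k%:R * (N * (D * X)) by rewrite mulr_ge0.
nra.
Qed.

Section Cycle.
Variable m : nat.
Notation Ccnt := (cyc R m G).
Notation P := (sumt m.+3 (fun s => (pc G s)%:R : R)).
Notation L := (sumt m.+3 (fun s => (lc G s)%:R : R)).

Lemma cyc_ge0 k : 0 <= cyc R k G.
Proof. by apply: sumt_ge0 => -[|x p]. Qed.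

Lemma sum_edges_a x s :
  \sum_b \sum_a (e a b)%:R * ((a \in s)%:R + (e a x)%:R) <= (size s)%:R * D + D ^+ 2 :> R.
Proof.
rewrite exchange_big /= (eq_bigr (fun a => D * ((a \in s)%:R + (e a x)%:R))); last first.
  by move=> a _; rewrite -mulr_suml (sum_adj R _ hG).
by rewrite -mulr_sumr big_split /= (sum_adj_r R _ hG) // mulrDr -expr2 lerD2r mulrC
  ler_wpM2r // sum_mem_le.
Qed.

Lemma sum_edges_b x s :
  \sum_b \sum_a (e a b)%:R * ((b \in s)%:R + (e b x)%:R) <= (size s)%:R * D + D ^+ 2 :> R.
Proof.
rewrite (eq_bigr (fun b => D * ((b \in s)%:R + (e b x)%:R))); last first.
  by move=> b _; rewrite -mulr_suml (sum_adj_r R _ hG).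
by rewrite -mulr_sumr big_split /= (sum_adj_r R _ hG) // mulrDr -expr2 lerD2r mulrC
  ler_wpM2r // sum_mem_le.
Qed.

Lemma sum_adj2_r : \sum_b \sum_a (e a b)%:R = N * D :> R.
Proof. by rewrite exchange_big /= (sum_adj2 R hG). Qed.

Lemma L_le : L <= N * D * Ccnt.
Proof.
rewrite sumt_front2 /cyc -sumtZ; apply: ler_sumt => -[|x p] // [sp].
rewrite -sum_adj2_r mulr_suml; apply: ler_sum => b _.
rewrite mulr_suml; apply: ler_sum => a _.
rewrite -natrM mulnb /lc [e (last _ _) _]sG.
apply: ler_bool => /and5P[/= /and3P[_ _ /andP[-> ->]] -> -> -> _].
by [].
Qed.

(** A reverse site is a cycle with an oriented edge [ab]. For each of [a] and [b], lying on the
    cycle excludes at most [(m + 1) d] edges and being adjacent to the facing cycle vertex at most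
    [d^2]. *)
Lemma L_ge : (N * D - 2 * m.+1%:R * D - 2 * D ^+ 2) * Ccnt <= L.
Proof.
rewrite sumt_front2 /cyc -sumtZ; apply: ler_sumt => -[|x p] // [sp].
case: and3P => [[us hp Eyx]|_]; last first.
  by rewrite mulr0; apply: sumr_ge0 => b _; apply: sumr_ge0.
rewrite mulr1; pose s := x :: p; set y := last x p in Eyx *.
have ss : size s = m.+1 by rewrite /= sp.
apply: (@le_trans _ _ (\sum_b \sum_a ((e a b)%:R
    - (e a b)%:R * ((a \in s)%:R + (e a x)%:R)
    - (e a b)%:R * ((b \in s)%:R + (e b y)%:R)))).
  under eq_bigr do rewrite !sumrB.
  rewrite !sumrB sum_adj2_r.
  have := sum_edges_a x s; have := sum_edges_b y s; rewrite ss.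
  by lra.
apply: ler_sum => b _; apply: ler_sum => a _.
rewrite /lc -/y hp [e x y]sG Eyx [uniq _]/= -!/s.
case Eab : (e a b); last by rewrite !mul0r !subr0.
have ba : b != a by apply: contraTneq Eab => ->; rewrite iG.
rewrite (in_cons a s b) (negbTE ba) /=; move: us => /= /andP[-> ->].
rewrite !andbT.
case: (a \in s); case: (b \in s); case: (e a x); case: (e b y) => /=; lra.
Qed.

Lemma P_le : P <= N * D ^+ m.+2.
Proof.
apply: (@le_trans _ _ (D ^+ 2 * upath m)); last first.
  by rewrite -(addn2 m) exprD mulrA [_ * upath m]mulrC ler_wpM2r ?exprn_ge0 // upath_le.
rewrite sumt_front2 /upath -sumtZ; apply: ler_sumt => -[|x p] // [sp].
set s := x :: p; set y := last x p.
apply: (@le_trans _ _ (\sum_b \sum_a (uniq s && path e x p)%:R * (e b y)%:R * (e a x)%:R)).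
  apply: ler_sum => b _; apply: ler_sum => a _.
  rewrite -!natrM !mulnb /pc -/s -/y.
  by apply: ler_bool => /and5P[/= /and3P[_ _ ->] -> -> -> _].
under eq_bigr do rewrite -mulr_sumr (sum_adj_r R _ hG) //.
by rewrite -mulr_suml -mulr_sumr (sum_adj_r R _ hG) // -mulrA -expr2 mulrC.
Qed.

Lemma sum_ends (x y : V) (s : seq V) :
  D ^+ 2 - (2 * (size s)%:R + 1) * D <=
  \sum_b \sum_a ([&& b \notin a :: s & a \notin s])%:R * (e b y)%:R * (e a x)%:R :> R.
Proof.
apply: (@le_trans _ _ (\sum_b \sum_a ((e b y)%:R * (e a x)%:R
   - (b \in s)%:R * (e a x)%:R - (e b y)%:R * (a \in s)%:R - (b == a)%:R * (e a x)%:R))).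
  under eq_bigr do rewrite !sumrB.
  rewrite !sumrB.
  have -> : \sum_b \sum_a (e b y)%:R * (e a x)%:R = D ^+ 2 :> R.
    under eq_bigr do rewrite -mulr_sumr (sum_adj_r R _ hG) //.
    by rewrite -mulr_suml (sum_adj_r R _ hG).
  have -> : \sum_b \sum_a (b \in s)%:R * (e a x)%:R = (\sum_b (b \in s)%:R) * D :> R.
    rewrite mulr_suml; apply: eq_bigr => b _.
    by rewrite -mulr_sumr (sum_adj_r R _ hG).
  have -> : \sum_b \sum_a (e b y)%:R * (a \in s)%:R = D * (\sum_b (b \in s)%:R) :> R.
    by rewrite -(sum_adj_r R y hG) mulr_suml; apply: eq_bigr => b _; rewrite -mulr_sumr.
  have -> : \sum_b \sum_a (b == a)%:R * (e a x)%:R = D :> R.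
    rewrite exchange_big /= -(sum_adj_r R x hG); apply: eq_bigr => a _.
    rewrite (bigD1 a) //= eqxx mul1r big1 ?addr0 // => b /negbTE ->.
    by rewrite mul0r.
  have := sum_mem_le R s; have : 0 <= D :> R by []; nra.
apply: ler_sum => b _; apply: ler_sum => a _.
rewrite in_cons negb_or.
case: (b == a); case: (b \in s); case: (a \in s); case: (e a x); case: (e b y) => /=; lra.
Qed.

(** Attach [a] and [b] to a self-avoiding path [x :: p]. If [x] and the end of [p] are adjacent, the
    path closes into a cycle with two free pendant edges, which gives [d^2 cyc m]; if [a] and [b]
    are adjacent, all [m + 3] vertices form a cycle. The coefficient adds [m^2] from [upath_ge] and
    [2 m + 3] from [sum_ends]. *)
Lemma P_ge : (0 < m)%N ->
  N * D ^+ m.+2 - ((m ^ 2)%N%:R + 2 * m%:R + 3) * N * D ^+ m.+1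
    - D ^+ 2 * Ccnt - cyc R m.+2 G <= P.
Proof.
move=> m0.
apply: (@le_trans _ _ ((D ^+ 2 - (2 * m.+1%:R + 1) * D) * upath m
   - D ^+ 2 * Ccnt - cyc R m.+2 G)).
  have := upath_le m; case: m m0 => // k _.
  have := upath_ge k; have : 0 <= D :> R by []; have : 0 <= N :> R by [].
  have : 0 <= k%:R :> R by []; have : 0 <= D ^+ k :> R by rewrite exprn_ge0.
  rewrite !exprS -!(natr1 k.+1) -!(natr1 k).
  set K := (_ ^ 2)%N%:R; set X := D ^+ k; set u := upath _.
  move=> X0 k0 N0 D0 h1 h2.
  have h1' := ler_wpM2l (mulr_ge0 D0 D0) h1.
  have h2' := ler_wpM2l (mulr_ge0 k0 D0) h2.
  have h2'' := ler_wpM2l D0 h2.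
  by rewrite expr0; lra.
rewrite /cyc !sumt_front2 /upath -!sumtZ -!sumtB.
apply: ler_sumt => -[|x p] // [sp].
set y := last x p.
case: (boolP (uniq (x :: p) && path e x p)) => [/andP[us hp]|hn]; last first.
  rewrite mulr0 andbA (negbTE hn) mulr0 subr0 sub0r.
  apply: le_trans (_ : 0 <= _); last by apply: sumr_ge0 => b _; apply: sumr_ge0.
  by rewrite oppr_le0; apply: sumr_ge0 => b _; apply: sumr_ge0.
rewrite mulr1 us hp !andTb.
have := sum_ends x y (x :: p); rewrite [size _]/= sp => h.
apply: le_trans (lerB (lerB h (lexx _)) (lexx _)) _.
have -> : D ^+ 2 = \sum_b \sum_a (e b y)%:R * (e a x)%:R :> R.
  under eq_bigr do rewrite -mulr_sumr (sum_adj_r R _ hG).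
  by rewrite -mulr_suml (sum_adj_r R _ hG).
rewrite mulr_suml -!sumrB; apply: ler_sum => b _.
rewrite mulr_suml -!sumrB; apply: ler_sum => a _.
rewrite /pc -/y.
have -> : uniq [:: b, a, x & p] = (b \notin [:: a, x & p]) && (a \notin x :: p).
  by move: us => /= /andP[-> ->]; rewrite !andbT.
rewrite /= hp -/y [e y b]sG [e y x]sG [e b a]sG.
case: (b \notin _); case: (a \notin _); case: (e b y); case: (e a x);
  case: (e x y); case: (e a b) => /=; lra.
Qed.

End Cycle.
End Counting.

(** * Change of the triangle count under a switching *)

Section CubicTrace.
Variables (R : realType) (n : nat).
Implicit Types B E : 'M[R]_n.

Lemma mxtrace_mul_delta B (u v : 'I_n) : \tr (B *m delta_mx u v) = B v u.
Proof.
rewrite mxtrace_mulC /mxtrace (bigD1 u) //= [X in _ + X]big1 => [|i iu].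
  rewrite addr0 mxE (bigD1 v) //= mxE !eqxx mul1r big1 ?addr0 // => j /negbTE jv.
  by rewrite mxE jv andbF mul0r.
by rewrite mxE big1 // => j _; rewrite mxE (negbTE iu) mul0r.
Qed.

(** Expand in [c]. The linear term is [3 tr (B B E)]; the quadratic one reduces to the diagonal
    entries of [B] at [u] and [v], and [tr (E E E) = 0]. With [c] equal to 1 or -1 this adds or
    deletes one edge. *)
Lemma cubic_trace_edge B (u v : 'I_n) (c : R) : B^T = B -> B u u = 0 -> B v v = 0 ->
  u != v -> let C := B + c *: (delta_mx u v + delta_mx v u) in
  \tr (C *m C *m C) = \tr (B *m B *m B) + 6 * c * (B *m B) u v.
Proof.
move=> sB Bu Bv uv C; rewrite /C; set E := delta_mx u v + delta_mx v u.
have trE X : \tr (X *m E) = X v u + X u v.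
  by rewrite mulmxDr linearD /= !mxtrace_mul_delta.
have EE : E *m E = delta_mx u u + delta_mx v v.
  rewrite mulmxDl !mulmxDr !mul_delta_mx_cond !eqxx [v == u]eq_sym (negbTE uv).
  by rewrite !mulr0n !mulr1n addr0 add0r.
have sBB : (B *m B) v u = (B *m B) u v.
  by rewrite -[in LHS]sB -trmx_mul mxE.
have t1 : \tr (B *m B *m E) = 2 * (B *m B) u v by rewrite trE sBB; ring.
have t2 : \tr (B *m E *m B) = 2 * (B *m B) u v.
  by rewrite -mulmxA mxtrace_mulC -mulmxA mxtrace_mulC t1.
have t3 : \tr (E *m B *m B) = 2 * (B *m B) u v by rewrite -mulmxA mxtrace_mulC t1.
have t4 : \tr (B *m E *m E) = 0.
  by rewrite -mulmxA EE mulmxDr linearD /= !mxtrace_mul_delta Bu Bv addr0.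
have t5 : \tr (E *m B *m E) = 0 by rewrite -mulmxA mxtrace_mulC.
have t6 : \tr (E *m E *m B) = 0 by rewrite mxtrace_mulC mulmxA t4.
have t7 : \tr (E *m E *m E) = 0.
  by rewrite trE EE !mxE !eqxx /= (negbTE uv) [v == u]eq_sym (negbTE uv) /= !addr0.
clearbody E; rewrite !(mulmxDl, mulmxDr) -!(scalemxAl, scalemxAr) !linearD /= !linearZ /=.
rewrite t1 t2 t3 t4 t5 t6 t7.
ring.
Qed.

End CubicTrace.

Arguments pc : simpl never.
Arguments lc : simpl never.

Section ExtraTriangles.
Variables (R : realType) (n d : nat) (G : graph n).
Hypothesis hG : G \in reg_graphs n d.
Notation V := 'I_n.
Notation e := (adj G).
Notation D := d%:R.
Notation N := n%:R.
Notation cod := (cod R G).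

Let sG := reg_sym hG.
Let iG := reg_irr hG.

Lemma sum_cod : \sum_x \sum_y (e x y)%:R * cod x y = cyc R 2 G.
Proof.
apply: eq_bigr => x _; apply: eq_bigr => y _; rewrite mulr_sumr.
apply: eq_bigr => z _; rewrite -!natrM !mulnb /= !inE !negb_or andbT.
case Exy : (e x y); case Eyz : (e y z); rewrite ?andbF ?andbT //= sG.
case Ezx : (e z x); rewrite ?andbF //= andbT.
have -> : x != y by apply: contraTneq Exy => ->; rewrite iG.
have -> : y != z by apply: contraTneq Eyz => ->; rewrite iG.
by have -> : x != z by apply: contraTneq Ezx => ->; rewrite iG.
Qed.

(* Bounds the change of the triangle count: see [gain] below. *)
Definition extra (s : seq V) : R := if s is b :: a :: x :: p then
  cod x (last x p) + cod a b + cod a x + cod b (last x p) else 0.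

Variable m : nat.

Lemma sum_ends_prod (F1 F2 : V -> R) :
  \sum_b \sum_a F1 b * F2 a = (\sum_b F1 b) * \sum_a F2 a.
Proof. by under eq_bigr do rewrite -mulr_sumr; rewrite -mulr_suml. Qed.

Lemma pc_le b a x p : (pc G (b :: a :: x :: p))%:R <=
   (path e x p)%:R * ((e b (last x p))%:R * (e a x)%:R) :> R.
Proof.
by rewrite -!natrM !mulnb; apply: ler_bool => /and5P[_ -> -> -> _].
Qed.

Lemma extra_ax :
  sumt m.+3 (fun s => (pc G s)%:R * (if s is b :: a :: x :: p then cod a x else 0))
  <= D ^+ m.+1 * cyc R 2 G.
Proof.
rewrite sumt_front2.
apply: (@le_trans _ _ (sumt m.+1 (fun s => if s is x :: p then
   (path e x p)%:R * (D * \sum_a (e a x)%:R * cod a x) else 0))).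
  apply: ler_sumt => -[|x p] // _.
  rewrite -(sum_adj_r R (last x p) hG) -sum_ends_prod mulr_sumr.
  apply: ler_sum => b _; rewrite mulr_sumr; apply: ler_sum => a _.
  by rewrite !mulrA ler_wpM2r ?cod_ge0 // -mulrA pc_le.
rewrite /= exprS -mulrA mulrCA -sum_cod exchange_big /= mulr_sumr.
rewrite [X in _ <= X](mulr_sumr _ _ _ _).
by apply: ler_sum => x _; rewrite sumtZr (walk_sum R hG) mulrCA.
Qed.

Lemma extra_by :
  sumt m.+3 (fun s => (pc G s)%:R * (if s is b :: a :: x :: p then cod b (last x p) else 0))
  <= D ^+ m.+1 * cyc R 2 G.
Proof.
rewrite sumt_front2.
apply: (@le_trans _ _ (sumt m.+1 (fun s => if s is x :: p then
   (path e x p)%:R * (D * \sum_b (e b (last x p))%:R * cod b (last x p)) else 0))).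
  apply: ler_sumt => -[|x p] // _.
  rewrite [D * _]mulrC -(sum_adj_r R x hG) -sum_ends_prod mulr_sumr.
  apply: ler_sum => b _; rewrite mulr_sumr; apply: ler_sum => a _.
  rewrite [X in _ <= _ * X]mulrAC !mulrA ler_wpM2r ?cod_ge0 // -mulrA.
  exact: pc_le.
rewrite /= (walk_end hG m (fun y => D * \sum_b (e b y)%:R * cod b y)).
by rewrite -mulr_sumr exprSr -mulrA -sum_cod [X in _ <= _ * (_ * X)]exchange_big.
Qed.

Lemma cod_split s x y : uniq s ->
  cod x y <= (size s)%:R + \sum_w (w \notin s)%:R * ((e x w)%:R * (e y w)%:R).
Proof.
move=> us; rewrite /cod (sum_mem_uniq _ us) addrC lerD2r.
elim: s {us} => [|v s IH]; rewrite ?big_nil // big_cons -[size _]/(size s).+1.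
rewrite -natr1 addrC lerD // -natrM mulnb; exact: (@ler_bool R _ true).
Qed.

(** Common neighbours on the path number at most [m + 1] per site; one outside the path closes
    [x :: p] into a cycle of [m + 2] vertices, to which [a] and [b] are attached in at most [d^2]
    ways. *)
Lemma extra_xy :
  sumt m.+3 (fun s => (pc G s)%:R * (if s is b :: a :: x :: p then cod x (last x p) else 0))
  <= m.+1%:R * N * D ^+ m.+2 + D ^+ 2 * cyc R m.+1 G.
Proof.
apply: (@le_trans _ _ (m.+1%:R * sumt m.+3 (fun s => (pc G s)%:R)
    + D ^+ 2 * cyc R m.+1 G)); last first.
  by rewrite lerD2r -mulrA ler_wpM2l // (P_le R hG).
have -> : cyc R m.+1 G = sumt m.+1 (fun s => \sum_w
     ([&& uniq (w :: s), path e w s & e (last w s) w])%:R) by rewrite /cyc sumt_front.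
rewrite !sumt_front2 -!sumtZ -sumtD; apply: ler_sumt => -[|x p] // [sp].
set y := last x p.
case: (boolP (uniq (x :: p))) => us; last first.
  have pc0 b a : pc G [:: b, a, x & p] = false.
    by apply/negbTE; apply: contra us => /and5P[/= /and3P[_ _ ->]].
  rewrite big1 => [|b _]; last by rewrite big1 // => a _; rewrite pc0 mul0r.
  apply: addr_ge0; apply: mulr_ge0; rewrite ?exprn_ge0 //.
    by apply: sumr_ge0 => b _; apply: sumr_ge0.
  by apply: sumr_ge0.
have := cod_split x y us; rewrite [size _]/= sp => h.
apply: (@le_trans _ _ (\sum_b \sum_a (m.+1%:R * (pc G [:: b, a, x & p])%:R +
   (path e x p)%:R * ((e b y)%:R * (e a x)%:R) *
     \sum_w (w \notin x :: p)%:R * ((e x w)%:R * (e y w)%:R)))).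
  apply: ler_sum => b _; apply: ler_sum => a _.
  apply: le_trans (ler_wpM2l _ h) _; first by [].
  rewrite mulrDr mulrC lerD2l ler_wpM2r ?pc_le //.
  by apply: sumr_ge0 => w _; rewrite !mulr_ge0.
under eq_bigr do rewrite big_split /= -mulr_sumr -mulr_suml -mulr_sumr.
rewrite big_split /= -mulr_sumr lerD2l -mulr_suml -mulr_sumr sum_ends_prod.
rewrite !(sum_adj_r R _ hG) -expr2 [X in X * _]mulrC -mulrA ler_wpM2l ?exprn_ge0 //.
rewrite mulr_sumr; apply: ler_sum => w _.
rewrite -!natrM !mulnb -/y [e x w]sG.
by apply: ler_bool => /and4P[-> hw -> ->] /=; rewrite hw; move: us => /= /andP[-> ->].
Qed.

(** As for [extra_xy], except that a common neighbour of [a] and [b] outside the site closes the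
    whole path into a cycle of [m + 4] vertices. *)
Lemma extra_ab :
  sumt m.+3 (fun s => (pc G s)%:R * (if s is b :: a :: x :: p then cod a b else 0))
  <= m.+1%:R * N * D ^+ m.+2 + cyc R m.+3 G.
Proof.
apply: (@le_trans _ _ (m.+1%:R * sumt m.+3 (fun s => (pc G s)%:R) + cyc R m.+3 G)); last first.
  by rewrite lerD2r -mulrA ler_wpM2l // (P_le R hG).
have -> : cyc R m.+3 G = sumt m.+1 (fun s => if s is x :: p then \sum_b \sum_a \sum_w
     ([&& uniq [:: b, w, a, x & p], path e b [:: w, a, x & p] & e (last x p) b])%:R else 0).
  rewrite /cyc sumt_front2 sumt_front; apply: eq_sumt => -[|x p] // _.
  by rewrite exchange_big.
rewrite !sumt_front2 -sumtZ -sumtD; apply: ler_sumt => -[|x p] // [sp].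
set y := last x p.
rewrite mulr_sumr -big_split; apply: ler_sum => b _ /=.
rewrite mulr_sumr -big_split; apply: ler_sum => a _ /=.
case hpc : (pc G _); last first.
  by rewrite mul0r mulr0 add0r; apply: sumr_ge0.
move: hpc; rewrite /pc -/y => /and5P[us Eax hp Eby /andP[nxy nab]].
have us' : uniq (x :: p) by move: us => /= /and3P[].
rewrite mul1r mulr1; apply: le_trans (cod_split a b us') _.
rewrite [size _]/= sp lerD2l; apply: ler_sum => w _.
rewrite -!natrM !mulnb; apply: ler_bool => /and3P[wn Eaw Ebw].
have wa : w != a by apply: contraTneq Eaw => ->; rewrite iG.
have wb : b != w by apply: contraTneq Ebw => ->; rewrite iG.
rewrite /= -/y hp Ebw [e w a]sG Eaw Eax [e y b]sG Eby !andbT.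
move: us wn wa wb; rewrite /= !in_cons !negb_or.
move=> /and4P[/and3P[-> -> ->] /andP[-> ->] -> ->] /andP[-> ->] -> ->.
by [].
Qed.

Lemma sum_extra_le :
  sumt m.+3 (fun s => (pc G s)%:R * extra s) <=
  2 * m.+1%:R * N * D ^+ m.+2 + 2 * D ^+ m.+1 * cyc R 2 G
   + D ^+ 2 * cyc R m.+1 G + cyc R m.+3 G.
Proof.
apply: le_trans (_ : _ <= m.+1%:R * N * D ^+ m.+2 + D ^+ 2 * cyc R m.+1 G +
  (m.+1%:R * N * D ^+ m.+2 + cyc R m.+3 G) + D ^+ m.+1 * cyc R 2 G +
  D ^+ m.+1 * cyc R 2 G) _; last by lra.
rewrite [X in X <= _](_ : _ =
  sumt m.+3 (fun s => (pc G s)%:R * (if s is b :: a :: x :: p then cod x (last x p) else 0))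
  + sumt m.+3 (fun s => (pc G s)%:R * (if s is b :: a :: x :: p then cod a b else 0))
  + sumt m.+3 (fun s => (pc G s)%:R * (if s is b :: a :: x :: p then cod a x else 0))
  + sumt m.+3 (fun s => (pc G s)%:R * (if s is b :: a :: x :: p then cod b (last x p) else 0))).
  by rewrite !lerD ?extra_xy ?extra_ab ?extra_ax ?extra_by.
rewrite -!sumtD; apply: eq_sumt => -[|b [|a [|x p]]] //.
by rewrite /extra !mulrDr.
Qed.

Definition amx (H : graph n) : 'M[R]_n := \matrix_(i, j) (adj H i j)%:R.

(** In a loopless graph the vertices of a closed walk of length three are automatically distinct.
    The trace makes the effect of a switching an algebraic computation. *)
Lemma cyc2_trace (H : graph n) : H \in reg_graphs n d ->
  cyc R 2 H = \tr (amx H *m amx H *m amx H).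
Proof.
move=> hH; have sH := reg_sym hH; have iH := reg_irr hH.
rewrite /mxtrace /cyc /=; apply: eq_bigr => x _; rewrite mxE.
under [RHS]eq_bigr do rewrite mxE mulr_suml.
rewrite [RHS]exchange_big; apply: eq_bigr => z _; apply: eq_bigr => y _.
rewrite !mxE -!natrM !mulnb /= !inE !negb_or andbT.
case Exy : (adj H x z); case Eyz : (adj H z y); rewrite ?andbF ?andbT //=.
case Ezx : (adj H y x); rewrite ?andbF //= ?andbT.
have -> : x != z by apply: contraTneq Exy => ->; rewrite iH.
have -> : z != y by apply: contraTneq Eyz => ->; rewrite iH.
by have -> : x != y by apply: contraTneq Ezx => ->; rewrite iH.
Qed.

(** The four edges are changed one at a time by [cubic_trace_edge]: delete [ax] and [by], then add
    [xy] and [ab]. The adjacency corrections arise because the last two codegrees are taken after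
    the deletions: [a] and [b] may have ceased to be common neighbours of [x] and [y], and [x] and
    [y] of [a] and [b]. *)
Lemma cyc2_sw b a x p : (1 < size p)%N -> pc G (b :: a :: x :: p) ->
  let y := last x p in
  cyc R 2 (sws (b :: a :: x :: p) G) - cyc R 2 G =
  6 * (cod x y + cod a b - cod a x - cod b y
       - 2 * (e a y)%:R - 2 * (e b x)%:R).
Proof.
move=> p1 + y; rewrite /pc -/y => /and5P[U Eax hp Eby /andP[nxy nab]].
have yp : y \in p by rewrite /y; case: (p) p1 => //= z p' _; exact: mem_last.
have [ba bx ax] : [/\ b != a, b != x & a != x].
  by move: U; rewrite /= !in_cons !negb_or => /and3P[/and3P[-> -> _] /andP[-> _] _].
have [yb ya yx] : [/\ y != b, y != a & y != x].
  move: U; rewrite /= !in_cons !negb_or.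
  move=> /and4P[/and3P[_ _ hb] /andP[_ ha] hx _].
  by split; [apply: contraNneq hb|apply: contraNneq ha|apply: contraNneq hx] => <-.
have U4 : uniq [:: x; y; b; a].
  by rewrite /= !inE !negb_or ![x == _]eq_sym yx bx ax yb ya ba.
have hG' : sw x y b a G \in reg_graphs n d.
  apply: sw_reg => //; rewrite ?(negbTE nxy) 1?[e b a]sG ?(negbTE nab) //.
    by rewrite sG Eby Eax.
  by rewrite (sG y b) Eby.
rewrite /sws -/y (cyc2_trace hG) (cyc2_trace hG').
pose A := amx G.
pose E (u v : V) : 'M[R]_n := delta_mx u v + delta_mx v u.
pose A1 := A + (-1) *: E a x.
pose A2 := A1 + (-1) *: E b y.
pose A3 := A2 + 1 *: E x y.
pose A4 := A3 + 1 *: E a b.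
have N := (negbTE ba, negbTE bx, negbTE ax, negbTE yb, negbTE ya, negbTE yx).
have N' : ((a == b = false) * (x == b = false) * (x == a = false) *
   (b == y = false) * (a == y = false) * (x == y = false))%type.
  by rewrite ![a == _]eq_sym ![x == _]eq_sym [b == y]eq_sym !N.
have F : ((e x y = false) * (e y x = false) * (e a x = true) * (e x a = true) *
   (e b y = true) * (e y b = true) * (e a b = false) * (e b a = false))%type.
  by rewrite [e y x]sG [e x a]sG [e y b]sG [e b a]sG (negbTE nxy) (negbTE nab) Eax Eby.
have -> : amx (sw x y b a G) = A4.
  apply/matrixP => i j; rewrite /A4 /A3 /A2 /A1 /A /E !mxE adj_sw !inE !xpair_eqE.
  have [->|ix] := eqVneq i x.
    rewrite ?N' /= ?(andbF, andbT, orbF).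
    have [->|jy] := eqVneq j y; first by rewrite ?N F /=; ring.
    have [->|ja] := eqVneq j a; first by rewrite ?F /=; ring.
    by rewrite ?addbF /=; ring.
  have [->|iy] := eqVneq i y.
    rewrite ?N /= ?(andbF, andbT, orbF).
    have [->|jx] := eqVneq j x; first by rewrite ?N' F /=; ring.
    have [->|jb] := eqVneq j b; first by rewrite ?F /=; ring.
    by rewrite ?addbF /=; ring.
  have [->|ia] := eqVneq i a.
    rewrite ?N' /= ?(andbF, andbT, orbF).
    have [->|jx] := eqVneq j x; first by rewrite ?N' F /=; ring.
    have [->|jb] := eqVneq j b; first by rewrite ?F /=; ring.
    by rewrite ?addbF /=; ring.
  have [->|ib] := eqVneq i b.
    rewrite /= ?(andbF, andbT, orbF).
    have [->|jy] := eqVneq j y; first by rewrite ?N F /=; ring.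
    have [->|ja] := eqVneq j a; first by rewrite ?F /=; ring.
    by rewrite ?addbF /=; ring.
  by rewrite /= ?addbF; ring.
have sE u v : (E u v)^T = E u v by rewrite linearD /= !trmx_delta addrC.
have sA : A^T = A by apply/matrixP => i j; rewrite !mxE sG.
have sA1 : A1^T = A1 by rewrite linearD linearZ /= sA sE.
have sA2 : A2^T = A2 by rewrite linearD linearZ /= sA1 sE.
have sA3 : A3^T = A3 by rewrite linearD linearZ /= sA2 sE.
have zA i : A i i = 0 by rewrite mxE iG.
have zE u v i : u != v -> E u v i i = 0.
  move=> uv; rewrite !mxE.
  have [->|iu] := eqVneq i u; first by rewrite (negbTE uv) /= addr0.
  by rewrite andbF addr0.
have yb' : b != y by rewrite eq_sym.
have yx' : x != y by rewrite eq_sym.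
have ba' : a != b by rewrite eq_sym.
have zA1 i : A1 i i = 0 by rewrite mxE [X in _ + X]mxE zE // mulr0 addr0 zA.
have zA2 i : A2 i i = 0 by rewrite mxE [X in _ + X]mxE zE // mulr0 addr0 zA1.
have zA3 i : A3 i i = 0 by rewrite mxE [X in _ + X]mxE zE // mulr0 addr0 zA2.
rewrite (cubic_trace_edge 1 sA3 (zA3 a) (zA3 b) ba').
rewrite (cubic_trace_edge 1 sA2 (zA2 x) (zA2 y) yx').
rewrite (cubic_trace_edge (-1) sA1 (zA1 b) (zA1 y) yb').
rewrite (cubic_trace_edge (-1) sA (zA a) (zA x) ax).
have sum_delta (u : V) (f : V -> R) : \sum_w (w == u)%:R * f w = f u.
  rewrite (bigD1 u) //= eqxx mul1r big1 ?addr0 // => w /negbTE ->.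
  by rewrite mul0r.
have -> : (A *m A) a x = cod a x.
  by rewrite mxE; apply: eq_bigr => w _; rewrite !mxE [e w x]sG.
have -> : (A1 *m A1) b y = cod b y.
  rewrite mxE; apply: eq_bigr => w _; rewrite !mxE ?(N, N') ?(andbF, andFb) [e w y]sG /=.
  by ring.
have -> : (A2 *m A2) x y = cod x y - (e a y)%:R - (e b x)%:R.
  rewrite mxE (eq_bigr (fun w => (e x w)%:R * (e y w)%:R - (w == a)%:R * (e w y)%:R -
     (w == b)%:R * (e x w)%:R)).
    by rewrite !sumrB !sum_delta -/(cod x y) [e x b]sG.
  move=> w _; rewrite !mxE ?(N, N') ?(andbF, andFb, andbT, eqxx) [e w y]sG /=.
  have [->|wa] := eqVneq w a; first by rewrite ?(N, N') /=; ring.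
  by have [->|wb] := eqVneq w b; rewrite ?(N, N') /=; ring.
have -> : (A3 *m A3) a b = cod a b - (e a y)%:R - (e b x)%:R.
  rewrite mxE (eq_bigr (fun w => (e a w)%:R * (e b w)%:R - (w == x)%:R * (e w b)%:R -
     (w == y)%:R * (e a w)%:R)).
    by rewrite !sumrB !sum_delta -/(cod a b) [e x b]sG; ring.
  move=> w _; rewrite !mxE ?(N, N') ?(andbF, andFb, andbT, eqxx) [e w b]sG /=.
  have [->|wa] := eqVneq w x; first by rewrite ?(N, N') /=; ring.
  by have [->|wb] := eqVneq w y; rewrite ?(N, N') /=; ring.
by ring.
Qed.

End ExtraTriangles.

(** * Weak law for cycle counts *)

Lemma uniq_ends (T : eqType) (b a x : T) (p : seq T) : (0 < size p)%N ->
  uniq [:: b, a, x & p] -> uniq [:: x; last x p; b; a].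
Proof.
move=> p0 U; set y := last x p.
have yp : y \in p by rewrite /y; case: (p) p0 => //= z p' _; exact: mem_last.
move: U; rewrite /= !in_cons !negb_or !andbT.
move=> /and4P[/and3P[ba bx hb] /andP[ax ha] hx _].
have ne u : u \notin p -> y != u by apply: contraNneq => <-.
by rewrite -/y ?inE ?negb_or ![x == _]eq_sym (ne x) // (ne b) // (ne a) // bx ax ba.
Qed.

Section CycleLemma.
Variables (R : realType) (n d : nat).
Notation Reg := (reg_graphs n d).
Notation Ex := (@Gnd_expect R n d).
Notation D := d%:R.
Notation N := n%:R.
Notation Cyc m := (fun G => cyc R m G).

Lemma sws_reg G b a x p : (0 < size p)%N -> G \in Reg -> pc G [:: b, a, x & p] ->
  sws [:: b, a, x & p] G \in Reg.
Proof.
move=> p0 hG; rewrite /pc => /and5P[U Eax hp Eby /andP[nxy nab]].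
have sG := reg_sym hG.
apply: sw_reg => //; first exact: uniq_ends p0 U.
- by rewrite (negbTE nxy) sG (negbTE nab).
- by rewrite sG Eby Eax.
- by rewrite (negbTE nxy) (sG _ b) Eby.
Qed.

Variable (C : R).
Hypotheses (Reg_gt0 : (0 < #|Reg|)%N) (d20 : (20 <= d)%N)
  (dn : (4 * (d + 1) + 80 <= n)%N) (C1 : 1 <= C) (dC : D ^+ 2 <= C * N).

Let D20_ : 20 <= D :> R. Proof. by rewrite ler_nat. Qed.
Let DN_ : 4 * (D + 1) + 80 <= N :> R.
Proof. by have := dn; rewrite -(ler_nat R) natrD natrM natrD. Qed.

(** The switching identity with [h = 1] equates the expected numbers of sites: on one side at least
    [n d / 2] per cycle, on the other at most [n d^(m + 2)]. *)
Lemma Ex_cyc_le m : (1 < m < 20)%N -> Ex (Cyc m) <= 2 * D ^+ m.+1.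
Proof.
move=> /andP[m1 m20].
have D20 := D20_; have DN := DN_.
have M20 : m.+1%:R <= 20 :> R by rewrite ler_nat.
have H := switch_id d (fun=> 1 : R) m1.
have h1 : (N * D - 2 * m.+1%:R * D - 2 * D ^+ 2) * Ex (Cyc m) <= N * D ^+ m.+2.
  rewrite -ExZ; apply: le_trans (_ : _ <= Ex (fun=> N * D ^+ m.+2)) _; last by rewrite Ex_cst.
  apply: le_trans (ler_Ex (fun G hG => L_ge R hG m)) _.
  have <- : Ex (fun G => 1 * sumt m.+3 (fun s => (lc G s)%:R)) =
      Ex (fun G => sumt m.+3 (fun s => (lc G s)%:R)).
    by apply: eq_Ex => G _; rewrite mul1r.
  rewrite H; apply: ler_Ex => G hG.
  by apply: le_trans (P_le R hG m); apply: ler_sumt => s _; rewrite mulr1.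
have E0 : 0 <= Ex (Cyc m) by apply: Ex_ge0 => G _; exact: cyc_ge0.
have D0 : 0 < D :> R by lra.
have N0 : 0 < N :> R by lra.
have h2 : N * D / 2 * Ex (Cyc m) <= N * D ^+ m.+2.
  apply: le_trans h1; apply: ler_wpM2r => //.
  have : 0 <= D * (N / 2 - 2 * m.+1%:R - 2 * D) :> R by rewrite mulr_ge0 //; lra.
  by lra.
rewrite -(@ler_pM2l _ (N * D / 2)); last by rewrite divr_gt0 // mulr_gt0.
by apply: le_trans h2 _; rewrite [D ^+ m.+2]exprS; lra.
Qed.

(** The range of [m] leaves room for the index [m + 3] in [Ex_cyc_le]; the bound [d^2 <= C n] brings
    the cycle terms to order [n d^(m + 2)]. *)
Lemma Ex_extra_le m : (1 < m < 17)%N ->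
  Ex (fun G => sumt m.+3 (fun s => (pc G s)%:R * extra R G s)) <=
  (2 * m.+1%:R + 8 * C) * N * D ^+ m.+2.
Proof.
move=> /andP[m1 m17].
apply: le_trans (ler_Ex (fun G hG => sum_extra_le R hG m)) _.
rewrite !ExD Ex_cst // !ExZ.
have h2 := @Ex_cyc_le 2 isT.
have h3 : Ex (Cyc m.+1) <= 2 * D ^+ m.+2.
  by apply: Ex_cyc_le; apply/andP; split; [exact: ltnW|exact: (@leq_trans 18 m.+2 20)].
have h4 : Ex (Cyc m.+3) <= 2 * D ^+ m.+4.
  by apply: Ex_cyc_le; apply/andP; split.
set X := (D ^+ m.+2 : R); have X0 : 0 <= X :> R by rewrite exprn_ge0.
have DX : D ^+ 2 * X <= C * N * X by rewrite ler_wpM2r.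
have e4 : D ^+ m.+4 = D ^+ 2 * X :> R by rewrite -exprD.
have Y0 : 0 <= D ^+ m.+1 :> R by rewrite exprn_ge0.
have h2' := ler_wpM2l Y0 h2.
have e2 : D ^+ m.+1 * (2 * D ^+ 3) = 2 * (D ^+ 2 * X) :> R.
  by rewrite mulrCA -(exprD _ m.+1 3) (addnC m.+1 3) -exprD.
have h3' := ler_wpM2l (sqr_ge0 D) h3.
rewrite -/X in h3'; rewrite e4 in h4; rewrite e2 in h2'.
by lra.
Qed.

(* The errors are one power of [d] smaller than [cyc m], and a switching moves [h] by
   at most [M / d] times the change of the triangle count. *)
Lemma cyc_weak m (M : R) (h : graph n -> R) : (1 < m < 17)%N -> 0 <= M ->
  (forall G, G \in Reg -> `|h G| <= M) ->
  (forall G G', G \in Reg -> G' \in Reg ->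
     `|h G' - h G| <= M / D * `|cyc R 2 G' - cyc R 2 G|) ->
  `|Ex (fun G => h G * (cyc R m G - D ^+ m.+1))|
    <= C * (m%:R ^+ 2 + 18 * m%:R + 99) * M * D ^+ m.
Proof.
move=> m17 M0 hM hL; have /andP[m1 ml17] := m17.
have m20 : (1 < m < 20)%N by rewrite m1 (leq_trans ml17).
have m22 : (1 < m.+2 < 20)%N by apply/andP; split=> //; exact: (@leq_trans 19 m.+3 20).
have D20 := D20_; have DN := DN_.
pose L (G : graph n) : R := sumt m.+3 (fun s => (lc G s)%:R).
pose P (G : graph n) : R := sumt m.+3 (fun s => (pc G s)%:R).
have D0 : 0 < D :> R by lra.
have N0 : 0 < N :> R by lra.
set X := (N * D ^+ m.+1 : R); have X0 : 0 <= X :> R by rewrite mulr_ge0 ?exprn_ge0.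
have DX : D ^+ m.+3 <= C * X.
  have -> : D ^+ m.+3 = D ^+ 2 * D ^+ m.+1 :> R by rewrite -exprD.
  by rewrite /X mulrA ler_wpM2r ?exprn_ge0.
have DX2 : D ^+ m.+2 <= C * X.
  apply: le_trans DX; rewrite [leRHS]exprS ler_peMl ?exprn_ge0 //; lra.
have Ecm := Ex_cyc_le m20.
have E1 : `|Ex (fun G => h G * (N * D * cyc R m G - L G))| <= M * ((4 * m%:R + 8) * C * X).
  apply: (@le_trans _ _ (Ex (fun G => M * ((2 * m.+1%:R * D + 2 * D ^+ 2) * cyc R m G)))).
    apply: Ex_norm_le => G hG; rewrite normrM; apply: ler_pM => //; first exact: hM.
    rewrite ger0_norm; last by rewrite subr_ge0; exact: L_le.
    by have := L_ge R hG m; rewrite /L; lra.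
  rewrite ExZ ler_wpM2l // ExZ.
  apply: le_trans (ler_wpM2l _ Ecm) _.
    by rewrite addr_ge0 // ?mulr_ge0 // ?sqr_ge0.
  have -> : (2 * m.+1%:R * D + 2 * D ^+ 2) * (2 * D ^+ m.+1) =
     (4 * (m%:R + 1)) * D ^+ m.+2 + 4 * D ^+ m.+3 :> R.
    by rewrite natr1 !exprS; ring.
  have := ler_wpM2l (_ : 0 <= 4 * (m%:R + 1) :> R) DX2; rewrite mulr_ge0 ?addr_ge0 //.
  by move=> /(_ isT); lra.
have E2 : `|Ex (fun G => h G * (P G - N * D ^+ m.+2))|
    <= M * ((m%:R ^+ 2 + 2 * m%:R + 3 + 4 * C) * X).
  apply: (@le_trans _ _ (Ex (fun G => M * ((m%:R ^+ 2 + 2 * m%:R + 3) * X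
      + (D ^+ 2 * cyc R m G + cyc R m.+2 G))))).
    apply: Ex_norm_le => G hG; rewrite normrM; apply: ler_pM => //; first exact: hM.
    rewrite ler0_norm; last by rewrite subr_le0; exact: P_le.
    by have := P_ge R hG (ltnW m1); rewrite /P natrX /X; lra.
  rewrite ExZ ler_wpM2l // ExD Ex_cst // ExD ExZ.
  have Ecm2 := Ex_cyc_le m22.
  have := ler_wpM2l (sqr_ge0 D) Ecm.
  have -> : D ^+ 2 * (2 * D ^+ m.+1) = 2 * D ^+ m.+3 :> R by rewrite mulrCA -exprD.
  by lra.
(* By [cyc2_sw] the ordered triangle count moves by at most [6 (extra + 4)], where the 4 covers the
   two adjacency corrections. *)
have E3 : `|Ex (fun G => sumt m.+3 (fun s => (pc G s)%:R * (h (sws s G) - h G)))|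
    <= M * ((12 * m%:R + 36 + 48 * C) * X).
  apply: (@le_trans _ _ (Ex (fun G => M / D * 6 * (4 * P G +
     sumt m.+3 (fun s => (pc G s)%:R * extra R G s))))).
    apply: Ex_norm_le => G hG; apply: le_trans (ler_norm_sumt _ _) _.
    rewrite /P -sumtZ -sumtD -sumtZ; apply: ler_sumt => -[|b [|a [|x p]]] // [sp].
    have p1 : (1 < size p)%N by rewrite sp.
    case hpc : (pc G _); last by rewrite !mul0r mulr0 addr0 mulr0 normr0.
    rewrite !mul1r mulr1; apply: le_trans (hL _ _ hG _) _.
      by apply: sws_reg => //; exact: ltnW.
    have -> := cyc2_sw R hG p1 hpc.
    rewrite -[X in _ <= X]mulrA ler_wpM2l ?divr_ge0 // normrM ger0_norm // ler_wpM2l //.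
    rewrite /extra; set y := last x p.
    have c1 := cod_ge0 R G x y; have c2 := cod_ge0 R G a b.
    have c3 := cod_ge0 R G a x; have c4 := cod_ge0 R G b y.
    rewrite ler_norml; clear -c1 c2 c3 c4.
    by case: (adj G a y); case: (adj G b x) => /=; apply/andP; split; lra.
  rewrite ExZ ExD ExZ.
  have EP : Ex P <= N * D ^+ m.+2.
    rewrite -[leRHS](Ex_cst _ Reg_gt0); apply: ler_Ex => G hG; exact: P_le.
  have EE := Ex_extra_le m17.
  have MD0 : 0 <= M / D * 6 by rewrite mulr_ge0 // divr_ge0.
  apply: le_trans (ler_wpM2l MD0 (lerD (ler_wpM2l _ EP) EE)) _ => //.
  rewrite [D ^+ m.+2]exprS /X -natr1 le_eqVlt; apply/orP; left; apply/eqP.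
  by field; rewrite lt0r_neq0.
(* [L] and [P] replace their main terms [n d * cyc m] and [n d^(m + 2)]; by [switch_id] what is left
   between them is the change of [h] over the path sites. *)
have key : N * D * Ex (fun G => h G * (cyc R m G - D ^+ m.+1)) =
   Ex (fun G => h G * (N * D * cyc R m G - L G)) +
   Ex (fun G => h G * (P G - N * D ^+ m.+2)) +
   Ex (fun G => sumt m.+3 (fun s => (pc G s)%:R * (h (sws s G) - h G))).
  have -> : Ex (fun G => sumt m.+3 (fun s => (pc G s)%:R * (h (sws s G) - h G))) =
     Ex (fun G => h G * L G) - Ex (fun G => h G * P G).
    rewrite switch_id // -ExB; apply: eq_Ex => G _.
    rewrite /P -sumtZ -sumtB; apply: eq_sumt => s _.
    ring.
  rewrite -ExZ -ExB -!ExD; apply: eq_Ex => G _.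
  by rewrite [D ^+ m.+2]exprS; ring.
have ND0 : 0 < N * D :> R by rewrite mulr_gt0.
rewrite -(@ler_pM2l _ (N * D)) // -{1}(gtr0_norm ND0) -normrM key.
apply: le_trans (ler_normD _ _) _; apply: le_trans (lerD (ler_normD _ _) (lexx _)) _.
apply: le_trans (lerD (lerD E1 E2) E3) _.
(* The constant is the sum of the three errors: [4 m + 8], then [m^2 + 2 m + 3 + 4], then
   [12 m + 36 + 48], each coefficient being raised to a multiple of [C]. *)
have -> : N * D * (C * (m%:R ^+ 2 + 18 * m%:R + 99) * M * D ^+ m) =
  M * (C * (m%:R ^+ 2 + 18 * m%:R + 99) * X) by rewrite /X [D ^+ m.+1]exprS; ring.
rewrite -!mulrDr ler_wpM2l //.
have m0 : 0 <= m%:R :> R by [].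
have mm0 : 0 <= m%:R ^+ 2 :> R by rewrite sqr_ge0.
have : 0 <= (C - 1) * ((m%:R ^+ 2 + 14 * m%:R + 39) * X).
  by rewrite mulr_ge0 ?subr_ge0 // mulr_ge0 // !addr_ge0 // mulr_ge0.
by lra.
Qed.

End CycleLemma.

(** * Five- and six-vertex patterns *)

Definition between (R : realType) (lo x hi : R) := lo <= x <= hi.

Section TriangleCounts.
Variables (R : realType) (n d : nat) (x0 : 'I_n) (G : graph n).
Hypothesis hG : G \in reg_graphs n d.
Notation V := 'I_n.
Notation e := (adj G).
Notation D := d%:R.
Notation N := n%:R.
Notation T := (cyc R 2 G).
Notation I5 := (inj_count R x0 G 5).
Notation I6 := (inj_count R x0 G 6).
Notation P := (sumt 5 (fun s => (pc G s)%:R : R)).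
Notation L := (sumt 5 (fun s => (lc G s)%:R : R)).

Let sG := reg_sym hG.
Let iG := reg_irr hG.

(* Patterns on [b a x z y] (with indices 0, .., 4), respectively on [w b a x z y]. *)
Definition g5 : seq (nat * nat) := [:: (1, 2); (2, 3); (3, 4); (0, 4)].
Definition tri5 : seq (nat * nat) := [:: (1, 0); (2, 3); (3, 4); (2, 4)].
Definition g6 : seq (nat * nat) := [:: (2, 3); (3, 4); (4, 5); (1, 5)].

Lemma inj_count_ge0 k Es : 0 <= inj_count R x0 G k Es.
Proof. exact: sumt_ge0. Qed.

(** Inclusion and exclusion over the two forbidden edges [xy] and [ab]. *)
Lemma P_inj : P = I5 g5 - I5 ((2, 4) :: g5) - I5 ((1, 0) :: g5)
   + I5 ((1, 0) :: (2, 4) :: g5).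
Proof.
rewrite /inj_count -!sumtB -sumtD; apply: eq_sumt => -[|b [|a [|x [|z [|y [|? ?]]]]]] // _.
rewrite /pc; case: (uniq _) => /=; last by ring.
by case: (e a x); case: (e x z); case: (e z y); case: (e b y); case: (e x y);
  case: (e a b) => /=; ring.
Qed.

(** Inclusion and exclusion over [ax] and [by]. With both present the pattern has all six edges, so
    its last term is the one of [P_inj]. *)
Lemma L_inj : L = I5 tri5 - I5 ((1, 2) :: tri5) - I5 ((0, 4) :: tri5)
   + I5 ((1, 0) :: (2, 4) :: g5).
Proof.
rewrite /inj_count -!sumtB -sumtD; apply: eq_sumt => -[|b [|a [|x [|z [|y [|? ?]]]]]] // _.
rewrite /lc; case: (uniq _) => /=; last by ring.
by case: (e a x); case: (e x z); case: (e z y); case: (e b y); case: (e x y);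
  case: (e a b) => /=; ring.
Qed.

Lemma cyc4_inj : I5 ((1, 0) :: g5) = cyc R 4 G.
Proof.
apply: eq_sumt => -[|b [|a [|x [|z [|y [|? ?]]]]]] // _ /=.
by rewrite [e b a]sG [e b y]sG; congr (_%:R); case: (e a b); rewrite /= ?andbF ?andbT -?andbA.
Qed.

Lemma cyc5_inj : I6 ((0, 2) :: (0, 1) :: g6) = cyc R 5 G.
Proof.
rewrite /inj_count /cyc /= exchange_big; apply: eq_bigr => b _; apply: eq_bigr => w _.
do 4 (apply: eq_bigr => ? _).
congr ((nat_of_bool _)%:R); set s := [:: _; _; _; _].
rewrite -[X in X && _ = _]/(uniq [:: w, b & s]).
rewrite (perm_uniq (_ : perm_eq [:: w, b & s] [:: b, w & s])); last first.
  by apply/permP => q /=; rewrite addnCA.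
rewrite [e b w]sG [e b _]sG.
rewrite -[X in _ = X && _]/(uniq [:: b, w & s]).
by case: (uniq _) => //=; case: (e w b); case: (e w _); rewrite /= ?andbF ?andbT -?andbA.
Qed.

Definition tri x z y := [&& e x z, e z y & e y x].

Lemma tri_uniq x z y : tri x z y -> uniq [:: x; z; y].
Proof.
move=> /and3P[xz zy yx]; rewrite /= !inE !negb_or andbT.
have ne u v : e u v -> u != v by apply: contraTneq => ->; rewrite iG.
by rewrite (ne _ _ xz) (ne _ _ zy) eq_sym (ne _ _ yx).
Qed.

Lemma cyc2E : T = \sum_x \sum_z \sum_y (tri x z y)%:R.
Proof.
apply: eq_bigr => x _; apply: eq_bigr => z _; apply: eq_bigr => y _.
congr ((nat_of_bool _)%:R).
rewrite [LHS](_ : _ = uniq [:: x; z; y] && tri x z y); last first.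
  by rewrite /tri /= !andbT -?andbA.
by case: (boolP (tri x z y)) => h; rewrite ?andbF ?andbT ?tri_uniq.
Qed.

(** One union bound for all the ways of attaching [a] and [b] below: [b] in [s], [a] in [s] and
    [b = a] are removed at the price of column, row and diagonal sums. *)
Lemma sum_ends_gen s (H : V -> V -> R) (c : R) :
  (forall b a, 0 <= H b a) -> (forall a, \sum_b H b a <= D) ->
  (forall b, \sum_a H b a <= D) -> \sum_a H a a <= D ->
  \sum_b \sum_a H b a = c ->
  between (c - (2 * (size s)%:R + 1) * D)
    (\sum_b \sum_a ((b \notin a :: s) && (a \notin s))%:R * H b a) c.
Proof.
move=> H0 Hb Ha Hd Hc; rewrite /between; apply/andP; split; last first.
  rewrite -Hc; apply: ler_sum => b _; apply: ler_sum => a _.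
  by rewrite ler_piMl // (@ler_bool R _ true).
apply: (@le_trans _ _ (\sum_b \sum_a (H b a
   - (b \in s)%:R * H b a - (a \in s)%:R * H b a - (b == a)%:R * H b a))).
  under eq_bigr do rewrite !sumrB.
  rewrite !sumrB Hc.
  have h1 : \sum_b \sum_a (b \in s)%:R * H b a <= (size s)%:R * D.
    apply: le_trans (_ : _ <= \sum_b (b \in s)%:R * D) _.
      by apply: ler_sum => b _; rewrite -mulr_sumr ler_wpM2l.
    by rewrite -mulr_suml ler_wpM2r // sum_mem_le.
  have h2 : \sum_b \sum_a (a \in s)%:R * H b a <= (size s)%:R * D.
    rewrite exchange_big; apply: le_trans (_ : _ <= \sum_a (a \in s)%:R * D) _.
      by apply: ler_sum => a _; rewrite -mulr_sumr ler_wpM2l.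
    by rewrite -mulr_suml ler_wpM2r // sum_mem_le.
  have h3 : \sum_b \sum_a (b == a)%:R * H b a <= D.
    apply: le_trans Hd; rewrite exchange_big; apply: ler_sum => a _.
    rewrite (bigD1 a) //= eqxx mul1r big1 ?addr0 // => b /negbTE ->.
    by rewrite mul0r.
  by lra.
apply: ler_sum => b _; apply: ler_sum => a _; rewrite in_cons negb_or.
have := H0 b a.
by case: (b == a); case: (b \in s); case: (a \in s) => /=; lra.
Qed.

Lemma ends_pendant x y s :
  @between R (D ^+ 2 - (2 * (size s)%:R + 1) * D)
    (\sum_b \sum_a ((b \notin a :: s) && (a \notin s))%:R * ((e b y)%:R * (e a x)%:R))
    (D ^+ 2).
Proof.
apply: sum_ends_gen => [b a|a|b||]; first by rewrite mulr_ge0.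
- rewrite -mulr_suml (sum_adj_r R y hG) ler_piMr //; exact: (@ler_bool R _ true).
- rewrite -mulr_sumr (sum_adj_r R x hG) ler_piMl //; exact: (@ler_bool R _ true).
- rewrite -(sum_adj_r R x hG); apply: ler_sum => a _; rewrite ler_piMl //.
  exact: (@ler_bool R _ true).
- by rewrite sum_ends_prod !(sum_adj_r R _ hG).
Qed.

Lemma ends_edge s :
  @between R (N * D - (2 * (size s)%:R + 1) * D)
    (\sum_b \sum_a ((b \notin a :: s) && (a \notin s))%:R * (e a b)%:R) (N * D).
Proof.
apply: sum_ends_gen => [b a|a|b||] //; rewrite ?(sum_adj R _ hG) ?(sum_adj_r R _ hG) //.
- by rewrite big1 // => a _; rewrite iG.
- by rewrite exchange_big /= (sum_adj2 R hG).
Qed.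

Lemma ends_path_a x s :
  @between R (D ^+ 2 - (2 * (size s)%:R + 1) * D)
    (\sum_b \sum_a ((b \notin a :: s) && (a \notin s))%:R * ((e a b)%:R * (e a x)%:R))
    (D ^+ 2).
Proof.
apply: sum_ends_gen => [b a|a|b||]; first by rewrite mulr_ge0.
- rewrite -mulr_suml (sum_adj R a hG) ler_piMr //; exact: (@ler_bool R _ true).
- rewrite -(sum_adj_r R x hG); apply: ler_sum => a _; rewrite ler_piMl //.
  exact: (@ler_bool R _ true).
- by rewrite big1 // => a _; rewrite iG mul0r.
- rewrite exchange_big /=; under eq_bigr do rewrite -mulr_suml (sum_adj R _ hG).
  by rewrite -mulr_sumr (sum_adj_r R _ hG).
Qed.

Lemma ends_path_b y s :
  @between R (D ^+ 2 - (2 * (size s)%:R + 1) * D)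
    (\sum_b \sum_a ((b \notin a :: s) && (a \notin s))%:R * ((e a b)%:R * (e b y)%:R))
    (D ^+ 2).
Proof.
apply: sum_ends_gen => [b a|a|b||]; first by rewrite mulr_ge0.
- rewrite -(sum_adj_r R y hG); apply: ler_sum => b _; rewrite ler_piMl //.
  exact: (@ler_bool R _ true).
- rewrite -mulr_suml (sum_adj_r R b hG) ler_piMr //; exact: (@ler_bool R _ true).
- by rewrite big1 // => a _; rewrite iG mul0r.
- under eq_bigr do rewrite -mulr_suml (sum_adj_r R _ hG).
  by rewrite -mulr_sumr (sum_adj_r R _ hG).
Qed.

Lemma tri_ext Es (H : V -> V -> V -> V -> V -> R) (c : R) :
  (forall b a x z y, (uniq [:: b; a; x; z; y] && has_all G (inst x0 [:: b; a; x; z; y] Es))%:R =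
     (tri x z y)%:R * (((b \notin [:: a; x; z; y]) && (a \notin [:: x; z; y]))%:R * H x z y b a)) ->
  (forall x z y, between (c - (2 * 3 + 1) * D)
     (\sum_b \sum_a ((b \notin [:: a; x; z; y]) && (a \notin [:: x; z; y]))%:R * H x z y b a) c) ->
  between ((c - 7 * D) * T) (I5 Es) (c * T).
Proof.
move=> h1 h2; rewrite /between cyc2E /inj_count sumt_front2 /= !mulr_sumr.
have E x z y : \sum_b \sum_a (uniq [:: b; a; x; z; y] &&
      has_all G (inst x0 [:: b; a; x; z; y] Es))%:R = (\sum_b \sum_a
      ((b \notin [:: a; x; z; y]) && (a \notin [:: x; z; y]))%:R * H x z y b a) *
      (tri x z y)%:R.
  rewrite mulr_suml; apply: eq_bigr => b _; rewrite mulr_suml.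
  by apply: eq_bigr => a _; rewrite h1 mulrC.
apply/andP; split; apply: ler_sum => x _; rewrite mulr_sumr; apply: ler_sum => z _;
  rewrite mulr_sumr; apply: ler_sum => y _; have /andP[h3 h4] := h2 x z y;
  rewrite E ler_wpM2r //; lra.
Qed.

End TriangleCounts.

Section PatternEstimates.
Variables (R : realType) (n d : nat) (x0 : 'I_n) (G : graph n).
Hypotheses (hG : G \in reg_graphs n d) (d20 : (20 <= d)%N).
Notation V := 'I_n.
Notation e := (adj G).
Notation D := d%:R.
Notation N := n%:R.
Notation T := (cyc R 2 G).
Notation I5 := (inj_count R x0 G 5).
Notation tri := (tri G).

Let sG := reg_sym hG.
Let iG := reg_irr hG.

Lemma tri_bool b a x z y (c : bool) :
  uniq [:: b; a; x; z; y] && [&& e x z, e z y, e x y & c] =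
  tri x z y && (((b \notin [:: a; x; z; y]) && (a \notin [:: x; z; y])) && c).
Proof.
have -> : uniq [:: b; a; x; z; y] = [&& b \notin [:: a; x; z; y], a \notin [:: x; z; y]
  & uniq [:: x; z; y]] by [].
have [ht|] := boolP (tri x z y).
  rewrite (tri_uniq hG ht) andbT; move: ht => /and3P[-> -> h].
  by rewrite [e x y]sG h.
rewrite /tri [e y x]sG.
by case: (e x z); case: (e z y); case: (e x y) => //=; rewrite ?andbF.
Qed.

Lemma inj5_xy : between ((D ^+ 2 - 7 * D) * T) (I5 ((2, 4) :: g5)) (D ^+ 2 * T).
Proof.
apply: (tri_ext hG (H := fun x z y b a => (e b y)%:R * (e a x)%:R)) => [b a x z y|x z y].
  rewrite -!natrM !mulnb -tri_bool; congr ((nat_of_bool _)%:R); congr (_ && _) => /=.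
  by case: (e x y); case: (e a x); case: (e x z); case: (e z y); case: (e b y).
exact: ends_pendant.
Qed.

Lemma inj5_edge : between ((N * D - 7 * D) * T) (I5 tri5) (N * D * T).
Proof.
apply: (tri_ext hG (H := fun x z y b a => (e a b)%:R)) => [b a x z y|x z y].
  rewrite -!natrM !mulnb -tri_bool; congr ((nat_of_bool _)%:R); congr (_ && _) => /=.
  by case: (e x y); case: (e a b); case: (e x z); case: (e z y).
exact: ends_edge.
Qed.

Lemma inj5_path_a : between ((D ^+ 2 - 7 * D) * T) (I5 ((1, 2) :: tri5)) (D ^+ 2 * T).
Proof.
apply: (tri_ext hG (H := fun x z y b a => (e a b)%:R * (e a x)%:R)) => [b a x z y|x z y].
  rewrite -!natrM !mulnb -tri_bool; congr ((nat_of_bool _)%:R); congr (_ && _) => /=.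
  by case: (e x y); case: (e a x); case: (e x z); case: (e z y); case: (e a b).
exact: ends_path_a.
Qed.

Lemma inj5_path_b : between ((D ^+ 2 - 7 * D) * T) (I5 ((0, 4) :: tri5)) (D ^+ 2 * T).
Proof.
apply: (tri_ext hG (H := fun x z y b a => (e a b)%:R * (e b y)%:R)) => [b a x z y|x z y].
  rewrite -!natrM !mulnb -tri_bool; congr ((nat_of_bool _)%:R); congr (_ && _) => /=.
  by case: (e x y); case: (e b y); case: (e x z); case: (e z y); case: (e a b).
exact: ends_path_b.
Qed.

Lemma sum_neq u z : e u z -> \sum_a ((e a u) && (a != z))%:R = D - 1 :> R.
Proof.
move=> uz; rewrite -(sum_adj_r R u hG) [in RHS](bigD1 z) //= sG uz addrC addrK.
rewrite (bigD1 z) //= eqxx andbF add0r; apply: eq_bigr => a az.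
by rewrite az andbT.
Qed.

(** Choosing [z], then [x] and [y], then [a] and [b], always without turning back, gives exactly
    [n d (d - 1)^3]. The coincidences left are [a = y] and [b = x], each closing a triangle with a
    pendant edge, and [a = b], closing a 4-cycle. Using [d^3] instead of [(d - 1)^3] would cost
    [n d^3], more than the admissible [n d^2]. *)
Lemma inj5_path : between (N * D * (D - 1) ^+ 3 - 2 * D * T - cyc R 3 G)
  (I5 g5) (N * D * (D - 1) ^+ 3).
Proof.
pose B x z y b a := ([&& e x z, e z y & x != y])%:R *
  (((e b y) && (b != z))%:R * ((e a x) && (a != z))%:R) : R.
have HB : \sum_x \sum_z \sum_y \sum_b \sum_a B x z y b a = N * D * (D - 1) ^+ 3.
  transitivity (\sum_x \sum_z \sum_y ([&& e x z, e z y & x != y])%:R * (D - 1) ^+ 2 : R).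
    do 3 (apply: eq_bigr => ? _).
    under eq_bigr do rewrite -mulr_sumr.
    rewrite -mulr_sumr sum_ends_prod.
    case: and3P => [[h1 h2 _]|_]; last by rewrite !mul0r.
    by rewrite !sum_neq ?mul1r ?expr2 // sG.
  rewrite exchange_big /=.
  transitivity (\sum_(z : V) (D * (D - 1) ^+ 3 : R)); last first.
    by rewrite sumr_const card_ord -[RHS]mulrA [RHS]mulr_natl.
  apply: eq_bigr => z _.
  transitivity (\sum_(x : V) ((e x z)%:R * (D - 1) ^+ 3 : R)); last first.
    by rewrite -mulr_suml (sum_adj_r R _ hG).
  apply: eq_bigr => x _; rewrite -mulr_suml [in RHS]exprS mulrA; congr (_ * _).
  case xz : (e x z); last by rewrite mul0r big1.
  rewrite mul1r -(sum_neq (_ : e z x)); last by rewrite sG.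
  by apply: eq_bigr => y _; rewrite [e y z]sG [y == x]eq_sym.
rewrite /between /inj_count sumt_front2 /=.
apply/andP; split; last first.
  rewrite -HB; apply: ler_sum => x _; apply: ler_sum => z _; apply: ler_sum => y _.
  apply: ler_sum => b _; apply: ler_sum => a _.
  rewrite /B -!natrM !mulnb !inE !negb_or; apply: ler_bool.
  move=> /andP[/and5P[/and4P[_ _ bz _] /and3P[_ az _] /andP[_ xy] _ _]].
  by move=> /and5P[-> -> -> -> _]; rewrite bz az xy.
rewrite (cyc2E R hG).
have HT1 : \sum_x \sum_z \sum_y \sum_b \sum_a B x z y b a * (a == y)%:R
    <= D * \sum_x \sum_z \sum_y (tri x z y)%:R.
  rewrite mulr_sumr; apply: ler_sum => x _; rewrite mulr_sumr; apply: ler_sum => z _.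
  rewrite mulr_sumr; apply: ler_sum => y _.
  apply: (@le_trans _ _ (\sum_b \sum_a ((e b y)%:R * ((a == y)%:R * (tri x z y)%:R)))).
    apply: ler_sum => b _; apply: ler_sum => a _; rewrite /B -!natrM !mulnb.
    apply: ler_bool => /andP[/and3P[/and3P[h1 h2 _] /andP[h3 _] /andP[h4 _]] /eqP ay].
    by rewrite h3 ay eqxx /tri h1 h2 -ay h4.
  rewrite sum_ends_prod (sum_adj_r R _ hG) -mulr_suml.
  rewrite (bigD1 y) //= eqxx big1 ?addr0 ?mul1r // => a /negbTE ->.
  by [].
have HT2 : \sum_x \sum_z \sum_y \sum_b \sum_a B x z y b a * (b == x)%:R
    <= D * \sum_x \sum_z \sum_y (tri x z y)%:R.
  rewrite mulr_sumr; apply: ler_sum => x _; rewrite mulr_sumr; apply: ler_sum => z _.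
  rewrite mulr_sumr; apply: ler_sum => y _.
  apply: (@le_trans _ _ (\sum_b \sum_a (((b == x)%:R * (tri x z y)%:R) * (e a x)%:R))).
    apply: ler_sum => b _; apply: ler_sum => a _; rewrite /B -!natrM !mulnb.
    apply: ler_bool => /andP[/and3P[/and3P[h1 h2 _] /andP[h3 _] /andP[h4 _]] /eqP bx].
    by rewrite h4 bx eqxx /tri h1 h2 -bx sG h3.
  rewrite sum_ends_prod (sum_adj_r R _ hG) -mulr_suml mulrC.
  rewrite (bigD1 x) //= eqxx big1 ?addr0 ?mul1r // => a /negbTE ->.
  by [].
have HC : \sum_x \sum_z \sum_y \sum_b \sum_a B x z y b a * (b == a)%:R <= cyc R 3 G.
  rewrite /cyc sumt_front /=.
  apply: ler_sum => x _; apply: ler_sum => z _; apply: ler_sum => y _.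
  rewrite exchange_big; apply: ler_sum => a _.
  rewrite (bigD1 a) //= [X in _ + X]big1 ?addr0 => [|b /negbTE ->]; last by rewrite mulr0.
  rewrite eqxx mulr1 /B -!natrM !mulnb !inE !negb_or; apply: ler_bool.
  move=> /and3P[/and3P[xz zy xy] /andP[ay az] /andP[ax _]].
  have ne u v : e u v -> u != v by apply: contraTneq => ->; rewrite iG.
  by rewrite (ne _ _ ax) az (ne _ _ ay) (ne _ _ xz) xy (ne _ _ zy) ax xz zy sG ay.
rewrite -HB.
apply: (@le_trans _ _ (\sum_x \sum_z \sum_y \sum_b \sum_a B x z y b a
   - (\sum_x \sum_z \sum_y \sum_b \sum_a B x z y b a * (a == y)%:R)
   - (\sum_x \sum_z \sum_y \sum_b \sum_a B x z y b a * (b == x)%:R)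
   - (\sum_x \sum_z \sum_y \sum_b \sum_a B x z y b a * (b == a)%:R))).
  by lra.
rewrite -!sumrB.
apply: ler_sum => x _; rewrite -!sumrB; apply: ler_sum => z _; rewrite -!sumrB.
apply: ler_sum => y _; rewrite -!sumrB; apply: ler_sum => b _; rewrite -!sumrB.
apply: ler_sum => a _.
rewrite /B !inE !negb_or.
have ne u v : e u v -> u != v by apply: contraTneq => ->; rewrite iG.
case xz : (e x z); last by rewrite /= !mul0r !subr0.
case zy : (e z y); last by rewrite /= !mul0r !subr0.
case bY : (e b y); last by rewrite /= !(mul0r, mulr0) !subr0.
case ax : (e a x); last by rewrite /= !(mul0r, mulr0) !subr0.
rewrite (ne _ _ xz) (ne _ _ zy) (ne _ _ bY) (ne _ _ ax) /=.
clear HB HT1 HT2 HC.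
case: (x == y); case: (b == z); case: (a == z); case: (a == y); case: (b == x);
  case: (b == a) => /=; lra.
Qed.

End PatternEstimates.

Section WedgeEstimates.
Variables (R : realType) (n d : nat) (x0 : 'I_n) (G : graph n).
Hypotheses (hG : G \in reg_graphs n d) (d20 : (20 <= d)%N).
Notation V := 'I_n.
Notation e := (adj G).
Notation D := d%:R.
Notation T := (cyc R 2 G).
Notation I6 := (inj_count R x0 G 6).
Notation tri := (tri G).

Let sG := reg_sym hG.
Let iG := reg_irr hG.

Lemma sum_front2_3 (F : V -> V -> V -> V -> V -> R) :
  \sum_b \sum_a \sum_x \sum_z \sum_y F b a x z y =
  \sum_x \sum_z \sum_y \sum_b \sum_a F b a x z y.
Proof.
exact: (sumt_front2 3 (fun s => if s is [:: b; a; x; z; y] then F b a x z y else 0)).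
Qed.

Lemma sum_rev5 (F : V -> V -> V -> V -> V -> R) :
  \sum_b \sum_a \sum_x \sum_z \sum_y F b a x z y =
  \sum_b \sum_a \sum_x \sum_z \sum_y F a b y z x.
Proof.
rewrite exchange_big; apply: eq_bigr => b _; apply: eq_bigr => a _.
rewrite exchange_big; under eq_bigr do rewrite exchange_big.
by rewrite exchange_big.
Qed.

Lemma inj6_xy : between ((D ^+ 2 - 9 * D) * cyc R 3 G) (I6 ((0, 3) :: (0, 5) :: g6))
  (D ^+ 2 * cyc R 3 G).
Proof.
pose c4 w x z y := uniq [:: w; x; z; y] && [&& path e w [:: x; z; y] & e y w].
have E w x z y : \sum_b \sum_a (uniq [:: w; b; a; x; z; y] &&
      has_all G (inst x0 [:: w; b; a; x; z; y] ((0, 3) :: (0, 5) :: g6)))%:R =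
   (\sum_b \sum_a ((b \notin [:: a; w; x; z; y]) && (a \notin [:: w; x; z; y]))%:R *
     ((e b y)%:R * (e a x)%:R)) * (c4 w x z y)%:R :> R.
  rewrite mulr_suml; apply: eq_bigr => b _; rewrite mulr_suml.
  apply: eq_bigr => a _; rewrite -!natrM !mulnb; congr ((nat_of_bool _)%:R).
  rewrite (perm_uniq (_ : perm_eq _ [:: b, a, w & [:: x; z; y]])); last first.
    by apply/permP => q /=; lia.
  rewrite -[uniq _]/([&& b \notin [:: a; w; x; z; y], a \notin [:: w; x; z; y] &
    uniq [:: w; x; z; y]]) /c4 /= [e y w]sG.
  set u := [&& w \notin _, _ & _].
  case: (b \notin _); case: (a \notin _) => //=; rewrite ?andbF //.
  by case: u; case: (e w x); case: (e w y); case: (e b y); case: (e a x);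
     case: (e x z); case: (e z y).
rewrite /between /cyc /inj_count /=.
rewrite !mulr_sumr.
apply/andP; split; apply: ler_sum => w _; rewrite sum_front2_3;
  rewrite mulr_sumr; apply: ler_sum => x _;
  rewrite mulr_sumr; apply: ler_sum => z _; rewrite mulr_sumr; apply: ler_sum => y _;
  rewrite E; have /andP[h1 h2] := ends_pendant R hG x y [:: w; x; z; y];
  rewrite -/(c4 w x z y) ler_wpM2r //; rewrite [size _]/= in h1; lra.
Qed.

Lemma ext_between (c : bool) u s : between (c%:R * (D - (size s)%:R))
  (\sum_v (c && ((v \notin s) && e v u))%:R) (c%:R * D : R).
Proof.
under eq_bigr do rewrite -mulnb natrM.
rewrite -mulr_sumr; apply/andP; split; rewrite ler_wpM2l //.
  exact: (ext_ge R hG).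
rewrite -(sum_adj_r R u hG); apply: ler_sum => v _.
by apply: ler_bool => /andP[].
Qed.

Lemma inj6_ax_eq : I6 ((0, 2) :: (0, 3) :: g6) =
  \sum_w \sum_a \sum_x \sum_z \sum_y \sum_b
   ([&& [&& tri w a x & (z \notin [:: x; a; w]) && e z x] &
      (y \notin [:: z; x; a; w]) && e y z] &&
      ((b \notin [:: y; z; x; a; w]) && e b y))%:R.
Proof.
rewrite /inj_count /=; apply: eq_bigr => w _.
rewrite exchange_big /=; apply: eq_bigr => a _.
rewrite exchange_big /=; apply: eq_bigr => x _.
rewrite exchange_big /=; apply: eq_bigr => z _.
rewrite exchange_big /=; apply: eq_bigr => y _; apply: eq_bigr => b _.
congr ((nat_of_bool _)%:R).
rewrite -[X in X && _]/(uniq [:: w; b; a; x; z; y]).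
rewrite (perm_uniq (_ : perm_eq _ [:: b; y; z; x; a; w])); last first.
  by apply/permP => q /=; lia.
rewrite -[uniq _]/([&& b \notin [:: y; z; x; a; w], y \notin [:: z; x; a; w],
  z \notin [:: x; a; w] & uniq [:: x; a; w]]).
case: (b \notin _); last by rewrite /= andbF.
case: (y \notin _); last by rewrite /= andbF.
case: (z \notin _); last by rewrite /= andbF.
rewrite [e z x]sG [e y z]sG.
have [ht|] := boolP (tri w a x).
  have U : uniq [:: x; a; w].
    rewrite (perm_uniq (_ : perm_eq _ [:: w; a; x])) ?(tri_uniq hG ht) //.
    by apply/permP => q /=; lia.
  rewrite U; move: ht => /and3P[-> -> h].
  by rewrite [e w x]sG h; case: (e x z); case: (e z y); case: (e b y).
rewrite /tri [e x w]sG.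
by case: (e w a); case: (e a x); case: (e w x) => //=; rewrite ?andbF.
Qed.

(** The pattern is the triangle [w a x] with the tail [z, y, b] hanging from [x]. Growing the tail
    vertex by vertex gives at least [(d - 3) (d - 4) (d - 5)] extensions, and [12 = 3 + 4 + 5]. *)
Lemma inj6_ax : between ((D ^+ 3 - 12 * D ^+ 2) * T) (I6 ((0, 2) :: (0, 3) :: g6))
   (D ^+ 3 * T).
Proof.
rewrite inj6_ax_eq (cyc2E R hG).
set Q1 := \sum_x \sum_z \sum_y _.
pose c2 w a x z := tri w a x && ((z \notin [:: x; a; w]) && e z x).
pose c3 w a x z y := c2 w a x z && ((y \notin [:: z; x; a; w]) && e y z).
pose Q2 := \sum_w \sum_a \sum_x \sum_z (c2 w a x z)%:R : R.
pose Q3 := \sum_w \sum_a \sum_x \sum_z \sum_y (c3 w a x z y)%:R : R.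
have D20 : 20 <= D :> R by rewrite ler_nat.
have /andP[q1 q1'] : between (Q1 * (D - 3)) Q2 (Q1 * D).
  rewrite /between /Q1 /Q2 !mulr_suml.
  apply/andP; split; apply: ler_sum => w _; rewrite mulr_suml; apply: ler_sum => a _;
    rewrite mulr_suml; apply: ler_sum => x _;
    by have /andP[] := ext_between (tri w a x) x [:: x; a; w].
have /andP[q2 q2'] : between (Q2 * (D - 4)) Q3 (Q2 * D).
  rewrite /between /Q2 /Q3 !mulr_suml.
  apply/andP; split; apply: ler_sum => w _; rewrite mulr_suml; apply: ler_sum => a _;
    rewrite mulr_suml; apply: ler_sum => x _; rewrite mulr_suml; apply: ler_sum => z _;
    by have /andP[] := ext_between (c2 w a x z) z [:: z; x; a; w].
have : between (Q3 * (D - 5)) (\sum_w \sum_a \sum_x \sum_z \sum_y \sum_b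
      (c3 w a x z y && ((b \notin [:: y; z; x; a; w]) && e b y))%:R) (Q3 * D).
  rewrite /between /Q3 !mulr_suml.
  apply/andP; split; apply: ler_sum => w _; rewrite mulr_suml; apply: ler_sum => a _;
    rewrite mulr_suml; apply: ler_sum => x _; rewrite mulr_suml; apply: ler_sum => z _;
    rewrite mulr_suml; apply: ler_sum => y _;
    by have /andP[] := ext_between (c3 w a x z y) y [:: y; z; x; a; w].
move=> /andP[q3 q3'].
have Q10 : 0 <= Q1.
  by apply: sumr_ge0 => w _; apply: sumr_ge0 => a _; apply: sumr_ge0.
apply/andP; split.
  apply: le_trans q3.
  have D5 : 0 <= D - 5 :> R by lra.
  have D4 : 0 <= D - 4 :> R by lra.
  have := ler_wpM2r D5 (le_trans (ler_wpM2r D4 q1) q2).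
  have := mulr_ge0 Q10 (_ : 0 <= 47 * D - 60 :> R); rewrite subr_ge0.
  have -> : 60 <= 47 * D :> R by lra.
  by move=> /(_ isT); lra.
apply: le_trans q3' _.
have D0 : 0 <= D :> R by [].
by have := ler_wpM2r D0 (le_trans q2' (ler_wpM2r D0 q1')); lra.
Qed.

(** Reversing the path exchanges [a] with [b] and [x] with [y]. *)
Lemma inj6_by_eq : I6 ((0, 1) :: (0, 5) :: g6) = I6 ((0, 2) :: (0, 3) :: g6).
Proof.
rewrite /inj_count /=; apply: eq_bigr => w _; rewrite sum_rev5.
apply: eq_bigr => b _; apply: eq_bigr => a _; apply: eq_bigr => x _.
apply: eq_bigr => z _; apply: eq_bigr => y _; congr ((nat_of_bool _)%:R).
rewrite -[X in X && _]/(uniq [:: w; a; b; y; z; x]).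
rewrite -[X in _ = X && _]/(uniq [:: w; b; a; x; z; y]).
rewrite (perm_uniq (_ : perm_eq _ [:: w; b; a; x; z; y])); last first.
  by apply/permP => q /=; lia.
rewrite [e y z]sG [e z x]sG; case: (uniq _) => //=.
by case: (e w a); case: (e w x); case: (e a x); case: (e x z); case: (e z y);
  case: (e b y).
Qed.

(** Common neighbours off the path, summed over sites [[:: b; a; x; z; y]]: the index pairs [2 4],
    [1 0], [1 2], [0 4] stand for [xy], [ab], [ax], [by]. *)
Definition wedge_sum (i j : nat) : R := sumt 5 (fun t => (pc G t)%:R *
  \sum_w (w \notin t)%:R * ((e (nth x0 t i) w)%:R * (e (nth x0 t j) w)%:R)).

(** Dropping the two non-adjacency conditions of [pc] gives the upper bound, and a union bound over
    their failure the lower one. Indices shift by one since [w] now stands in front: [(3, 5)] is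
    [xy] and [(2, 1)] is [ab]. *)
Lemma wedge_sum_bounds i j (Es := (0, i.+1) :: (0, j.+1) :: g6) :
  between (I6 Es - I6 ((3, 5) :: Es) - I6 ((2, 1) :: Es)) (wedge_sum i j) (I6 Es).
Proof.
have F Es' : I6 Es' = sumt 5 (fun t => \sum_w
    (uniq (w :: t) && has_all G (inst x0 (w :: t) Es'))%:R) by rewrite /inj_count sumt_front.
rewrite /between /wedge_sum !F -!sumtB.
have H b a x z y w (t := [:: b; a; x; z; y]) :
    @between R ((uniq (w :: t) && has_all G (inst x0 (w :: t) Es))%:R
    - (uniq (w :: t) && has_all G (inst x0 (w :: t) ((3, 5) :: Es)))%:R
    - (uniq (w :: t) && has_all G (inst x0 (w :: t) ((2, 1) :: Es)))%:R)
    ((pc G t)%:R * ((w \notin t)%:R * ((e (nth x0 t i) w)%:R * (e (nth x0 t j) w)%:R)))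
    ((uniq (w :: t) && has_all G (inst x0 (w :: t) Es))%:R).
  rewrite /between.
  rewrite -!natrM !mulnb.
  rewrite -[pc G _]/([&& uniq t, e a x, [&& e x z, e z y & true], e b y, ~~ e x y & ~~ e a b]).
  have E1 : has_all G (inst x0 (w :: t) Es) = [&& e w (nth x0 t i), e w (nth x0 t j),
    e a x, e x z, e z y, e b y & true] by [].
  have E2 : has_all G (inst x0 (w :: t) ((3, 5) :: Es)) = e x y &&
     has_all G (inst x0 (w :: t) Es) by [].
  have E3 : has_all G (inst x0 (w :: t) ((2, 1) :: Es)) = e a b &&
     has_all G (inst x0 (w :: t) Es) by [].
  rewrite E2 E3 E1 -[uniq (w :: t)]/((w \notin t) && uniq t) ![e (nth x0 t _) w]sG.
  move: (w \notin t) (uniq t) (e w (nth x0 t i)) (e w (nth x0 t j)) => [] [] [] [] //=;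
    rewrite ?andbF ?subr0 ?lexx //.
  clear F E1 E2 E3.
  by case: (e a x); case: (e x z); case: (e z y); case: (e b y); case: (e x y);
    case: (e a b) => //=; apply/andP; split; lra.
apply/andP; split; apply: ler_sumt => -[|b [|a [|x [|z [|y [|? ?]]]]]] // _;
  rewrite -?sumrB mulr_sumr; apply: ler_sum => w _;
  by have /andP[] := H b a x z y w.
Qed.

End WedgeEstimates.

(** * The change of the triangle count summed over all path sites *)

Section TriangleChange.
Variables (R : realType) (n d : nat) (x0 : 'I_n) (G : graph n).
Hypotheses (hG : G \in reg_graphs n d) (d20 : (20 <= d)%N).
Notation V := 'I_n.
Notation e := (adj G).
Notation D := d%:R.
Notation N := n%:R.
Notation cod := (cod R G).
Notation T := (cyc R 2 G).
Notation I5 := (inj_count R x0 G 5).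
Notation I6 := (inj_count R x0 G 6).
Notation P := (sumt 5 (fun s => (pc G s)%:R : R)).
Notation L := (sumt 5 (fun s => (lc G s)%:R : R)).

Let sG := reg_sym hG.
Let iG := reg_irr hG.

(** At a path site, the exact increment of the number of unordered triangles, a sixth of the one in
    [cyc2_sw]. *)
Definition gain (s : seq V) : R := if s is b :: a :: x :: p then
  let y := last x p in
  cod x y + cod a b - cod a x - cod b y - 2 * (e a y)%:R - 2 * (e b x)%:R else 0.

Lemma cyc2_sws s : size s = 5 -> pc G s ->
  cyc R 2 (sws s G) - cyc R 2 G = 6 * gain s.
Proof.
case: s => [|b [|a [|x p]]] // [sp] h.
by rewrite (cyc2_sw R hG _ h) // sp.
Qed.

Lemma gain_le s : `|gain s| <= extra R G s + 4.
Proof.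
case: s => [|b [|a [|x p]]]; rewrite /gain /extra ?normr0 ?add0r //.
set y := last x p.
have c1 := cod_ge0 R G x y; have c2 := cod_ge0 R G a b.
have c3 := cod_ge0 R G a x; have c4 := cod_ge0 R G b y.
rewrite ler_norml; clear -c1 c2 c3 c4.
by case: (e a y); case: (e b x) => /=; apply/andP; split; lra.
Qed.

Lemma extra_le s : extra R G s <= 4 * D.
Proof.
case: s => [|b [|a [|x p]]]; rewrite /extra ?mulr_ge0 //.
have := cod_le R hG x (last x p); have := cod_le R hG a b.
have := cod_le R hG a x; have := cod_le R hG b (last x p).
by lra.
Qed.

Lemma extra_ge0 s : 0 <= extra R G s.
Proof.
by case: s => [|b [|a [|x p]]] //; rewrite /extra !addr_ge0 // cod_ge0.
Qed.

(* Contribution to [gain] of the common neighbours lying on the path itself, apart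
   from the common neighbour [z] of [x] and [y], which accounts for the new triangle. *)
Definition zdeg (t : seq V) : R := if t is [:: b; a; x; z; y]
  then (e a z)%:R * (e b z)%:R - (e a z)%:R - (e b z)%:R else 0.

(** Each codegree is split into common neighbours off the site and the five vertices of the site.
    Among the latter, [z] as a common neighbour of [x] and [y] yields [P]; the pairs counted through
    [a], [b] for [xy] and through [x], [y] for [ab] cancel the adjacency corrections exactly; only
    [zdeg] survives. *)
Lemma gain_split : sumt 5 (fun t => (pc G t)%:R * gain t) =
  P + sumt 5 (fun t => (pc G t)%:R * zdeg t) + wedge_sum R x0 G 2 4
   + wedge_sum R x0 G 1 0 - wedge_sum R x0 G 1 2 - wedge_sum R x0 G 0 4.
Proof.
rewrite /wedge_sum -!sumtD -!sumtB; apply: eq_sumt => -[|b [|a [|x [|z [|y [|? ?]]]]]] // _.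
set t := [:: b; a; x; z; y].
case hpc : (pc G t); last by rewrite !mul0r !addr0 !subr0.
rewrite !mul1r; move: hpc; rewrite /pc -/t => /and5P[us Eax hp Eby /andP[nxy nab]].
have F u v : cod u v = \sum_w (w \notin t)%:R * ((e u w)%:R * (e v w)%:R)
    + ((e u b)%:R * (e v b)%:R + ((e u a)%:R * (e v a)%:R + ((e u x)%:R * (e v x)%:R +
      ((e u z)%:R * (e v z)%:R + (e u y)%:R * (e v y)%:R)))).
  rewrite /cod (sum_mem_uniq _ us); congr (_ + _).
  by rewrite /t !big_cons big_nil addr0.
rewrite /gain /zdeg /t /= -/t !F.
move: hp nxy => /= /and3P[Exz Ezy _] nxy.
have -> : e a b = false by exact/negbTE.
have -> : e x y = false by exact/negbTE.
rewrite !iG Eax Exz Eby ![e x a]sG Eax ![e y b]sG Eby ![e y z]sG Ezy [e b a]sG (negbTE nab).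
rewrite [e y x]sG (negbTE nxy) [e x b]sG [e y a]sG /=.
by ring.
Qed.

Lemma zdeg_le : `|sumt 5 (fun t => (pc G t)%:R * zdeg t)| <=
  I5 ((1, 3) :: g5) + I5 ((0, 3) :: g5).
Proof.
apply: le_trans (ler_norm_sumt _ _) _; rewrite /inj_count -sumtD.
apply: ler_sumt => -[|b [|a [|x [|z [|y [|? ?]]]]]] // _.
set t := [:: b; a; x; z; y].
case hpc : (pc G t); last by rewrite mul0r normr0 addr_ge0.
move: hpc; rewrite /pc -/t => /and5P[us Eax /and3P[Exz Ezy _] Eby _].
rewrite us !andTb.
have -> : has_all G (inst x0 t ((1, 3) :: g5)) =
  [&& e a z, e a x, e x z, e z y, e b y & true] by [].
have -> : has_all G (inst x0 t ((0, 3) :: g5)) =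
  [&& e b z, e a x, e x z, e z y, e b y & true] by [].
rewrite Eax Exz Ezy Eby /zdeg /t /= !andbT.
by case: (e a z); case: (e b z); rewrite /= ler_norml; apply/andP; split; lra.
Qed.

Definition chord6 Es : R := I6 ((3, 5) :: Es) + I6 ((2, 1) :: Es).

Definition gain_err : R :=
  I5 ((1, 3) :: g5) + I5 ((0, 3) :: g5)
  + chord6 ((0, 3) :: (0, 5) :: g6) + chord6 ((0, 2) :: (0, 1) :: g6)
  + chord6 ((0, 2) :: (0, 3) :: g6) + chord6 ((0, 1) :: (0, 5) :: g6)
  + 9 * D * cyc R 3 G + 24 * D ^+ 2 * T.

(** The three cycle terms beside [P] are each of order [d^6] and cancel only on average, so they are
    kept explicit for [cyc_weak]; everything in [gain_err] is of order [d^5] in expectation. *)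
Lemma gain_sum : `|sumt 5 (fun t => (pc G t)%:R * gain t)
   - (P + D ^+ 2 * cyc R 3 G + cyc R 5 G - 2 * D ^+ 3 * T)| <= gain_err.
Proof.
have := zdeg_le; rewrite ler_norml => /andP[z1 z2].
rewrite gain_split /gain_err /chord6.
have /andP[a1 a2] : between _ _ _ := wedge_sum_bounds R x0 hG 2 4.
have /andP[b1 b2] : between _ _ _ := wedge_sum_bounds R x0 hG 1 0.
have /andP[c1 c2] : between _ _ _ := wedge_sum_bounds R x0 hG 1 2.
have /andP[d1 d2] : between _ _ _ := wedge_sum_bounds R x0 hG 0 4.
have /andP[a3 a4] := inj6_xy R x0 hG d20.
have /andP[c3 c4] := inj6_ax R x0 hG d20.
rewrite (cyc5_inj R x0 hG) in b1 b2; rewrite (inj6_by_eq R x0 hG d20) in d1 d2.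
have pos k Es := inj_count_ge0 R x0 G k Es.
have p1 := pos 6 ((3, 5) :: (0, 3) :: (0, 5) :: g6).
have p2 := pos 6 ((2, 1) :: (0, 3) :: (0, 5) :: g6).
have p3 := pos 6 ((3, 5) :: (0, 2) :: (0, 1) :: g6).
have p4 := pos 6 ((2, 1) :: (0, 2) :: (0, 1) :: g6).
have p5 := pos 6 ((3, 5) :: (0, 2) :: (0, 3) :: g6).
have p6 := pos 6 ((2, 1) :: (0, 2) :: (0, 3) :: g6).
have p7 := pos 6 ((3, 5) :: (0, 1) :: (0, 5) :: g6).
have p8 := pos 6 ((2, 1) :: (0, 1) :: (0, 5) :: g6).
have p9 := pos 5 ((1, 3) :: g5); have p10 := pos 5 ((0, 3) :: g5).
have q1 : 0 <= D * cyc R 3 G by rewrite mulr_ge0 ?cyc_ge0.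
have q2 : 0 <= D ^+ 2 * T by rewrite mulr_ge0 ?cyc_ge0 ?sqr_ge0.
clear pos; rewrite ler_norml; apply/andP; split; lra.
Qed.

Definition X5 : R := I5 ((1, 0) :: (2, 4) :: g5).

Lemma L_est : `|L - (N * D - 2 * D ^+ 2) * T| <= 14 * D * T + X5.
Proof.
have /andP[a1 a2] := inj5_edge R x0 hG.
have /andP[b1 b2] := inj5_path_a R x0 hG.
have /andP[c1 c2] := inj5_path_b R x0 hG.
have p1 : 0 <= X5 by exact: inj_count_ge0.
have q1 : 0 <= D * T by rewrite mulr_ge0 ?cyc_ge0.
by rewrite (L_inj R x0 G) -/X5 ler_norml; apply/andP; split; lra.
Qed.

Lemma P_est : `|P - (N * D * (D - 1) ^+ 3 - D ^+ 2 * T - cyc R 4 G)|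
   <= 7 * D * T + cyc R 3 G + X5.
Proof.
have /andP[a1 a2] := inj5_path R x0 hG.
have /andP[b1 b2] := inj5_xy R x0 hG.
have p1 : 0 <= X5 by exact: inj_count_ge0.
have p2 := cyc_ge0 R G 3.
have q1 : 0 <= D * T by rewrite mulr_ge0 ?cyc_ge0.
by rewrite (P_inj R x0) (cyc4_inj R x0 hG) -/X5 ler_norml; apply/andP; split; lra.
Qed.

End TriangleChange.

(** * The approximate Stein identity *)

Section SteinIdentity.
Variables (R : realType) (n d : nat).
Notation V := 'I_n.
Notation Reg := (reg_graphs n d).
Notation Ex := (@Gnd_expect R n d).
Notation D := d%:R.
Notation N := n%:R.

Variable (C : R).
Hypotheses (Reg_gt0 : (0 < #|Reg|)%N) (d20 : (20 <= d)%N)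
  (dn : (4 * (d + 1) + 80 <= n)%N) (C1 : 1 <= C) (dC : D ^+ 2 <= C * N).

Let D20_ : 20 <= D :> R. Proof. by rewrite ler_nat. Qed.
Let DN_ : 4 * (D + 1) + 80 <= N :> R.
Proof. by have := dn; rewrite -(ler_nat R) natrD natrM natrD. Qed.
Let n_gt0 : (0 < n)%N. Proof. by apply: leq_trans dn; rewrite addn_gt0 orbT. Qed.
Let x0 : V := Ordinal n_gt0.
Let d_gt0 : (0 < d)%N. Proof. exact: leq_trans d20. Qed.

Definition scale : R := Num.sqrt (D ^+ 3 / 6).
(* The value of [T / 6] at which [(nd - 2d^2) T = nd (d-1)^3 - d^2 T - d^5]. *)
Definition center : R := (N * D * (D - 1) ^+ 3 - D ^+ 5) / (6 * (N * D - D ^+ 2)).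
Definition Wst (G : graph n) : R := (cyc R 2 G / 6 - center) / scale.

Lemma Ex_inj5 Es : good_pattern 5 Es -> (size Es = 5)%N ->
  Ex (fun G => inj_count R x0 G 5 Es) <= 32 * D ^+ 5.
Proof.
move=> gE sE; apply: le_trans (inj_count_le R d_gt0 dn x0 Reg_gt0 gE _) _; first by rewrite sE.
have N0 : 0 < N :> R by have := DN_; have := D20_; lra.
rewrite sE le_eqVlt; apply/orP; left; apply/eqP.
by field; rewrite lt0r_neq0.
Qed.

(** Six edges on five vertices: the surplus edge brings a factor [2 d / n], and [d^2 <= C n] turns
    [d^6 / n] into [C d^4]. *)
Lemma Ex_X5 : Ex (fun G => X5 R x0 G) <= 64 * C * D ^+ 4.
Proof.
apply: le_trans (inj_count_le R d_gt0 dn x0 Reg_gt0 (Es := [:: (1, 0), (2, 4) & g5]) _ _) _ => //.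
have N0 : 0 < N :> R by have := DN_; have := D20_; lra.
rewrite [size _]/=.
have -> : N ^+ 5 * (2 * D / N) ^+ 6 = 64 * D ^+ 4 * (D ^+ 2 / N) :> R.
  by field; rewrite lt0r_neq0.
rewrite -[64 * C * _]mulrAC; apply: ler_wpM2l; first by rewrite mulr_ge0 ?exprn_ge0.
by rewrite ler_pdivrMr.
Qed.

Lemma Ex_inj6 Es : good_pattern 6 Es -> (size Es = 7)%N ->
  Ex (fun G => inj_count R x0 G 6 Es) <= 128 * C * D ^+ 5.
Proof.
move=> gE sE; apply: le_trans (inj_count_le R d_gt0 dn x0 Reg_gt0 gE _) _; first by rewrite sE.
have N0 : 0 < N :> R by have := DN_; have := D20_; lra.
rewrite sE.
have -> : N ^+ 6 * (2 * D / N) ^+ 7 = 128 * D ^+ 5 * (D ^+ 2 / N) :> R.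
  by field; rewrite lt0r_neq0.
rewrite -[128 * C * _]mulrAC; apply: ler_wpM2l; first by rewrite mulr_ge0 ?exprn_ge0.
by rewrite ler_pdivrMr.
Qed.

(** In units of [d^5]: the eight chord patterns give [8 * 128 C], the two five-vertex patterns
    [2 * 32], the cycle terms [9 * 2] and [24 * 2]; and [1024 + 64 + 18 + 48 = 1154]. *)
Lemma Ex_gain_err : Ex (fun G => gain_err R d x0 G) <= (1154 * C) * C * N * D ^+ 3.
Proof.
rewrite /gain_err /chord6 !ExD !ExZ.
have a1 := @Ex_inj5 [:: (1, 3) & g5] isT erefl.
have a2 := @Ex_inj5 [:: (0, 3) & g5] isT erefl.
have b1 := @Ex_inj6 [:: (3, 5), (0, 3), (0, 5) & g6] isT erefl.
have b2 := @Ex_inj6 [:: (2, 1), (0, 3), (0, 5) & g6] isT erefl.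
have b3 := @Ex_inj6 [:: (3, 5), (0, 2), (0, 1) & g6] isT erefl.
have b4 := @Ex_inj6 [:: (2, 1), (0, 2), (0, 1) & g6] isT erefl.
have b5 := @Ex_inj6 [:: (3, 5), (0, 2), (0, 3) & g6] isT erefl.
have b6 := @Ex_inj6 [:: (2, 1), (0, 2), (0, 3) & g6] isT erefl.
have b7 := @Ex_inj6 [:: (3, 5), (0, 1), (0, 5) & g6] isT erefl.
have b8 := @Ex_inj6 [:: (2, 1), (0, 1), (0, 5) & g6] isT erefl.
have c3 := Ex_cyc_le R Reg_gt0 d20 dn (m := 3) isT.
have c2 := Ex_cyc_le R Reg_gt0 d20 dn (m := 2) isT.
have D0 : 0 <= D :> R by [].
have c3' := ler_wpM2l D0 c3.
have c2' := ler_wpM2l (mulr_ge0 D0 D0) c2.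
have h5 : D ^+ 5 <= C * N * D ^+ 3.
  have -> : D ^+ 5 = D ^+ 2 * D ^+ 3 :> R by rewrite -exprD.
  by rewrite ler_wpM2r ?exprn_ge0.
have h5C : C * D ^+ 5 <= C * (C * N * D ^+ 3) by rewrite ler_wpM2l // (le_trans _ C1).
have hC : 0 <= (C - 1) * D ^+ 5 by rewrite mulr_ge0 ?subr_ge0 ?exprn_ge0.
by lra.
Qed.

Section TestFunction.
Variables (phi g : R -> R) (M : R).
Hypotheses (M0 : 0 <= M)
  (phi_bd : forall x, `|phi x| <= M) (phi_lip : forall x y, `|phi x - phi y| <= M * `|x - y|)
  (g_bd : forall x, `|g x| <= M) (g_lip : forall x y, `|g x - g y| <= M * `|x - y|)
  (taylor : forall x y, `|phi y - phi x - g x * (y - x)| <= M * (y - x) ^+ 2).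

Lemma scale_ge : D <= scale.
Proof.
have D20 := D20_.
have D0 : 0 <= D :> R by [].
rewrite /scale -[X in X <= _](ger0_norm D0) -sqrtr_sqr ler_sqrt; last first.
  by rewrite divr_ge0 ?exprn_ge0.
have -> : D ^+ 3 / 6 = D ^+ 2 * (D / 6) :> R by rewrite exprSr mulrA.
by rewrite ler_peMr ?sqr_ge0 //; lra.
Qed.

Lemma scale_sqr : scale ^+ 2 = D ^+ 3 / 6.
Proof. by rewrite sqr_sqrtr // divr_ge0 ?exprn_ge0. Qed.

Lemma scale_gt0 : 0 < scale.
Proof. by apply: lt_le_trans scale_ge; rewrite ltr0n. Qed.

(** The crude bound [d <= scale] already provides the Lipschitz hypothesis of [cyc_weak], although
    [scale] is of order [d^(3/2)]. *)
Lemma lip_W (f : R -> R) : (forall x y, `|f x - f y| <= M * `|x - y|) ->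
  forall G G' : graph n, `|f (Wst G') - f (Wst G)| <= M / D * `|cyc R 2 G' - cyc R 2 G|.
Proof.
move=> fl G G'; apply: le_trans (fl _ _) _; rewrite -mulrA ler_wpM2l //.
have D0 : 0 < D :> R by rewrite ltr0n.
have -> : Wst G' - Wst G = (cyc R 2 G' - cyc R 2 G) * (6 * scale)^-1.
  by rewrite /Wst; field; rewrite lt0r_neq0 // scale_gt0.
rewrite normrM mulrC ler_wpM2r // ger0_norm.
  by rewrite lef_pV2 ?posrE ?mulr_gt0 ?scale_gt0 //; have := scale_ge; have := scale_gt0; lra.
by rewrite invr_ge0 mulr_ge0 // ltW // scale_gt0.
Qed.

Let L (G : graph n) : R := sumt 5 (fun s => (lc G s)%:R).
Let P (G : graph n) : R := sumt 5 (fun s => (pc G s)%:R).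

(** The common unit of error. Divided by the coefficient of [E (W phi(W))], of order [n d^(5/2)], it
    leaves [1 / sqrt d]. *)
Let U : R := M * C ^+ 2 * N * D ^+ 2.

Let DCN4 : D ^+ 4 <= C * N * D ^+ 2.
Proof.
have -> : D ^+ 4 = D ^+ 2 * D ^+ 2 :> R by rewrite -exprD.
by rewrite ler_wpM2r ?sqr_ge0.
Qed.

Let DCN5 : D ^+ 5 <= C * N * D ^+ 3.
Proof.
have -> : D ^+ 5 = D ^+ 2 * D ^+ 3 :> R by rewrite -exprD.
by rewrite ler_wpM2r ?exprn_ge0.
Qed.

Let C_le : C <= C ^+ 2.
Proof. by rewrite expr2 ler_peMl // (le_trans _ C1). Qed.

Let Y0 : 0 <= N * D ^+ 2 :> R.
Proof. by rewrite mulr_ge0 ?sqr_ge0. Qed.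

(** The constant is [14 * 2 + 64], from [L_est], [Ex_cyc_le] and [Ex_X5]. *)
Lemma err_L : `|Ex (fun G => phi (Wst G) * (L G - (N * D - 2 * D ^+ 2) * cyc R 2 G))|
  <= 92 * U.
Proof.
apply: (@le_trans _ _ (Ex (fun G => M * (14 * D * cyc R 2 G + X5 R x0 G)))).
  apply: Ex_norm_le => G hG; rewrite normrM; apply: ler_pM => //.
  exact: L_est.
have -> : 92 * U = M * (92 * (C ^+ 2 * (N * D ^+ 2))) by rewrite /U; ring.
rewrite ExZ ler_wpM2l // ExD ExZ.
have c2 := Ex_cyc_le R Reg_gt0 d20 dn (m := 2) isT.
have D0 : 0 <= D :> R by [].
have c2' := ler_wpM2l D0 c2.
have x5 := Ex_X5; have h4 := DCN4.
have h4C := ler_wpM2l (le_trans ler01 C1) h4.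
have hY := ler_wpM2r Y0 C_le.
have h0 : 0 <= D ^+ 4 :> R by rewrite exprn_ge0.
by lra.
Qed.

Lemma err_P : `|Ex (fun G => phi (Wst G) *
   (P G - (N * D * (D - 1) ^+ 3 - D ^+ 2 * cyc R 2 G - cyc R 4 G)))| <= 80 * U.
Proof.
apply: (@le_trans _ _ (Ex (fun G => M * (7 * D * cyc R 2 G + cyc R 3 G + X5 R x0 G)))).
  apply: Ex_norm_le => G hG; rewrite normrM; apply: ler_pM => //.
  exact: P_est.
have -> : 80 * U = M * (80 * (C ^+ 2 * (N * D ^+ 2))) by rewrite /U; ring.
rewrite ExZ ler_wpM2l // !ExD ExZ.
have c2 := Ex_cyc_le R Reg_gt0 d20 dn (m := 2) isT.
have c3 := Ex_cyc_le R Reg_gt0 d20 dn (m := 3) isT.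
have D0 : 0 <= D :> R by [].
have c2' := ler_wpM2l D0 c2.
have x5 := Ex_X5; have h4 := DCN4.
have h4C := ler_wpM2l (le_trans ler01 C1) h4.
have hY := ler_wpM2r Y0 C_le.
have h0 : 0 <= D ^+ 4 :> R by rewrite exprn_ge0.
by lra.
Qed.

Let weak (f : R -> R) m (fb : forall x, `|f x| <= M)
  (fl : forall x y, `|f x - f y| <= M * `|x - y|) (m17 : (1 < m < 17)%N) :=
  cyc_weak Reg_gt0 d20 dn C1 dC m17 M0 (fun G _ => fb (Wst G))
    (fun G G' _ _ => lip_W fl G G').

Lemma err_C5 : `|Ex (fun G => phi (Wst G) * (cyc R 4 G - D ^+ 5))| <= 187 * U.
Proof.
have h := weak phi_bd phi_lip (m := 4) isT.
apply: le_trans h _; rewrite /U.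
have -> : C * (4 ^+ 2 + 18 * 4 + 99) * M * D ^+ 4 = 187 * M * (C * D ^+ 4) :> R by ring.
have -> : 187 * (M * C ^+ 2 * N * D ^+ 2) = 187 * M * (C * (C * N * D ^+ 2)) by ring.
apply: ler_wpM2l; first by rewrite mulr_ge0.
by apply: ler_wpM2l; rewrite ?DCN4 // (le_trans _ C1).
Qed.

(** A squared gain is at most [5 d] times [extra + 4]: one factor is bounded by the maximal
    codegree, the other by its average over sites, which is [O(1)] by [Ex_extra_le]. The remaining
    [d / scale^2] is of order [1 / d^2]. *)
Lemma err_taylor : `|Ex (fun G => sumt 5 (fun s => (pc G s)%:R *
    (phi (Wst (sws s G)) - phi (Wst G) - g (Wst G) * (gain R G s / scale))))| <= 540 * U.
Proof.
have D20 := D20_.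
apply: (@le_trans _ _ (Ex (fun G => M * (6 / D ^+ 3) * (5 * D) *
   sumt 5 (fun s => (pc G s)%:R * (extra R G s + 4))))).
  apply: Ex_norm_le => G hG; apply: le_trans (ler_norm_sumt _ _) _.
  rewrite -sumtZ; apply: ler_sumt => s sz.
  case hpc : (pc G s); last by rewrite !mul0r mulr0 normr0.
  rewrite !mul1r.
  have eW : gain R G s / scale = Wst (sws s G) - Wst G.
    have := cyc2_sws R hG sz hpc => h.
    rewrite /Wst (_ : cyc R 2 (sws s G) = cyc R 2 G + 6 * gain R G s); last by rewrite -h; ring.
    by field; rewrite lt0r_neq0 // scale_gt0.
  rewrite eW; apply: le_trans (taylor _ _) _; rewrite -eW expr_div_n scale_sqr.
  have -> : M * (gain R G s ^+ 2 / (D ^+ 3 / 6)) = M * (6 / D ^+ 3) * gain R G s ^+ 2.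
    by field; rewrite lt0r_neq0 //; lra.
  rewrite -[leRHS]mulrA; apply: ler_wpM2l.
    by rewrite mulr_ge0 // divr_ge0 ?exprn_ge0.
  have h1 := gain_le R G s; have h2 := extra_le R hG s.
  have h3 := extra_ge0 R G s.
  rewrite -real_normK ?num_real // expr2 ler_pM //; lra.
have hE : Ex (fun G => sumt 5 (fun s => (pc G s)%:R * (extra R G s + 4)))
     <= (10 + 8 * C) * N * D ^+ 4.
  rewrite (eq_Ex (Y := fun G => sumt 5 (fun s => (pc G s)%:R * extra R G s) + P G * 4)).
    rewrite ExD ExZr.
    have e1 := Ex_extra_le Reg_gt0 d20 dn dC (m := 2) isT.
    have e2 : Ex P <= N * D ^+ 4.
      rewrite -[leRHS](Ex_cst _ Reg_gt0); apply: ler_Ex => G hG; exact: P_le.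
    by lra.
  move=> G _; rewrite /P -sumtZr -sumtD; apply: eq_sumt => s _; by rewrite mulrDr.
rewrite ExZ.
have pos : 0 <= M * (6 / D ^+ 3) * (5 * D).
  by rewrite !mulr_ge0 // divr_ge0 ?exprn_ge0.
apply: le_trans (ler_wpM2l pos hE) _.
have -> : M * (6 / D ^+ 3) * (5 * D) * ((10 + 8 * C) * N * D ^+ 4) =
   M * ((300 + 240 * C) * (N * D ^+ 2)).
  by field; rewrite lt0r_neq0 //; lra.
have -> : 540 * U = M * ((540 * C ^+ 2) * (N * D ^+ 2)) by rewrite /U; ring.
rewrite ler_wpM2l // ler_wpM2r //.
have := C_le; have := C1; lra.
Qed.

(** The weak law for cycles of 3, 4 and 6 vertices is where the [d^6] terms cancel. The error is a
    power of [d] larger than the others, which is harmless because the gain enters divided by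
    [scale >= d]. The contributions [1154 + 15 + 162 + 214 + 278] stay below 1900. *)
Lemma err_gain : `|Ex (fun G => g (Wst G) *
   (sumt 5 (fun s => (pc G s)%:R * gain R G s) - N * D ^+ 4))| <= 1900 * (U * D).
Proof.
have D20 := D20_.
have D0 : 0 <= D :> R by [].
have h4 := DCN5.
have CC := C_le.
have Z0 : 0 <= N * D ^+ 3 :> R by rewrite mulr_ge0 ?exprn_ge0.
have E1 : `|Ex (fun G => g (Wst G) * (sumt 5 (fun s => (pc G s)%:R * gain R G s)
   - (P G + D ^+ 2 * cyc R 3 G + cyc R 5 G - 2 * D ^+ 3 * cyc R 2 G)))|
    <= M * ((1154 * C) * C * N * D ^+ 3).
  apply: le_trans (_ : _ <= Ex (fun G => M * gain_err R d x0 G)) _.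
    apply: Ex_norm_le => G hG; rewrite normrM; apply: ler_pM => //.
    exact: gain_sum.
  by rewrite ExZ ler_wpM2l // Ex_gain_err.
have E2 : `|Ex (fun G => g (Wst G) * (P G - N * D ^+ 4))| <= M * ((11 + 4 * C) * N * D ^+ 3).
  apply: (@le_trans _ _ (Ex (fun G => M * (11 * N * D ^+ 3
      + (D ^+ 2 * cyc R 2 G + cyc R 4 G))))).
    apply: Ex_norm_le => G hG; rewrite normrM; apply: ler_pM => //.
    rewrite ler0_norm; last by rewrite subr_le0; exact: P_le.
    by have := P_ge R hG (m := 2) isT; rewrite /P; lra.
  rewrite ExZ ler_wpM2l // ExD Ex_cst // ExD ExZ.
  have c2 := ler_wpM2l (mulr_ge0 D0 D0) (Ex_cyc_le R Reg_gt0 d20 dn (m := 2) isT).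
  have c4 := Ex_cyc_le R Reg_gt0 d20 dn (m := 4) isT.
  by lra.
have E3 := weak g_bd g_lip (m := 3) isT.
have E4 := weak g_bd g_lip (m := 5) isT.
have E5 := weak g_bd g_lip (m := 2) isT.
have -> : Ex (fun G => g (Wst G) * (sumt 5 (fun s => (pc G s)%:R * gain R G s) - N * D ^+ 4)) =
  Ex (fun G => g (Wst G) * (sumt 5 (fun s => (pc G s)%:R * gain R G s)
   - (P G + D ^+ 2 * cyc R 3 G + cyc R 5 G - 2 * D ^+ 3 * cyc R 2 G))) +
  Ex (fun G => g (Wst G) * (P G - N * D ^+ 4)) +
  D ^+ 2 * Ex (fun G => g (Wst G) * (cyc R 3 G - D ^+ 4)) +
  Ex (fun G => g (Wst G) * (cyc R 5 G - D ^+ 6)) -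
  2 * D ^+ 3 * Ex (fun G => g (Wst G) * (cyc R 2 G - D ^+ 3)).
  rewrite -!ExZ -!ExD -ExB; apply: eq_Ex => G _.
  ring.
set e1 := Ex _ in E1 *; set e2 := Ex _ in E2 *; set e3 := Ex _ in E3 *.
set e4 := Ex _ in E4 *; set e5 := Ex _ in E5 *.
have F3 : `|D ^+ 2 * e3| <= 162 * (M * C * D ^+ 5).
  rewrite normrM ger0_norm ?sqr_ge0 //.
  by apply: le_trans (ler_wpM2l (sqr_ge0 D) E3) _; lra.
have F5 : `|2 * D ^+ 3 * e5| <= 278 * (M * C * D ^+ 5).
  have h : 0 <= 2 * D ^+ 3 :> R by rewrite mulr_ge0 ?exprn_ge0.
  rewrite normrM ger0_norm //.
  by apply: le_trans (ler_wpM2l h E5) _; lra.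
have F4 : `|e4| <= 214 * (M * C * D ^+ 5) by apply: le_trans E4 _; lra.
have MC : 0 <= M * C by rewrite mulr_ge0 // (le_trans _ C1).
have h5 := ler_wpM2l MC h4.
have h6 : M * ((11 + 4 * C) * N * D ^+ 3) <= 15 * (M * C ^+ 2 * N * D ^+ 3).
  have -> : 15 * (M * C ^+ 2 * N * D ^+ 3) = M * ((15 * C ^+ 2) * (N * D ^+ 3)) by ring.
  have -> : (11 + 4 * C) * N * D ^+ 3 = (11 + 4 * C) * (N * D ^+ 3) by rewrite mulrA.
  apply: ler_wpM2l => //; apply: ler_wpM2r => //.
  by have := C1; lra.
apply: le_trans (ler_normB _ _) _.
apply: le_trans (lerD (ler_normD _ _) F5) _.
apply: le_trans (lerD (lerD (ler_normD _ _) F4) (lexx _)) _.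
apply: le_trans (lerD (lerD (lerD (ler_normD _ _) F3) (lexx _)) (lexx _)) _.
apply: le_trans (lerD (lerD (lerD (lerD E1 E2) (lexx _)) (lexx _)) (lexx _)) _.
have U0 : 0 <= M * C ^+ 2 * N * D ^+ 3 by rewrite !mulr_ge0 ?exprn_ge0 // (le_trans _ C1).
rewrite /U; lra.
Qed.

End TestFunction.
End SteinIdentity.

Definition stein_test (R : realType) (phi g : R -> R) (M : R) :=
  [/\ forall x, `|phi x| <= M, forall x y, `|phi x - phi y| <= M * `|x - y|,
      forall x, `|g x| <= M, forall x y, `|g x - g y| <= M * `|x - y| &
      forall x y, `|phi y - phi x - g x * (y - x)| <= M * (y - x) ^+ 2].

Section SteinBound.
Variables (R : realType) (n d : nat).
Notation Reg := (reg_graphs n d).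
Notation Ex := (@Gnd_expect R n d).
Notation D := d%:R.
Notation N := n%:R.
Notation W := (Wst R d).
Notation scale := (scale R d).

Variable (C : R).
Hypotheses (Reg_gt0 : (0 < #|Reg|)%N) (d20 : (20 <= d)%N)
  (dn : (4 * (d + 1) + 80 <= n)%N) (C1 : 1 <= C) (dC : D ^+ 2 <= C * N).

Lemma stein_bound (K : R) (phi g : R -> R) (M : R) : 2801 <= K -> stein_test phi g M ->
  `|Ex (fun G => W G * phi (W G)) - Ex (fun G => g (W G))|
    <= K * C ^+ 2 * M / Num.sqrt D.
Proof.
move=> hK [phi_bd phi_lip g_bd g_lip taylor].
have M0 : 0 <= M := le_trans (normr_ge0 _) (phi_bd 0).
have D20 : 20 <= D :> R by rewrite ler_nat.
have DN : 4 * (D + 1) + 80 <= N :> R.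
  by have := dn; rewrite -(ler_nat R) natrD natrM natrD.
have N0 : 0 < N :> R by lra.
have D0 : 0 < D :> R by lra.
have s0 : 0 < scale := scale_gt0 R d20.
have s2 : scale ^+ 2 = D ^+ 3 / 6 := scale_sqr R d.
have sD : D <= scale := scale_ge R d20.
pose B : R := 6 * (N * D - D ^+ 2) * scale.
have ND2 : 0 < N * D - D ^+ 2 :> R.
  have -> : N * D - D ^+ 2 = (N - D) * D :> R by ring.
  by rewrite mulr_gt0 // subr_gt0; lra.
have B3 : 3 * N * D * scale <= B.
  rewrite /B; apply: ler_wpM2r; first exact: ltW.
  have : 0 <= (N - 2 * D) * D :> R by rewrite mulr_ge0 //; lra.
  by lra.
have B0 : 0 < B by rewrite /B mulr_gt0 // mulr_gt0.
have rD0 : 0 < Num.sqrt D :> R by rewrite sqrtr_gt0.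
have rD2 : Num.sqrt D ^+ 2 = D :> R by rewrite sqr_sqrtr // ltW.
have r1 : 1 <= Num.sqrt D :> R by rewrite -[X in X <= _]sqrtr1 ler_sqrt ?ltW //; lra.
set r := Num.sqrt D in rD0 rD2 r1 *.
(* The left side is [d^(3/2)], that is [sqrt 6] times [scale]; this is what turns an error [n d^2]
   into [n d * scale / sqrt d]. *)
have sr : D * r <= 3 * scale.
  rewrite -ler_sqr ?nnegrE ?mulr_ge0 ?(ltW s0) ?(ltW rD0) ?(ltW D0) //.
  rewrite !exprMn s2 rD2.
  have : 0 <= D ^+ 3 :> R by rewrite exprn_ge0 // ltW.
  by rewrite exprS; lra.
set h := fun G : graph n => phi (W G).
set h' := fun G : graph n => g (W G).
pose L (G : graph n) : R := sumt 5 (fun s => (lc G s)%:R).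
pose P (G : graph n) : R := sumt 5 (fun s => (pc G s)%:R).
pose U : R := M * C ^+ 2 * N * D ^+ 2.
have eL := err_L Reg_gt0 d20 dn C1 dC M0 phi_bd.
have eP := err_P Reg_gt0 d20 dn C1 dC M0 phi_bd.
have eC := err_C5 Reg_gt0 d20 dn C1 dC M0 phi_bd phi_lip.
have eT := err_taylor Reg_gt0 d20 dn C1 dC M0 taylor.
have eG := err_gain Reg_gt0 d20 dn C1 dC M0 g_bd g_lip.
set xL := Ex _ in eL; set xP := Ex _ in eP; set xC := Ex _ in eC.
set xT := Ex _ in eT; set xG := Ex _ in eG.
pose A : R := Ex (fun G => h G * ((N * D - D ^+ 2) * cyc R 2 G
  - N * D * (D - 1) ^+ 3 + D ^+ 5)).
(* [switch_id] says that [E (h L)] is the sum of [h] after switching over the path sites; expanding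
   [h] to first order there leaves [E (h P)], the gain term and the Taylor error [xT]. *)
have key : A = - xL + xP - xC + xT + xG / scale + N * D ^+ 4 / scale * Ex h'.
  have id := switch_id d h (m := 2) isT.
  have E1 : xT = Ex (fun G => h G * L G) - Ex (fun G => h G * P G)
      - Ex (fun G => h' G * sumt 5 (fun s => (pc G s)%:R * gain R G s)) / scale.
    rewrite id -ExZr -!ExB; apply: eq_Ex => G _.
    rewrite /P -!sumtZ -!sumtZr -!sumtB; apply: eq_sumt => s _.
    rewrite /h /h'; ring.
  have E2 : xG = Ex (fun G => h' G * sumt 5 (fun s => (pc G s)%:R * gain R G s))
      - N * D ^+ 4 * Ex h'.
    by rewrite -ExZ -ExB; apply: eq_Ex => G _; rewrite /h'; ring.
  have E3 : A + xL - xP + xC = Ex (fun G => h G * L G) - Ex (fun G => h G * P G).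
    rewrite /A /xL /xP /xC -!(ExD, ExB); apply: eq_Ex => G _.
    rewrite /L /P /h; ring.
  have -> : A = (A + xL - xP + xC) - xL + xP - xC by ring.
  by rewrite E3 E1 E2; ring.
(* [center] is the zero of the linear expression in [cyc R 2 G] inside [A], so that expression is
   [B] times [W]. *)
have AW : A = B * Ex (fun G => W G * phi (W G)).
  rewrite -ExZ; apply: eq_Ex => G _; rewrite /h /Wst /B /center.
  by field; rewrite !lt0r_neq0.
have cG : N * D ^+ 4 / scale = 6 * N * D * scale.
  have -> : N * D ^+ 4 = 6 * N * D * (D ^+ 3 / 6) :> R by field.
  by rewrite -s2; field; rewrite lt0r_neq0.
have Eg : `|Ex h'| <= M.
  by rewrite -[leRHS](Ex_cst _ Reg_gt0); apply: Ex_norm_le => G _; exact: g_bd.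
set diff := _ - _.
have C0 : 0 <= C := le_trans ler01 C1.
have U0 : 0 <= U by rewrite /U !mulr_ge0 ?sqr_ge0.
(* Here [2799 = 92 + 80 + 187 + 540 + 1900]. The second term is the mismatch between [n d] in the
   gain term and [n d - d^2] in [B]. *)
have step : B * `|diff| <= 2799 * U + 6 * D ^+ 2 * scale * M.
  rewrite -[in B * _](ger0_norm (ltW B0)) -normrM.
  have -> : B * diff = (- xL + xP - xC + xT + xG / scale) + 6 * D ^+ 2 * scale * Ex h'.
    rewrite /diff mulrBr -AW key cG /B /h'; ring.
  apply: le_trans (ler_normD _ _) (lerD _ _); last first.
    have h0 : 0 <= 6 * D ^+ 2 * scale by rewrite !mulr_ge0 ?sqr_ge0 // ltW.
    by rewrite normrM ger0_norm // ler_wpM2l.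
  have eG' : `|xG / scale| <= 1900 * U.
    rewrite normrM [`|scale^-1|]ger0_norm ?invr_ge0 ?(ltW s0) //.
    rewrite ler_pdivrMr //; apply: le_trans eG _.
    have := ler_wpM2l U0 sD; rewrite -/U; lra.
  rewrite -/U in eL eP eC eT.
  apply: le_trans (ler_normD _ _) _; apply: le_trans (lerD (ler_normD _ _) eG') _.
  apply: le_trans (lerD (lerD (ler_normB _ _) eT) (lexx _)) _.
  apply: le_trans (lerD (lerD (lerD (ler_normD _ _) eC) (lexx _)) (lexx _)) _.
  rewrite normrN.
  apply: le_trans (lerD (lerD (lerD (lerD eL eP) (lexx _)) (lexx _)) (lexx _)) _.
  by lra.
rewrite -(@ler_pM2l _ B) //; apply: le_trans step _.
have CC0 : 0 <= C ^+ 2 by rewrite sqr_ge0.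
have K_ge0 : 0 <= K := le_trans (ler0n _ _) hK.
have K0 : 0 <= K * C ^+ 2 * M / r.
  apply: divr_ge0; last exact: ltW.
  by apply: mulr_ge0 => //; apply: mulr_ge0.
apply: (@le_trans _ _ (3 * N * D * scale * (K * C ^+ 2 * M / r))); last first.
  exact: ler_wpM2r K0 _ _ B3.
have h1 : U <= M * C ^+ 2 * N * D * (3 * scale) / r.
  rewrite /U ler_pdivlMr //.
  have -> : M * C ^+ 2 * N * D ^+ 2 * r = M * C ^+ 2 * N * D * (D * r) by ring.
  by apply: ler_wpM2l => //; rewrite !mulr_ge0 // ltW.
have h2 : 6 * D ^+ 2 * scale * M <= 6 * M * C ^+ 2 * N * D * scale / r.
  rewrite ler_pdivlMr //.
  have -> : 6 * D ^+ 2 * scale * M * r = (6 * M * scale) * (D ^+ 2 * r) by ring.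
  have -> : 6 * M * C ^+ 2 * N * D * scale = (6 * M * scale) * (C * C * N * D) by ring.
  apply: ler_wpM2l; first by rewrite !mulr_ge0 // ltW.
  have rD : r <= D.
    by rewrite -[X in _ <= X]rD2 expr2 ler_peMr // ltW.
  apply: le_trans (ler_pM _ _ dC rD) _; rewrite ?sqr_ge0 ?(ltW rD0) //.
  have -> : C * C * N * D = C * (C * N * D) by ring.
  by rewrite ler_peMl // !mulr_ge0 // (le_trans _ C1).
pose Q : R := M * C ^+ 2 * N * D * scale / r.
have Q0 : 0 <= Q by rewrite divr_ge0 ?mulr_ge0 // ltW.
have e1 : M * C ^+ 2 * N * D * (3 * scale) / r = 3 * Q by rewrite /Q; ring.
have e2 : 6 * M * C ^+ 2 * N * D * scale / r = 6 * Q by rewrite /Q; ring.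
(* The threshold for [K] comes from [2799 * 3 + 6 = 3 * 2801]. *)
have -> : 3 * N * D * scale * (K * C ^+ 2 * M / r) = 3 * (K * Q) by rewrite /Q; ring.
have hKQ := ler_wpM2r Q0 hK.
rewrite e1 in h1; rewrite e2 in h2; move: h1 h2 hKQ.
move: (K * Q) (6 * D ^+ 2 * scale * M) (U) => KQ lower err; clear.
lra.
Qed.

End SteinBound.

(** * Stein's equation for the Gaussian law *)

Section Calculus.
Variable R : realType.
Implicit Types (f df : R -> R) (M x y : R).

Lemma mean_value f df x y : (forall z : R, is_derive z 1 f (df z)) ->
  exists2 c, `|c - x| <= `|y - x| & f y - f x = df c * (y - x).
Proof.
move=> hf.
have cf : continuous f.
  move=> z; apply: differentiable_continuous; apply/derivable1_diffP.
  exact: (@ex_derive _ _ _ _ _ _ _ (hf z)).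
have cw a b : {within `[a, b], continuous f} by apply: continuous_subspaceT.
have [xy|/ltW yx] := leP x y.
  have [c] := MVT_segment xy (fun z _ => hf z) (cw x y).
  rewrite in_itv /= => /andP[xc cy] e; exists c => //.
  by rewrite !ger0_norm ?subr_ge0 // lerB.
have [c] := MVT_segment yx (fun z _ => hf z) (cw y x).
rewrite in_itv /= => /andP[yc cx] e; exists c.
  by rewrite !ler0_norm ?subr_le0 // lerN2 lerB.
by rewrite -[LHS]opprB e -mulrN opprB.
Qed.

Lemma derive_lipschitz f df M : (forall z : R, is_derive z 1 f (df z)) ->
  (forall z, `|df z| <= M) -> forall x y, `|f x - f y| <= M * `|x - y|.
Proof.
move=> hf hM x y; have [c _ ->] := mean_value y x hf.
by rewrite normrM ler_wpM2r.
Qed.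

Lemma derive_taylor f df M : (forall z : R, is_derive z 1 f (df z)) ->
  (forall x y, `|df x - df y| <= M * `|x - y|) ->
  forall x y, `|f y - f x - df x * (y - x)| <= M * (y - x) ^+ 2.
Proof.
move=> hf hM x y; have [c hc ->] := mean_value x y hf.
rewrite -mulrBl normrM -real_normK ?num_real // expr2 mulrA ler_wpM2r //.
apply: le_trans (hM _ _) _; rewrite ler_wpM2l //.
have := hM 0 1; rewrite sub0r normrN1 mulr1; exact: le_trans.
Qed.

Lemma stein_test_atan : stein_test atan (fun x : R => (1 + x ^+ 2)^-1) 2.
Proof.
have pos (x : R) : 1 <= 1 + x ^+ 2 by rewrite lerDl sqr_ge0.
have hd (x : R) : is_derive x 1 (@atan R) (1 + x ^+ 2)^-1 by exact: is_derive1_atan.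
have gb (x : R) : `|(1 + x ^+ 2)^-1| <= 1.
  rewrite ger0_norm ?invr_ge0 ?(le_trans ler01 (pos x)) //.
  by rewrite invf_le1 // (lt_le_trans ltr01 (pos x)).
have gl (x y : R) : `|(1 + x ^+ 2)^-1 - (1 + y ^+ 2)^-1| <= 2 * `|x - y|.
  have px := pos x; have py := pos y.
  have -> : (1 + x ^+ 2)^-1 - (1 + y ^+ 2)^-1 =
      (y + x) * (y - x) / ((1 + x ^+ 2) * (1 + y ^+ 2)).
    by field; rewrite !lt0r_neq0 //; lra.
  rewrite !normrM [`|y - x|]distrC mulrAC ler_wpM2r //.
  rewrite normfV ler_pdivrMr ?normr_gt0 ?lt0r_neq0 ?mulr_gt0 //; try lra.
  rewrite [`|_ * _|]ger0_norm ?mulr_ge0 //; try lra.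
  have ax : `|x| <= 1 + x ^+ 2.
    have : 0 <= (`|x| - 1) ^+ 2 by rewrite sqr_ge0.
    have : 0 <= `|x| by []; rewrite -[x ^+ 2]real_normK ?num_real //.
    by set t := `|x|; nra.
  have ay : `|y| <= 1 + y ^+ 2.
    have : 0 <= (`|y| - 1) ^+ 2 by rewrite sqr_ge0.
    have : 0 <= `|y| by []; rewrite -[y ^+ 2]real_normK ?num_real //.
    by set t := `|y|; nra.
  apply: le_trans (ler_normD _ _) _.
  set u := 1 + x ^+ 2 in px ax *; set v := 1 + y ^+ 2 in py ay *.
  have : 0 <= (u - 1) * v by rewrite mulr_ge0 //; lra.
  have : 0 <= (v - 1) * u by rewrite mulr_ge0 //; lra.
  by lra.
split.
- move=> x; rewrite ler_norml.
  have := atan_gtNpi2 x; have := atan_ltpi2 x.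
  have := pihalf_02 R => /andP[_ h].
  by move=> h1 h2; apply/andP; split; apply/ltW; lra.
- move=> x y; apply: le_trans (derive_lipschitz hd gb x y) _.
  by rewrite mul1r ler_peMl // ler1n.
- by move=> x; apply: le_trans (gb x) _; rewrite ler1n.
- exact: gl.
- exact: derive_taylor hd gl.
Qed.

(** The product is even, and from 1 on [atan] is at least [atan 1 = pi / 4 >= 1 / 2]. *)
Lemma atan_mul_ge (x K : R) : 1 <= K -> K <= `|x| -> K / 2 <= x * atan x.
Proof.
have hd (z : R) : is_derive z 1 (@atan R) (1 + z ^+ 2)^-1 by exact: is_derive1_atan.
have base (z : R) : 1 <= z -> 1 / 2 <= atan z.
  move=> z1; have [c _ e] := mean_value 1 z hd.
  have : 0 <= atan z - atan 1.
    rewrite e mulr_ge0 ?subr_ge0 // invr_ge0.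
    by rewrite addr_ge0 // sqr_ge0.
  rewrite atan1; have := pi_ge2 R.
  by move=> h1 h2; lra.
move=> K1 Kx.
have -> : x * atan x = `|x| * atan `|x|.
  by case: ger0P => // _; rewrite atanN mulrNN.
have := base _ (le_trans K1 Kx); move: Kx; set t := `|x|; set a := atan t.
move=> Kt ha; have : 0 <= (t - K) * a by rewrite mulr_ge0 //; lra.
have : 0 <= K * (a - 1 / 2) by rewrite mulr_ge0 //; lra.
by lra.
Qed.

Lemma atan_mul_ge0 (x : R) : 0 <= x * atan x.
Proof.
have hd (z : R) : is_derive z 1 (@atan R) (1 + z ^+ 2)^-1 by exact: is_derive1_atan.
have [c _] := mean_value 0 x hd; rewrite atan0 !subr0 => ->.
rewrite mulrCA -expr2 mulr_ge0 ?sqr_ge0 //.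
by rewrite invr_ge0 addr_ge0 // sqr_ge0.
Qed.

End Calculus.

Section SteinSolution.
Variable R : realType.
Notation mu := (@lebesgue_measure R).
Notation p := (@normal_pdf R 0 1).

Lemma pdfE x : p x = normal_peak 1 * expR (- x ^+ 2 / 2).
Proof. by rewrite normal_pdfE // /normal_fun subr0 expr1n. Qed.

Lemma integrable_mul_pdf (q : R -> R) (Q : R) : continuous q ->
  (forall x, `|q x| <= Q) -> mu.-integrable setT (EFin \o (fun x => q x * p x)).
Proof.
move=> cq bq; have mq : measurable_fun setT q.
  exact: measurable_realfun.continuous_measurable_fun.
apply: (@le_integrable _ _ _ mu setT measurableT _ (fun x => (Q * p x)%:E)).
- by apply/measurable_EFinP; apply: measurable_funM => //; exact: measurable_normal_pdf.
- move=> x _ /=; rewrite lee_fin !normrM ler_wpM2r //.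
  by rewrite [leRHS]ger0_norm // (le_trans _ (bq x)).
- under eq_fun do rewrite EFinM.
  by apply: integrableZl => //; exact: integrable_normal_pdf.
Qed.

Definition gauss_mean (q : R -> R) : R := \int[mu]_x (q x * p x).

Lemma gauss_meanB (q1 q2 : R -> R) Q1 Q2 : continuous q1 -> continuous q2 ->
  (forall x, `|q1 x| <= Q1) -> (forall x, `|q2 x| <= Q2) ->
  gauss_mean (fun x => q1 x - q2 x) = gauss_mean q1 - gauss_mean q2.
Proof.
move=> c1 c2 b1 b2; rewrite /gauss_mean -RintegralB //.
- by apply: eq_Rintegral => x _; rewrite mulrBl.
- exact: (integrable_mul_pdf c1 b1).
- exact: (integrable_mul_pdf c2 b2).
Qed.

Lemma gauss_meanZ (q : R -> R) Q c : continuous q -> (forall x, `|q x| <= Q) ->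
  gauss_mean (fun x => c * q x) = c * gauss_mean q.
Proof.
move=> c1 b1; rewrite /gauss_mean -RintegralZl //; last exact: (integrable_mul_pdf c1 b1).
by apply: eq_Rintegral => x _; rewrite mulrA.
Qed.

End SteinSolution.

Section SteinEquation.
Variable R : realType.
Notation mu := (@lebesgue_measure R).
Notation p := (@normal_pdf R 0 1).
Notation gauss_mean := (@gauss_mean R).

Lemma lipschitz_cont (q : R -> R) (L : R) :
  (forall x y, `|q x - q y| <= L * `|x - y|) -> continuous q.
Proof.
move=> qL x; have L0 : 0 <= L.
  by have := qL 0 1; rewrite sub0r normrN1 mulr1; exact: le_trans.
apply/cvgrPdist_le => e e0; near=> y.
apply: le_trans (qL _ _) _.
have h : `|x - y| <= e / (L + 1).
  near: y; apply: cvgr_dist_le; first exact: cvg_id.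
  by rewrite divr_gt0 // ltr_wpDl.
apply: le_trans (ler_wpM2l L0 h) _.
rewrite mulrCA ler_piMr ?(ltW e0) // ler_pdivrMr ?mul1r ?lerDl //.
by rewrite ltr_wpDl.
Unshelve. all: by end_near. Qed.

Variables (q : R -> R) (L Q B : R).
Hypotheses (qL : forall x y, `|q x - q y| <= L * `|x - y|)
  (qQ : forall x, `|q x| <= Q) (B0 : 0 < B) (qB : forall x, B <= `|x| -> q x = 0)
  (q_mean : gauss_mean q = 0).

Let cq : continuous q := lipschitz_cont qL.
Let iq := integrable_mul_pdf cq qQ.
Let Q0 : 0 <= Q := le_trans (normr_ge0 _) (qQ 0).

(* Stein's solution is [phi x = e^(x^2/2) \int_(-oo)^x q(t) e^(-t^2/2) dt]; it has compact
   support because [q] has mean zero. *)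
Let F x : R := \int[mu]_(t in `]-oo, x]) (q t * p t).

Let F_derive (x : R) : is_derive x 1 F (q x * p x).
Proof.
have xu : x < x + 1 by rewrite ltrDl.
have h := @continuous_FTC1 R (fun t => q t * p t) -oo%O x (x + 1) xu.
have [|||h1 h2] := h _ _ _.
- exact: integrableS iq.
- by rewrite ltNyr.
- by apply: cvgM; [exact: cq|exact: continuous_normal_pdf].
by apply: (DeriveDef h1); rewrite -derive1E.
Qed.

Let F_left x : x <= - B -> F x = 0.
Proof.
move=> xB.
have aux (t : R) : t <= x -> q t * p t = 0.
  move=> tx; have tB : t <= - B := le_trans tx xB.
  have t0 : t <= 0 by have := B0; lra.
  by rewrite qB ?mul0r // ler0_norm // lerNr.
rewrite /F (eq_Rintegral _ (g := fun=> 0)) ?Rintegral_cst ?mul0r //.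
by move=> t; rewrite inE /= in_itv /=; exact: aux.
Qed.

Let F_right x : B <= x -> F x = 0.
Proof.
move=> xB.
have aux (t : R) : x < t -> q t * p t = 0.
  move=> xt; have Bt : B <= t := le_trans xB (ltW xt).
  by rewrite qB ?mul0r // (le_trans Bt) // ler_norm.
rewrite -[RHS]q_mean /gauss_mean /F Rintegral_mkcond.
apply: eq_Rintegral => t _; rewrite patchE; case: ifPn => //.
by rewrite notin_setE /= in_itv /= => /negP; rewrite -ltNge => /aux ->.
Qed.

Let u (x : R) : R := (normal_peak 1)^-1 * expR (x ^+ 2 / 2).

Let u_gt0 x : 0 < u x.
Proof. by rewrite mulr_gt0 ?expR_gt0 // invr_gt0 normal_peak_gt0. Qed.

Let u_pdf x : p x * u x = 1.
Proof.
rewrite pdfE /u mulrACA mulfV ?mul1r; last by rewrite lt0r_neq0 // normal_peak_gt0.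
by rewrite -expRD mulNr addNr expR0.
Qed.

Let u_derive (x : R) : is_derive x 1 u (x * u x).
Proof.
have h0 := is_deriveX 2 (is_derive_id x (1 : R)).
have h1 := is_deriveZ (2^-1 : R) h0.
have h2 := is_derive1_comp (is_derive_expR _) h1.
have h3 := is_deriveZ ((normal_peak 1)^-1 : R) h2.
have -> : x * u x = (normal_peak 1)^-1 *: (expR ((2^-1 \*: id ^+ 2) x) *
    (2^-1 *: ((2 * x ^+ 1) *: 1))).
  have e (c y : R) : c *: y = c * y by [].
  rewrite !e /= !e exprfctE expr1 /u [2^-1 * x ^+ 2]mulrC; field.
  by rewrite lt0r_neq0 // normal_peak_gt0.
suff -> : u = (normal_peak 1)^-1 \*: (expR \o (2^-1 \*: (id ^+ 2))) by [].
by apply/funext => z; rewrite /u /= exprfctE mulrC [2^-1 *: _]mulrC mulrC.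
Qed.

Let phi (x : R) : R := F x * u x.
Let g (x : R) : R := q x + x * phi x.

Let phi_derive (x : R) : is_derive x 1 phi (g x).
Proof.
have := is_deriveM (F_derive x) (u_derive x).
have -> // : F x *: (x * u x) + u x *: (q x * p x) = g x.
have e (c y : R) : c *: y = c * y by [].
rewrite !e /g /phi [u x * _]mulrC -[q x * p x * _]mulrA u_pdf mulr1 addrC.
by congr (_ + _); rewrite mulrCA.
Qed.

Let phi_out x : B <= `|x| -> phi x = 0.
Proof.
rewrite /phi; case: ger0P => x0 Bx; first by rewrite (F_right Bx) mul0r.
have xB : x <= - B by rewrite lerNr.
by rewrite (F_left xB) mul0r.
Qed.

Let F_le x : `|F x| <= Q.
Proof.
have mA : @measurable _ (measurableTypeR R) `]-oo, x] by exact: measurable_itv.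
have iA : mu.-integrable `]-oo, x] (EFin \o p).
  by apply: integrableS (integrable_normal_pdf 0 1).
have iqA : mu.-integrable `]-oo, x] (EFin \o (fun t => q t * p t)) by exact: integrableS iq.
have h0 : `|F x| <= \int[mu]_(t in `]-oo, x]) `|q t * p t| := le_normr_Rintegral mA iqA.
apply: le_trans h0 _.
apply: (@le_trans _ _ (\int[mu]_(t in `]-oo, x]) (Q * p t))).
  apply: le_Rintegral => //.
  - exact: (integrable_abse iqA).
  - exact: (integrableZl mA Q iA).
  - move=> t _; rewrite normrM ler_pM //.
    by rewrite ger0_norm // normal_pdf_ge0.
rewrite RintegralZl // ler_piMr //.
rewrite -[leRHS]/(fine 1%E); apply: fine_le => //; last first.
  exact: (probability_le1 (normal_prob 0 1) mA).
exact: (fin_num_measure (normal_prob 0 1) _ mA).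
Qed.

Let A : R := u B.

Let u_le x : `|x| <= B -> u x <= A.
Proof.
move=> xB; rewrite /A /u; apply: ler_wpM2l; first by rewrite invr_ge0 normal_peak_ge0.
rewrite ler_expR; apply: ler_wpM2r => //.
by rewrite -[x ^+ 2]real_normK ?num_real // lerXn2r ?nnegrE // ltW.
Qed.

Let A0 : 0 <= A. Proof. exact: ltW (u_gt0 B). Qed.

Let phi_le x : `|phi x| <= Q * A.
Proof.
have [xB|/ltW Bx] := leP `|x| B; last by rewrite phi_out // normr0 mulr_ge0.
rewrite /phi normrM; apply: ler_pM => //.
by rewrite (ger0_norm (ltW (u_gt0 x))); exact: u_le.
Qed.

Let g_out x : B <= `|x| -> g x = 0.
Proof. by move=> Bx; rewrite /g qB // phi_out // mulr0 addr0. Qed.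

Let Mg : R := Q + B * (Q * A).

Let Mg0 : 0 <= Mg.
Proof. by rewrite addr_ge0 // mulr_ge0 ?(ltW B0) // mulr_ge0. Qed.

Let g_le x : `|g x| <= Mg.
Proof.
have [xB|/ltW Bx] := leP `|x| B; last by rewrite g_out // normr0.
apply: le_trans (ler_normD _ _) _; rewrite normrM; apply: lerD; first exact: qQ.
by apply: ler_pM.
Qed.

Let xphi_derive (x : R) : is_derive x 1 (fun y => y * phi y) (phi x + x * g x).
Proof.
have := is_deriveM (is_derive_id x (1 : R)) (phi_derive x).
suff -> : id x *: g x + phi x *: (1 : R) = phi x + x * g x by [].
by rewrite addrC; congr (_ + _); exact: mulr1.
Qed.

Let xphi_le x : `|phi x + x * g x| <= Q * A + B * Mg.
Proof.
have [xB|/ltW Bx] := leP `|x| B; last first.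
  rewrite g_out // phi_out // mulr0 addr0 normr0; apply: addr_ge0; apply: mulr_ge0 => //.
  exact: ltW.
apply: le_trans (ler_normD _ _) _; apply: lerD; first exact: phi_le.
by rewrite normrM ler_pM.
Qed.

(** [phi], [g] and the derivative of [x * phi x] vanish once the absolute value of [x] reaches [B];
    inside, [u] is at most [u B], so all bounds are immediate. The Lipschitz bound for [g] combines
    that of [q] with the bounded derivative of [x * phi x]. *)
Lemma stein_solution : exists phi g : R -> R, exists M : R,
  stein_test phi g M /\ forall x, g x - x * phi x = q x.
Proof.
have L0 : 0 <= L by have := qL 0 1; rewrite sub0r normrN1 mulr1; exact: le_trans.
pose K := L + (Q * A + B * Mg).
have QA0 : 0 <= Q * A by rewrite mulr_ge0.
have K0 : 0 <= K.
  by apply: addr_ge0 => //; apply: addr_ge0 => //; apply: mulr_ge0 => //; exact: ltW.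
have g_lip x y : `|g x - g y| <= K * `|x - y|.
  have -> : g x - g y = (q x - q y) + (x * phi x - y * phi y) by rewrite /g; ring.
  apply: le_trans (ler_normD _ _) _; rewrite /K mulrDl lerD //.
  exact: derive_lipschitz xphi_derive xphi_le x y.
pose M := Q * A + Mg + K.
have [h1 h2 h3] : [/\ Q * A <= M, Mg <= M & K <= M].
  by move: QA0 Mg0 K0; rewrite /M => *; split; lra.
exists phi, g, M; split; last by move=> x; rewrite /g addrK.
split.
- by move=> x; apply: le_trans (phi_le x) h1.
- move=> x y; apply: le_trans (derive_lipschitz phi_derive g_le x y) _.
  exact: ler_wpM2r.
- by move=> x; apply: le_trans (g_le x) h2.
- by move=> x y; apply: le_trans (g_lip x y) _; exact: ler_wpM2r.
- move=> x y; apply: le_trans (derive_taylor phi_derive g_lip x y) _.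
  by rewrite ler_wpM2r ?sqr_ge0.
Qed.

End SteinEquation.

(** * Cutoffs and convergence of distribution functions *)

Section Cutoff.
Variable R : realType.
Notation mu := (@lebesgue_measure R).
Notation p := (@normal_pdf R 0 1).
Notation gauss_mean := (@gauss_mean R).
Notation gauss := (@normal_prob R 0 1).

Definition cutoff (psi : R -> R) := exists L B : R,
  [/\ 0 < B, forall x y, `|psi x - psi y| <= L * `|x - y|,
      forall x, 0 <= psi x <= 1 & forall x, B <= `|x| -> psi x = 0].

Definition trapezoid (a b delta x : R) : R :=
  Num.max 0 (Num.min 1 (1 + ((b - a) / 2 - `|x - (a + b) / 2|) / delta)).

Lemma trapezoid_cutoff a b delta : 0 < delta -> cutoff (trapezoid a b delta).
Proof.
move=> d0; exists delta^-1, (`|(b - a) / 2| + `|(a + b) / 2| + delta).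
have clampE (u v : R) : `|Num.max 0 (Num.min 1 u) - Num.max 0 (Num.min 1 v)| <= `|u - v|.
  wlog uv : u v / v <= u.
    move=> H; have [/H//|/ltW/H] := leP v u.
    by rewrite distrC [`|v - u|]distrC.
  have cl (t : R) : Num.max 0 (Num.min 1 t) = if 1 < t then 1 else if 0 < t then t else 0.
    by rewrite minElt; case: ifP => _; rewrite maxElt ?ltr01.
  rewrite [leRHS]ger0_norm ?subr_ge0 // ler_norml !cl.
  by case: (ltP 1 u); case: (ltP 1 v); case: (ltP 0 u); case: (ltP 0 v) => *;
    apply/andP; split; lra.
split.
- by rewrite ltr_wpDl // addr_ge0.
- move=> x y; apply: le_trans (clampE _ _) _.
  set c := (a + b) / 2; set r := (b - a) / 2.
  have -> : 1 + (r - `|x - c|) / delta - (1 + (r - `|y - c|) / delta) =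
     delta^-1 * (`|y - c| - `|x - c|) by field; rewrite lt0r_neq0.
  rewrite normrM [`|delta^-1|]ger0_norm ?invr_ge0 ?(ltW d0) // ler_pM2l ?invr_gt0 //.
  apply: le_trans (ler_dist_dist _ _) _.
  by rewrite distrC; have -> : x - c - (y - c) = x - y :> R by ring.
- move=> x; rewrite /trapezoid le_max lexx /= ge_max ler01 /=.
  by rewrite ge_min lexx.
- move=> x Bx; rewrite /trapezoid.
  set c := (a + b) / 2 in Bx *; set r := (b - a) / 2 in Bx *.
  have h : r + delta <= `|x - c|.
    have := lerB_dist x c; have := ler_norm r; move: Bx; lra.
  apply/max_idPl; rewrite ge_min; apply/orP; right.
  have -> : 1 + (r - `|x - c|) / delta = (r + delta - `|x - c|) / delta.
    by field; rewrite lt0r_neq0.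
  by rewrite pmulr_lle0 ?invr_gt0 // subr_le0.
Qed.

Lemma trapezoid1 a b delta x : 0 < delta -> a <= x <= b -> trapezoid a b delta x = 1.
Proof.
move=> d0 /andP[ax xb]; rewrite /trapezoid.
have h : `|x - (a + b) / 2| <= (b - a) / 2.
  by rewrite ler_norml; apply/andP; split; lra.
have h2 : 1 <= 1 + ((b - a) / 2 - `|x - (a + b) / 2|) / delta.
  by rewrite lerDl divr_ge0 ?subr_ge0 // ltW.
by rewrite (min_idPl h2); apply/max_idPr.
Qed.

Lemma trapezoid0 a b delta x : 0 < delta -> (x <= a - delta) || (b + delta <= x) ->
  trapezoid a b delta x = 0.
Proof.
move=> d0 hx; rewrite /trapezoid.
have h : (b - a) / 2 + delta <= `|x - (a + b) / 2|.
  case/orP: hx => hx.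
    by have := ler_norm (- (x - (a + b) / 2)); rewrite normrN; lra.
  by have := ler_norm (x - (a + b) / 2); lra.
apply/max_idPl; rewrite ge_min; apply/orP; right.
have -> : 1 + ((b - a) / 2 - `|x - (a + b) / 2|) / delta =
    ((b - a) / 2 + delta - `|x - (a + b) / 2|) / delta.
  by field; rewrite lt0r_neq0.
by rewrite pmulr_lle0 ?invr_gt0 // subr_le0.
Qed.

Lemma cutoff_bd psi : cutoff psi -> forall x, `|psi x| <= 1.
Proof.
move=> [L [B [_ _ h _]]] x; have /andP[h1 h2] := h x.
by rewrite ger0_norm.
Qed.

Lemma cutoff_cont psi : cutoff psi -> continuous psi.
Proof. by move=> [L [B [_ h _ _]]]; exact: lipschitz_cont h. Qed.

Lemma cutoff_integrable psi : cutoff psi ->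
  mu.-integrable setT (EFin \o (fun x => psi x * p x)).
Proof. by move=> h; exact: integrable_mul_pdf (cutoff_cont h) (cutoff_bd h). Qed.

Lemma gauss_mean_ge0 psi : cutoff psi -> 0 <= gauss_mean psi.
Proof.
move=> [L [B [_ _ h _]]]; apply: Rintegral_ge0 => x _.
by have /andP[h1 h2] := h x; rewrite mulr_ge0 // normal_pdf_ge0.
Qed.

Lemma gauss_mean_le1 psi : cutoff psi -> gauss_mean psi <= 1.
Proof.
move=> hpsi; have [L [B [_ _ h _]]] := hpsi.
have -> : 1 = \int[mu]_x p x by rewrite /Rintegral integral_normal_pdf.
apply: le_Rintegral => //; first exact: cutoff_integrable.
  exact: integrable_normal_pdf.
move=> x _; have /andP[h1 h2] := h x.
by rewrite ler_piMl // normal_pdf_ge0.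
Qed.

Lemma gauss_mean_ge psi a b : cutoff psi -> (forall x, a <= x <= b -> psi x = 1) ->
  fine (gauss `[a, b]) <= gauss_mean psi.
Proof.
move=> hpsi h1; have [L [B [_ _ h _]]] := hpsi.
have mA : @measurable _ (measurableTypeR R) `[a, b] by exact: measurable_itv.
have -> : fine (gauss `[a, b]) = \int[mu]_(x in `[a, b]) p x by [].
rewrite Rintegral_mkcond; apply: le_Rintegral => //; last 2 first.
- exact: cutoff_integrable.
- move=> x _; rewrite patchE; case: ifPn => [|_].
    by rewrite inE /= in_itv /= => /h1 ->; rewrite mul1r.
  by have /andP[h2 _] := h x; rewrite mulr_ge0 // normal_pdf_ge0.
rewrite -restrict_EFin; apply/integrable_restrict => //; rewrite setTI.
exact: integrableS (integrable_normal_pdf 0 1).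
Qed.

(** The multiple of [chi] is chosen to cancel the Gaussian mean, which a compactly supported
    solution requires. *)
Lemma stein_cutoff (psi chi : R -> R) : cutoff psi -> cutoff chi -> gauss_mean chi != 0 ->
  exists phi g : R -> R, exists M : R, stein_test phi g M /\
    forall x, g x - x * phi x = psi x - gauss_mean psi / gauss_mean chi * chi x.
Proof.
move=> hpsi hchi chi0; set k := _ / _.
have [L1 [B1 [B10 l1 b1 z1]]] := hpsi; have [L2 [B2 [B20 l2 b2 z2]]] := hchi.
apply: (@stein_solution R (fun x => psi x - k * chi x) (L1 + `|k| * L2) (1 + `|k|)
  (B1 + B2)).
- move=> x y; have -> : psi x - k * chi x - (psi y - k * chi y) =
    (psi x - psi y) - k * (chi x - chi y) by ring.
  apply: le_trans (ler_normB _ _) _; rewrite mulrDl; apply: lerD; first exact: l1.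
  by rewrite normrM -mulrA ler_wpM2l.
- move=> x; apply: le_trans (ler_normB _ _) _; apply: lerD; first exact: cutoff_bd.
  by rewrite normrM ler_piMr // cutoff_bd.
- by rewrite addr_gt0.
- move=> x Bx; rewrite z1 ?z2 ?mulr0 ?subr0 //; move: Bx; lra.
- rewrite (@gauss_meanB _ _ _ 1 `|k|).
  + rewrite (gauss_meanZ k (cutoff_cont hchi) (cutoff_bd hchi)) /k divfK //.
    exact: subrr.
  + exact: cutoff_cont.
  + by move=> x; apply: cvgM; [exact: cvg_cst|exact: cutoff_cont].
  + exact: cutoff_bd.
  + by move=> x; rewrite normrM ler_piMr // cutoff_bd.
Qed.

End Cutoff.

(** * Inner approximation of Gaussian half-lines by compact intervals *)

Section GaussIntervals.
Variable R : realType.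
Notation gauss := (@normal_prob R 0 1).

Definition Phi (x : R) : R := fine (gauss `]-oo, x]).

Let mitv (i : interval R) : @measurable _ (measurableTypeR R) [set` i].
Proof. exact: measurable_itv. Qed.

Lemma gauss_set1 (x : R) : gauss [set x] = 0%E.
Proof. by rewrite /normal_prob integral_set1. Qed.

Lemma gauss_cvg (F : nat -> set R) (A : set R) :
  (forall k, @measurable _ (measurableTypeR R) (F k)) -> @measurable _ (measurableTypeR R) A ->
  nondecreasing_seq F -> \bigcup_k F k = A ->
  forall e, 0 < e -> exists k, fine (gauss A) - e <= fine (gauss (F k)).
Proof.
move=> mF mA ndF FA e e0.
have h := @nondecreasing_cvg_mu _ _ _ gauss F mF _ ndF.
rewrite FA in h; have {}h := h mA.
have fA : gauss A \is a fin_num by exact: fin_num_measure.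
have h2 : (fine \o (gauss \o F)) @ \oo --> fine (gauss A).
  by apply: fine_cvg; rewrite fineK.
have /cvgrPdist_le /(_ e e0) [k _ hk] := h2.
exists k; have := hk k (leqnn k); rewrite ler_norml /= => /andP[_]; lra.
Qed.

Let inv_dec (k l : nat) : (k <= l)%N -> (l.+1%:R : R)^-1 <= k.+1%:R^-1.
Proof. by move=> kl; rewrite lef_pV2 ?posrE ?ltr0Sn // ler_nat. Qed.

(** Compact intervals exhaust the open half-line, and the endpoint has measure zero. The gap [delta]
    is later shared between the slope of a trapezoid and the movement of the threshold. *)
Lemma gauss_left (x e : R) : 0 < e ->
  exists K delta : R, 0 < delta /\ Phi x - e <= fine (gauss `[K, x - delta]).
Proof.
move=> e0; pose F k := `[- k%:R, x - k.+1%:R^-1]%classic : set R.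
have [||||k hk] := @gauss_cvg F `]-oo, x[ _ _ _ _ e e0.
- by move=> k; exact: mitv.
- exact: mitv.
- move=> k l kl; apply/subsetPset => t; rewrite /F /= !in_itv /= => /andP[h1 h2].
  rewrite (le_trans _ h1) ?lerN2 ?ler_nat //= (le_trans h2) // lerB //.
  exact: inv_dec.
- apply/seteqP; split=> t.
    move=> [k _]; rewrite /F /= !in_itv /= => /andP[_ h].
    by rewrite (le_lt_trans h) // ltrBlDr ltrDl invr_gt0.
  rewrite /= in_itv /= => tx.
  pose k := (Num.truncn `|t| + Num.truncn (x - t)^-1).+1.
  exists k => //; rewrite /F /= in_itv /=; apply/andP; split.
    rewrite lerNl (le_trans (ler_norm _)) // normrN ltW //.
    by apply: lt_le_trans (truncnS_gt _) _; rewrite ler_nat /k ltnS leq_addr.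
  rewrite lerBrDr -lerBrDl -[leRHS]invrK lef_pV2 ?posrE ?invr_gt0 ?subr_gt0 //.
  apply: le_trans (ltW (truncnS_gt _)) _; rewrite ler_nat /k !ltnS.
  by rewrite ltnW // ltnS leq_addl.
exists (- k%:R), (k.+1%:R^-1); split; first by rewrite invr_gt0.
apply: le_trans hk; rewrite lerB // /Phi.
have -> : `]-oo, x]%classic = `]-oo, x[%classic `|` [set x].
  by rewrite (@setUitv1 _ _ -oo%O x true).
by rewrite measureU0 //; exact: gauss_set1.
Qed.

Lemma gauss_right (x e : R) : 0 < e ->
  exists K delta : R, 0 < delta /\ 1 - Phi x - e <= fine (gauss `[x + delta, K]).
Proof.
move=> e0; pose F k := `[x + k.+1%:R^-1, k%:R]%classic : set R.
have [||||k hk] := @gauss_cvg F `]x, +oo[ _ _ _ _ e e0.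
- by move=> k; exact: mitv.
- exact: mitv.
- move=> k l kl; apply/subsetPset => t; rewrite /F /= !in_itv /= => /andP[h1 h2].
  rewrite (le_trans h2) ?ler_nat // andbT (le_trans _ h1) // lerD2l.
  exact: inv_dec.
- apply/seteqP; split=> t.
    move=> [k _]; rewrite /F /= !in_itv /= andbT => /andP[h _].
    by rewrite (lt_le_trans _ h) // ltrDl invr_gt0.
  rewrite /= in_itv /= andbT => tx.
  pose k := (Num.truncn `|t| + Num.truncn (t - x)^-1).+1.
  exists k => //; rewrite /F /= in_itv /=; apply/andP; split.
    rewrite addrC -lerBrDr -[leRHS]invrK lef_pV2 ?posrE ?invr_gt0 ?subr_gt0 //.
    apply: le_trans (ltW (truncnS_gt _)) _; rewrite ler_nat /k !ltnS.
    by rewrite ltnW // ltnS leq_addl.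
  rewrite (le_trans (ler_norm _)) // ltW //.
  by apply: lt_le_trans (truncnS_gt _) _; rewrite ler_nat /k ltnS leq_addr.
exists (k%:R), (k.+1%:R^-1); split; first by rewrite invr_gt0.
apply: le_trans hk; rewrite lerB // /Phi -setCitvl probability_setC; last exact: mitv.
have fA : gauss `]-oo, x] \is a fin_num by exact: fin_num_measure.
have aux (y : \bar R) : y \is a fin_num -> 1 - fine y <= fine (1 - y)%E by case: y.
exact: aux fA.
Qed.

Lemma gauss_tail (e : R) : 0 < e -> exists K : R, 1 <= K /\ 1 - e <= fine (gauss `[- K, K]).
Proof.
move=> e0; pose F k := `[- k.+1%:R, k.+1%:R]%classic : set R.
have [||||k hk] := @gauss_cvg F setT _ _ _ _ e e0.
- by move=> k; exact: mitv.
- exact: measurableT.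
- move=> k l kl; apply/subsetPset => t; rewrite /F /= !in_itv /= => /andP[h1 h2].
  by rewrite (le_trans _ h1) ?lerN2 ?ler_nat ?ltnS //= (le_trans h2) // ler_nat ltnS.
- apply/seteqP; split=> // t _.
  exists (Num.truncn `|t|) => //; rewrite /F /= in_itv /= -ler_norml.
  exact: ltW (truncnS_gt _).
exists k.+1%:R; split; first by rewrite ler1n.
by apply: le_trans hk; rewrite probability_setT.
Qed.

End GaussIntervals.

Lemma cutoff01 (R : realType) (psi : R -> R) x : cutoff psi -> 0 <= psi x <= 1.
Proof. by case=> L [B []]. Qed.

(** * From approximate Stein identities to convergence of distribution functions *)

Section WeakLimit.
(** [E n f] abstracts the expectation of [f(W)]. Total mass 1 is asked only eventually, since for
    small [n] there may be no regular graph, and then the mass is zero. *)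
Variables (R : realType) (E : nat -> (R -> R) -> R).
Notation gauss := (@normal_prob R 0 1).
Notation gauss_mean := (@gauss_mean R).
Hypotheses (E_add : forall n f g, E n (fun x => f x + g x) = E n f + E n g)
  (E_scale : forall n c f, E n (fun x => c * f x) = c * E n f)
  (E_le : forall n f g, (forall x, f x <= g x) -> E n f <= E n g)
  (E_one : \forall n \near \oo, E n (fun=> 1) = 1)
  (E_stein : forall phi g M, stein_test phi g M -> forall e : R, 0 < e ->
     \forall n \near \oo, `|E n (fun x => g x - x * phi x)| <= e).

Let E_sub n f g : E n (fun x => f x - g x) = E n f - E n g.
Proof.
rewrite -[- E n g]mulN1r -E_scale -E_add; congr (E n _).
by apply/funext => x; rewrite mulN1r.
Qed.

(* The test function [atan] has bounded derivative, while [x * atan x] grows linearly. *)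
Lemma tight (e : R) : 0 < e ->
  exists K0 : R, forall K, K0 <= K -> \forall n \near \oo, E n (fun x => (K <= `|x|)%R%:R) <= e.
Proof.
(* The mean of [x * atan x] will be at most 2, one unit from the Stein error and one from the
   derivative of [atan]; Markov's inequality with [K / 2] then gives a tail of at most [4 / K]. *)
move=> e0; exists (1 + 4 / e) => K hK.
have e4 : 0 < 4 / e by rewrite divr_gt0.
have K1 : 1 <= K by lra.
near=> n.
have h1 : `|E n (fun x => (1 + x ^+ 2)^-1 - x * atan x)| <= 1.
  by near: n; exact: E_stein (@stein_test_atan R) _ ltr01.
have E1 : E n (fun=> 1) = 1 by near: n; exact: E_one.
have h2 : E n (fun x => (1 + x ^+ 2)^-1) <= 1.
  rewrite -E1; apply: E_le => x; have x2 := sqr_ge0 x.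
  by rewrite -[leRHS]invr1 lef_pV2 ?posrE //; lra.
have h3 : K / 2 * E n (fun x => (K <= `|x|)%R%:R) <= E n (fun x => x * atan x).
  rewrite -E_scale; apply: E_le => x.
  case: (leP K `|x|) => [Kx|_]; first by rewrite mulr1; exact: atan_mul_ge.
  by rewrite mulr0; exact: atan_mul_ge0.
move: h1; rewrite E_sub ler_norml => /andP[h1 _].
have h4 : K / 2 * E n (fun x => (K <= `|x|)%R%:R) <= 2 by lra.
have Ke : 2 <= K / 2 * e.
  have -> : K / 2 * e = (K * e) / 2 by ring.
  have : 4 <= K * e.
    by rewrite -ler_pdivrMr //; lra.
  by lra.
rewrite -(@ler_pM2l _ (K / 2)); last by rewrite divr_gt0 //; lra.
exact: le_trans h4 Ke.
Unshelve. all: by end_near. Qed.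

(* Stein's equation is solved for [psi] minus the multiple of a wide cutoff [chi] with the
   same mean; by tightness [E chi] is close to 1. *)
Lemma E_cutoff psi (e : R) : cutoff psi -> 0 < e ->
  \forall n \near \oo, `|E n psi - gauss_mean psi| <= e.
Proof.
move=> hpsi e_gt0.
(* The cap [1 / 2] keeps the Gaussian mean of [chi] at least [1 / 2], so dividing by it at most
   doubles an error; the total is [a + 2 a]. *)
pose a : R := Num.min (e / 4) (1 / 2).
have a0 : 0 < a by rewrite lt_min !divr_gt0.
have ae : 4 * a <= e.
  have : a <= e / 4 by rewrite ge_min lexx.
  by lra.
have a2 : a <= 1 / 2 by rewrite ge_min lexx orbT.
have [K0 tK] := tight a0; have [K1 [K11 gK]] := gauss_tail a0.
pose K := Num.max K0 K1.
have KK0 : K0 <= K by rewrite le_max lexx.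
have KK1 : K1 <= K by rewrite le_max lexx orbT.
pose chi := trapezoid (- K) K 1.
have hchi : cutoff chi by exact: trapezoid_cutoff.
have Ichi : 1 - a <= gauss_mean chi.
  apply: le_trans gK _; apply: gauss_mean_ge hchi _ => x /andP[x1 x2].
  by apply: trapezoid1 => //; apply/andP; split; lra.
have Ichi1 := gauss_mean_le1 hchi.
have chi0 : gauss_mean chi != 0 by apply: lt0r_neq0; lra.
have [phi [g [M [ht hq]]]] := stein_cutoff hpsi hchi chi0.
near=> n.
have E1 : E n (fun=> 1) = 1 by near: n; exact: E_one.
have h1 : `|E n psi - gauss_mean psi / gauss_mean chi * E n chi| <= a.
  rewrite -E_scale -E_sub.
  have <- : (fun x => g x - x * phi x) =
     (fun x => psi x - gauss_mean psi / gauss_mean chi * chi x).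
    by apply/funext => x; exact: hq.
  by near: n; exact: E_stein ht _ a0.
have h2 : E n (fun x => (K <= `|x|)%R%:R) <= a by near: n; exact: tK.
have h3 : 1 - a <= E n chi.
  have : E n (fun=> 1) <= E n (fun x => chi x + (K <= `|x|)%R%:R).
    apply: E_le => x; case: (leP K `|x|) => Kx.
      by rewrite lerDr; have /andP[] := cutoff01 x hchi.
    rewrite addr0 /chi trapezoid1 // -ler_norml; exact: ltW.
  by rewrite E_add E1; lra.
have h4 : E n chi <= 1.
  rewrite -E1; by apply: E_le => x; have /andP[] := cutoff01 x hchi.
have I0 := gauss_mean_ge0 hpsi; have I1 := gauss_mean_le1 hpsi.
set I := gauss_mean psi in h1 I0 I1 *; set J := gauss_mean chi in h1 Ichi Ichi1 chi0.
have J0 : 0 < J by lra.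
have h5 : `|I / J * E n chi - I| <= 2 * a.
  have -> : I / J * E n chi - I = I * ((E n chi - J) / J) by field.
  rewrite normrM (ger0_norm I0); apply: le_trans (_ : `|(E n chi - J) / J| <= _).
    by rewrite ler_piMl.
  rewrite normrM normfV (gtr0_norm J0) ler_pdivrMr //.
  have : `|E n chi - J| <= a by rewrite ler_norml; apply/andP; split; lra.
  move=> h; apply: le_trans h _.
  have : 0 <= a * (2 * J - 1) by rewrite mulr_ge0 //; lra.
  by lra.
have := ler_normD (E n psi - I / J * E n chi) (I / J * E n chi - I).
have -> : E n psi - I / J * E n chi + (I / J * E n chi - I) = E n psi - I by ring.
by lra.
Unshelve. all: by end_near. Qed.

(** Cutoffs have compact support, so a half-line cannot be dominated by one; the upper bound uses a
    cutoff to the right of [x] and total mass 1. Half of each gap is spent on the slope and half on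
    the distance from [xs n] to [x]. *)
Lemma E_cdf (x e : R) (xs : nat -> R) : xs @ \oo --> x -> 0 < e ->
  \forall n \near \oo, `|E n (fun y => (y <= xs n)%R%:R) - Phi x| <= e.
Proof.
move=> hx e0; have e2 : 0 < e / 2 by rewrite divr_gt0.
have [K1 [d1 [d10 g1]]] := gauss_left x e2.
have [K2 [d2 [d20 g2]]] := gauss_right x e2.
have d12 : 0 < d1 / 2 by rewrite divr_gt0.
have d22 : 0 < d2 / 2 by rewrite divr_gt0.
pose psi1 := trapezoid K1 (x - d1) (d1 / 2).
pose psi2 := trapezoid (x + d2) K2 (d2 / 2).
have c1 : cutoff psi1 by exact: trapezoid_cutoff.
have c2 : cutoff psi2 by exact: trapezoid_cutoff.
have i1 := gauss_mean_ge c1 (fun y h => trapezoid1 d12 h).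
have i2 := gauss_mean_ge c2 (fun y h => trapezoid1 d22 h).
near=> n.
have E1 : E n (fun=> 1) = 1 by near: n; exact: E_one.
have h1 : `|E n psi1 - gauss_mean psi1| <= e / 2 by near: n; exact: E_cutoff.
have h2 : `|E n psi2 - gauss_mean psi2| <= e / 2 by near: n; exact: E_cutoff.
have x1 : `|x - xs n| <= d1 / 2 by near: n; move/cvgrPdist_le : hx; exact.
have x2 : `|x - xs n| < d2 / 2 by near: n; move/cvgrPdist_lt : hx; exact.
have l1 : E n psi1 <= E n (fun y => (y <= xs n)%R%:R).
  apply: E_le => y; have /andP[y0 y1] := cutoff01 y c1.
  case: (leP y (xs n)) => // yx.
  rewrite /psi1 trapezoid0 //; apply/orP; right.
  by move: x1; rewrite ler_norml => /andP[]; lra.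
have l2 : E n (fun y => (y <= xs n)%R%:R) <= E n (fun y => 1 - psi2 y).
  apply: E_le => y; have /andP[y0 y1] := cutoff01 y c2.
  case: (leP y (xs n)) => yx; last by rewrite subr_ge0.
  rewrite /psi2 trapezoid0 ?subr0 //; apply/orP; left.
  by move: x2; rewrite ltr_norml => /andP[]; lra.
move: l2; rewrite E_sub E1 => l2.
move: h1 h2; rewrite !ler_norml => /andP[h1 _] /andP[h2 _].
by apply/andP; split; lra.
Unshelve. all: by end_near. Qed.

End WeakLimit.

(** * Existence of regular graphs *)

Section Circulant.
Variables (m d : nat) (S : {set 'I_m.+1}).
Hypotheses (S0 : 0 \notin S) (SN : forall i, (- i \in S) = (i \in S)) (Sd : #|S| = d).

Lemma circulant_reg : [ffun p : 'I_m.+1 * 'I_m.+1 => p.2 - p.1 \in S] \in reg_graphs m.+1 d.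
Proof.
rewrite inE; apply/andP; split; first (apply/andP; split).
- by apply/forallP => i; apply/forallP => j; rewrite !ffunE /= -SN opprB.
- by apply/forallP => i; rewrite ffunE /= subrr.
apply/forallP => i; apply/eqP.
rewrite -Sd -[RHS](card_imset _ (@addIr _ i)); apply: eq_card => j.
rewrite !inE ffunE /=; apply/idP/imsetP => [h|[k hk ->]]; last by rewrite addrK.
by exists (j - i); rewrite ?subrK.
Qed.

End Circulant.

Lemma card_Iio n a : (a <= n)%N -> #|[set i : 'I_n | (i < a)%N]%SET| = a.
Proof.
move=> an; rewrite -sum1_card (eq_bigl (fun i : 'I_n => (i < a)%N)); last by move=> i; rewrite inE.
by rewrite -(big_ord_widen n (fun=> 1%N)) // sum_nat_const card_ord muln1.
Qed.

Lemma card_nat_set n (a b : nat) : (a <= b <= n)%N ->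
  #|[set i : 'I_n | (a <= i < b)%N]%SET| = (b - a)%N.
Proof.
case/andP=> ab bn.
have -> : [set i : 'I_n | (a <= i < b)%N]%SET =
  ([set i : 'I_n | (i < b)%N] :\: [set i : 'I_n | (i < a)%N])%SET.
  by apply/setP => i; rewrite !inE -leqNgt.
rewrite cardsD (_ : _ :&: _ = [set i : 'I_n | (i < a)%N]%SET)%SET; last first.
  by apply/setP => i; rewrite !inE; apply/andb_idl => h; exact: leq_trans ab.
by rewrite !card_Iio // (leq_trans ab).
Qed.

(** A circulant graph: each vertex is joined to the [d./2] nearest ones on either side and, for odd
    [d], to its antipode, which exists because [n] is then even. *)
Lemma reg_graphs_gt0 n d : (d < n)%N -> ~~ odd (d * n) -> (0 < #|reg_graphs n d|)%N.
Proof.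
case: n => // m dn od; apply/card_gt0P.
pose e := d./2.
have dE : d = (odd d + e.*2)%N by rewrite odd_double_half.
pose S : {set 'I_m.+1} := [set i : 'I_m.+1 | [|| (1 <= i < e.+1), (m.+1 - e <= i < m.+1)
   | odd d && (i == m.+1./2 :> nat)]%N]%SET.
exists [ffun p : 'I_m.+1 * 'I_m.+1 => p.2 - p.1 \in S]; apply: circulant_reg.
- by rewrite /S inE /=; lia.
- move=> i; rewrite /S !inE /=.
  case: i => i im /=.
  have [->|i0] := posnP i; first by rewrite subn0 modnn.
  rewrite modn_small; last by lia.
  lia.
pose T : {set 'I_m.+1} := [set i : 'I_m.+1 | odd d && (i == m.+1./2 :> nat)]%SET.
have -> : S = ([set i : 'I_m.+1 | (1 <= i < e.+1)%N] :|:
    [set i : 'I_m.+1 | (m.+1 - e <= i < m.+1)%N] :|: T)%SET.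
  by apply/setP => i; rewrite /S /T !inE orbA.
have cT : #|T| = odd d.
  rewrite /T; case odd_d : (odd d) => /=; last by apply: eq_card0 => i; rewrite inE.
  have h : (m.+1./2 < m.+1)%N by lia.
  by rewrite -(cards1 (Ordinal h)); apply: eq_card => i; rewrite !inE.
rewrite cardsU cardsU !card_nat_set ?cT; [|lia|lia].
rewrite [X in (_ - #|pred_of_set X|)%N](_ : _ = finset.set0); last first.
  by apply/setP => i; rewrite /T !inE; case: i => i im /=; lia.
rewrite [X in (_ - #|pred_of_set X| + _ - _)%N](_ : _ = finset.set0); last first.
  by apply/setP => i; rewrite !inE; case: i => i im /=; lia.
by rewrite cards0; lia.
Qed.

(** * Triangles as ordered triples *)

Lemma triples_of_3set (T : finType) (S : {set T}) : #|S| = 3%N ->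
  (\sum_(x : T) \sum_(z : T) \sum_(y : T)
     ((x \in S) && ((z \in S :\ x) && (y \in S :\ x :\ z))%SET) = 6)%N.
Proof.
move=> S3.
have c1 x : x \in S -> #|S :\ x|%SET = 2%N.
  by move=> xS; have := cardsD1 x S; rewrite S3 xS => -[].
have c2 x z : x \in S -> (z \in S :\ x)%SET -> #|S :\ x :\ z|%SET = 1%N.
  by move=> xS zS; have := cardsD1 z (S :\ x)%SET; rewrite c1 // zS => -[].
have sumA (A : {set T}) (f : T -> nat) k : (forall i, i \in A -> f i = k) ->
    (forall i, i \notin A -> f i = 0%N) -> (\sum_i f i = #|A| * k)%N.
  move=> h1 h2; rewrite (bigID (mem A)) /= addnC big1 // add0n.
  by rewrite -sum_nat_const; exact: eq_bigr.
rewrite (sumA S _ 2%N) ?S3 // => [x xS|x /negbTE xS]; last first.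
  by rewrite big1 // => z _; rewrite big1 // => y _; rewrite xS.
rewrite (sumA (S :\ x)%SET _ 1%N) ?c1 // => z zS; last first.
  by rewrite big1 // => y _; rewrite (negbTE zS) andbF.
rewrite (sumA (S :\ x :\ z)%SET _ 1%N) ?c2 // => y yS; first by rewrite xS zS yS.
by rewrite (negbTE yS) !andbF.
Qed.

(** Double counting of pairs formed by a triangle and an ordering of its three vertices. *)
Lemma num_triangles_ordered n (G : graph n) : is_simple G ->
  (\sum_x \sum_z \sum_y [&& G (x, z), G (z, y) & G (y, x)] = 6 * num_triangles G)%N.
Proof.
case/andP => /forallP sym /forallP irr.
have symG x y : G (x, y) = G (y, x) by have /forallP/(_ y)/eqP := sym x.
pose Tr := [set S : {set 'I_n} | (#|S| == 3)%N &&
   [forall i in S, forall j in S, (i != j) ==> G (i, j)]]%SET.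
transitivity (\sum_(S in Tr) 6)%N; last by rewrite sum_nat_const mulnC.
transitivity (\sum_x \sum_z \sum_y \sum_(S in Tr)
   [&& x \in S, z \in S :\ x & y \in S :\ x :\ z]%SET)%N; last first.
  under eq_bigr do under eq_bigr do rewrite exchange_big.
  under eq_bigr do rewrite exchange_big.
  rewrite exchange_big; apply: eq_bigr => S; rewrite inE => /andP[/eqP S3 _].
  exact: triples_of_3set.
apply: eq_bigr => x _; apply: eq_bigr => z _; apply: eq_bigr => y _.
pose S0 : {set 'I_n} := [set x; z; y]%SET.
case: (boolP (uniq [:: x; z; y])) => U; last first.
  rewrite big1 => [|S _].
    apply/eqP; rewrite eqb0; apply: contra U => /and3P[xz zy yx].
    rewrite /= !inE negb_or !andbT; apply/andP; split; first (apply/andP; split).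
    - by apply: contraTneq xz => ->; exact: irr.
    - by apply: contraTneq yx => ->; exact: irr.
    - by apply: contraTneq zy => ->; exact: irr.
  apply/eqP; rewrite eqb0; apply: contra U; rewrite !inE => /and3P[_ /andP[zx _] /and3P[yz yx _]].
  by rewrite /= !inE negb_or !(eq_sym x) zx yx eq_sym yz.
have [xz xy zy] : [/\ x != z, x != y & z != y].
  by move: U; rewrite /= !inE negb_or => /and3P[/andP[]].
have cS0 : #|S0| = 3%N.
  by rewrite (eq_card (_ : S0 =i [:: x; z; y])) ?(card_uniqP U) // => i; rewrite !inE orbA.
have memS (S : {set 'I_n}) : #|S| = 3%N ->
    [&& x \in S, z \in S :\ x & y \in S :\ x :\ z]%SET = (S == S0).
  move=> S3; apply/idP/eqP => [|->]; last first.
    by rewrite !inE !eqxx !orbT /= eq_sym xz eq_sym zy eq_sym xy.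
  rewrite !inE => /and3P[xS /andP[_ zS] /and3P[_ _ yS]].
  apply/esym/eqP; rewrite eqEcard S3 cS0 leqnn andbT.
  by apply/fintype.subsetP => i; rewrite !inE => /orP[/orP[]|] /eqP ->.
transitivity (S0 \in Tr : nat).
  congr nat_of_bool; rewrite inE cS0 eqxx /=; apply/idP/idP => [/and3P[Gxz Gzy Gyx]|].
    have [Gzx Gyz Gxy] : [/\ G (z, x), G (y, z) & G (x, y)] by split; rewrite symG.
    apply/forall_inP => i; rewrite !inE => /orP[/orP[]|] /eqP ->;
      by apply/forall_inP => j; rewrite !inE => /orP[/orP[]|] /eqP ->;
        rewrite ?eqxx //; apply/implyP.
  move=> /forall_inP h; have G0 i j : i \in S0 -> j \in S0 -> i != j -> G (i, j).
    by move=> iS jS; apply/implyP; have /forall_inP := h i iS; apply.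
  by rewrite !G0 ?inE ?eqxx ?orbT // eq_sym.
rewrite (bigID (pred1 S0)) /= [X in (_ + X)%N]big1 => [|S /andP[]]; last first.
  by rewrite inE => /andP[/eqP/memS -> _ /negbTE ->].
rewrite addn0; case: (boolP (S0 \in Tr)) => h.
  rewrite (big_pred1 S0) ?memS ?eqxx // => S /=.
  by rewrite andb_idl // => /eqP ->.
by rewrite big_pred0 // => S; apply: contraNF h => /andP[? /eqP <-].
Qed.

(** * The limit theorem *)

Lemma Gnd_probE (R : realType) n d (A : graph n -> bool) :
  Gnd_prob n d A = Gnd_expect n d (fun G => (A G)%:R) :> R.
Proof.
rewrite /Gnd_prob /Gnd_expect; congr (_ / _).
rewrite -sum1_card natr_sum big_mkcond [RHS]big_mkcond; apply: eq_bigr => G _.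
by rewrite inE; case: (G \in _) => //=; case: (A G).
Qed.

Lemma num_trianglesE (R : realType) n d (G : graph n) : G \in reg_graphs n d ->
  (num_triangles G)%:R = cyc R 2 G / 6.
Proof.
move=> hG; have simG : is_simple G by move: hG; rewrite inE => /andP[].
have h : cyc R 2 G = 6 * (num_triangles G)%:R.
  rewrite (cyc2E R hG) -natrM -num_triangles_ordered // natr_sum.
  by apply: eq_bigr => x _; rewrite natr_sum; apply: eq_bigr => z _; rewrite natr_sum.
by rewrite h; field.
Qed.

Section Asymptotics.
Variables (R : realType) (d : nat -> nat).
Hypotheses (d_even : forall n : nat, ~~ odd (d n * n)%N)
  (d_sqrt : exists C : R, exists N : nat, forall n : nat, (N <= n)%N ->
      (d n)%:R <= C * Num.sqrt (n%:R))
  (d_infty : forall M : nat, exists N : nat, forall n : nat, (N <= n)%N -> (M <= d n)%N).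

Lemma d_ge (c : R) : \forall n \near \oo, c <= (d n)%:R.
Proof.
have [N hN] := d_infty (Num.truncn c).+1; exists N => // n /= Nn.
by apply: le_trans (ltW (truncnS_gt c)) _; rewrite ler_nat; exact: hN.
Qed.

Lemma regular_regime : exists C : R, 1 <= C /\ \forall n \near \oo,
  [/\ (0 < #|reg_graphs n (d n)|)%N, (20 <= d n)%N, (4 * (d n + 1) + 80 <= n)%N &
      (d n)%:R ^+ 2 <= C * n%:R].
Proof.
have [C0 [N0 hN]] := d_sqrt.
pose C := 1 + C0 ^+ 2.
have C1 : 1 <= C by rewrite lerDl sqr_ge0.
exists C; split=> //; near=> n.
(* From [8 C <= d] and [d^2 <= C n] follows [8 d <= n]; with [21 <= d] this gives
   [4 (d + 1) + 80 <= 8 d <= n]. *)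
have h1 : 8 * C + 21 <= (d n)%:R by near: n; exact: d_ge.
have h2 : (d n)%:R <= C0 * Num.sqrt n%:R by near: n; exists N0.
have h3 : (d n)%:R ^+ 2 <= C * n%:R.
  apply: le_trans (_ : (C0 * Num.sqrt n%:R) ^+ 2 <= _).
    by rewrite ler_sqr ?nnegrE // (le_trans _ h2).
  by rewrite exprMn sqr_sqrtr // mulrDl mul1r lerDr.
have h4 : 8 * (d n)%:R <= n%:R :> R.
  have C0' : 0 < C by lra.
  rewrite -(ler_pM2l C0'); apply: le_trans h3.
  by rewrite expr2 mulrA ler_wpM2r //; lra.
have d21 : (21 <= d n)%N by rewrite -(ler_nat R); lra.
have h5 : (8 * d n <= n)%N by rewrite -(ler_nat R) natrM.
split => //.
- by apply: reg_graphs_gt0 => //; lia.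
- by lia.
- by lia.
Unshelve. all: by end_near. Qed.

Let E (n : nat) (f : R -> R) : R := Gnd_expect n (d n) (fun G => f (Wst R (d n) G)).

Let E_add n f g : E n (fun x => f x + g x) = E n f + E n g.
Proof. exact: ExD. Qed.

Let E_scale n c f : E n (fun x => c * f x) = c * E n f.
Proof. exact: ExZ. Qed.

Let E_le n f g : (forall x, f x <= g x) -> E n f <= E n g.
Proof. by move=> fg; apply: ler_Ex => G _. Qed.

Let E_one : \forall n \near \oo, E n (fun=> 1) = 1.
Proof.
have [C [_ hC]] := regular_regime.
near=> n; apply: Ex_cst.
have : [/\ (0 < #|reg_graphs n (d n)|)%N, (20 <= d n)%N, (4 * (d n + 1) + 80 <= n)%N &
      (d n)%:R ^+ 2 <= C * n%:R] by near: n.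
by case.
Unshelve. all: by end_near. Qed.

Let E_stein phi g M : stein_test phi g M -> forall e : R, 0 < e ->
  \forall n \near \oo, `|E n (fun x => g x - x * phi x)| <= e.
Proof.
move=> ht e e0; have [C [C1 hC]] := regular_regime.
have [K hK] : exists K : R, 2801 <= K by exists 2801.
pose B := K * C ^+ 2 * M.
near=> n.
have [Reg_gt0 d20 dn dC] : [/\ (0 < #|reg_graphs n (d n)|)%N, (20 <= d n)%N,
   (4 * (d n + 1) + 80 <= n)%N & (d n)%:R ^+ 2 <= C * n%:R] by near: n.
have hB : (B / e) ^+ 2 <= (d n)%:R by near: n; exact: d_ge.
rewrite /E ExB distrC.
apply: le_trans (stein_bound Reg_gt0 d20 dn C1 dC hK ht) _.
have s0 : 0 < Num.sqrt (d n)%:R :> R by rewrite sqrtr_gt0 ltr0n (leq_trans _ d20).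
rewrite -/B ler_pdivrMr // mulrC -ler_pdivrMr //.
apply: le_trans (ler_norm _) _.
by rewrite -sqrtr_sqr ler_sqrt.
Unshelve. all: by end_near. Qed.

Let mu n : R := mu_C3 n (d n).
Let s n := scale R (d n).

(** The Stein bound for the constant [phi = 1], with [g = 0], says that the mean of [W] tends to
    zero. *)
Lemma mu_center : (fun n => (mu n - center R n (d n)) / s n) @ \oo --> (0 : R).
Proof.
apply/cvgrPdist_le => e e0.
have [C [C1 hC]] := regular_regime.
have h : \forall n \near \oo, `|E n (fun x => 0 - x * 1)| <= e.
  apply: (E_stein (M := 1)) e0; split=> [x|x y|x|x y|x y].
  - by rewrite normr1.
  - by rewrite subrr normr0 mulr_ge0.
  - by rewrite normr0.
  - by rewrite subrr normr0 mulr_ge0.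
  - by rewrite subrr mul0r subrr normr0 mulr_ge0 // sqr_ge0.
near=> n.
have [Reg_gt0 d20 dn dC] : [/\ (0 < #|reg_graphs n (d n)|)%N, (20 <= d n)%N,
   (4 * (d n + 1) + 80 <= n)%N & (d n)%:R ^+ 2 <= C * n%:R] by near: n.
have -> : 0 - (mu n - center R n (d n)) / s n = E n (fun x => 0 - x * 1); last by near: n.
rewrite /E ExB Ex_cst // !sub0r ExZr mulr1; congr (- _).
rewrite /mu /mu_C3 /Wst ExZr ExB Ex_cst //.
by rewrite (eq_Ex (fun G hG => num_trianglesE R hG)).
Unshelve. all: by end_near. Qed.

(** [cyc_weak] with [h = 1] and [m = 2] bounds the distance from six times the mean to [d^3] by
    [139 C d^2]. *)
Lemma mu_scale : (fun n => mu n / s n ^+ 2) @ \oo --> (1 : R).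
Proof.
apply/cvgrPdist_le => e e0.
have [C [C1 hC]] := regular_regime.
near=> n.
have [Reg_gt0 d20 dn dC] : [/\ (0 < #|reg_graphs n (d n)|)%N, (20 <= d n)%N,
   (4 * (d n + 1) + 80 <= n)%N & (d n)%:R ^+ 2 <= C * n%:R] by near: n.
have he : 139 * C / e <= (d n)%:R by near: n; exact: d_ge.
have D0 : 0 < (d n)%:R :> R by rewrite ltr0n (leq_trans _ d20).
have := @cyc_weak R n (d n) C Reg_gt0 d20 dn C1 dC 2 1 (fun=> 1) isT ler01
  (fun _ _ => ltac:(by rewrite normr1))
  (fun _ _ _ _ => ltac:(by rewrite subrr normr0 mulr_ge0 // divr_ge0)).
rewrite ExZ mul1r ExB Ex_cst // => h.
have m6 : mu n = Gnd_expect n (d n) (fun G => cyc R 2 G) / 6.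
  by rewrite /mu /mu_C3 (eq_Ex (fun G hG => num_trianglesE R hG)) ExZr.
have -> : 1 - mu n / s n ^+ 2 =
  - (Gnd_expect n (d n) (fun G => cyc R 2 G) - (d n)%:R ^+ 3) / (d n)%:R ^+ 3.
  by rewrite /s scale_sqr m6; field; rewrite lt0r_neq0.
rewrite normrM normrN normfV (ger0_norm (exprn_ge0 _ (ltW D0))) ler_pdivrMr ?exprn_gt0 //.
apply: le_trans h _.
move: he; rewrite ler_pdivrMr // => he.
have := ler_wpM2r (sqr_ge0 (d n)%:R) he.
by lra.
Unshelve. all: by end_near. Qed.

(** The change of centring and scaling is moved into the threshold: the event becomes [W <= xs n],
    and [xs n] tends to [x] by [mu_center] and [mu_scale]. *)
Lemma prob_cvg (x : R) : (fun n : nat => Gnd_prob n (d n)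
    (fun G => ((num_triangles G)%:R - mu n) / Num.sqrt (mu n) <= x)) @ \oo --> Phi x.
Proof.
pose xs n := (mu n - center R n (d n)) / s n + x * Num.sqrt (mu n / s n ^+ 2).
have hxs : xs @ \oo --> x.
  rewrite -[X in _ --> X](_ : 0 + x * Num.sqrt 1 = x); last by rewrite sqrtr1 mulr1 add0r.
  apply: cvgD; first exact: mu_center.
  apply: cvgM; first exact: cvg_cst.
  exact: (@cvg_comp _ _ _ _ Num.sqrt _ _ _ mu_scale (@sqrt_continuous R 1)).
apply/cvgrPdist_le => e e0.
have [C [C1 hC]] := regular_regime.
have hE := E_cdf E_add E_scale E_le E_one E_stein hxs e0.
near=> n.
have [Reg_gt0 d20 dn dC] : [/\ (0 < #|reg_graphs n (d n)|)%N, (20 <= d n)%N,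
   (4 * (d n + 1) + 80 <= n)%N & (d n)%:R ^+ 2 <= C * n%:R] by near: n.
have s0 : 0 < s n by exact: scale_gt0.
have mu0 : 0 < mu n.
  have : `|1 - mu n / s n ^+ 2| < 1 by near: n; move/cvgrPdist_lt: mu_scale; apply.
  rewrite ltr_distlC subrr => /andP[+ _].
  by rewrite pmulr_lgt0 // invr_gt0 exprn_gt0.
have -> : Gnd_prob n (d n) (fun G => ((num_triangles G)%:R - mu n) / Num.sqrt (mu n) <= x) =
   E n (fun y => (y <= xs n)%R%:R).
  rewrite Gnd_probE; apply: eq_Ex => G hG; congr ((nat_of_bool _)%:R).
  rewrite (num_trianglesE R hG) ler_pdivrMr ?sqrtr_gt0 //.
  rewrite /Wst ler_pdivrMr // /xs mulrDl divfK ?lt0r_neq0 //.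
  rewrite (sqrtrM _ (ltW mu0)) (sqrtrV (exprn_ge0 2 (ltW s0))) sqrtr_sqr gtr0_norm //.
  rewrite -/(s n) -(mulrA x) divfK ?lt0r_neq0 //.
  by apply/idP/idP; lra.
by rewrite distrC; near: n.
Unshelve. all: by end_near. Qed.

End Asymptotics.

Theorem theorem2p6 (R : realType) (d : nat -> nat) :
  (forall n : nat, ~~ odd (d n * n)%N) ->
  (exists C : R, exists N : nat, forall n : nat, (N <= n)%N ->
      (d n)%:R <= C * Num.sqrt (n%:R)) ->
  (forall M : nat, exists N : nat, forall n : nat, (N <= n)%N -> (M <= d n)%N) ->
  forall x : R,
    (fun n : nat =>
       (Gnd_prob n (d n)
          (fun G => ((num_triangles G)%:R - mu_C3 n (d n)) /
                      Num.sqrt (mu_C3 n (d n)) <= x))%:E)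
      @ \oo --> std_normal_cdf x.
Proof.
move=> d_even d_sqrt d_infty x.
have -> : std_normal_cdf x = (Phi x)%:E.
  by rewrite /std_normal_cdf /Phi fineK // fin_num_measure.
apply: cvg_EFin; first by near=> n.
exact: prob_cvg.
Unshelve. all: by end_near. Qed.
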